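(* Assume $K$ has characteristic $0$. Let $2\le e\le n$ and $d\ge 4$ be integers and let $C\subset\mathbb{P}^n$ be the rational normal curve of degree $e$. Let $V$ be a vector bundle on $\mathbb{P}^1$ of one of the following two forms: (i) $V=\left(\bigoplus_{i=1}^{e-2}\mathcal{O}(e+2-a_i)\right)\oplus\left(\bigoplus_{j=e+1}^{n}\mathcal{O}(e-b_j)\right)$ with integers $a_i,b_j\ge 0$ and $\sum_{i=1}^{e-2}a_i+\sum_{j=e+1}^{n}b_j=e(d-1)-2$; (ii) $e<n-1$ and $V=\mathcal{O}(e+2)^{e-1}\oplus\left(\bigoplus_{j=e+2}^{n}\mathcal{O}(e-b_j)\right)$ with integers $b_j\ge 0$ and $\sum_{j=e+2}^{n}b_j=e(d-1)$. Then there exists a smooth hypersurface $X\subset\mathbb{P}^n$ of degree $d$ containing $C$ with normal bundle $N_{C/X}\cong V$.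
   Context: $K$ is an algebraically closed field. With homogeneous coordinates $x_0,\dots,x_n$ on $\mathbb{P}^n$ over $K$ and $e\le n$, the rational normal curve of degree $e$ in $\mathbb{P}^n$ is the image $C$ of $\mathbb{P}^1\to\mathbb{P}^n$, $(s:t)\mapsto(s^e:s^{e-1}t:\cdots:st^{e-1}:t^e:0:\cdots:0)$. The normal bundle $N_{C/X}$ is regarded as a vector bundle on $\mathbb{P}^1\cong C$, and $\mathcal{O}(k)=\mathcal{O}_{\mathbb{P}^1}(k)$. Empty sums are $0$ and empty direct sums are zero. *)

(* Defs.v *)
From HB Require Import structures.
From mathcomp Require Import all_boot all_order all_algebra.
From mathcomp Require Import mpoly.

Set Implicit Arguments.
Unset Strict Implicit.
Unset Printing Implicit Defensive.

Import GRing.Theory.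
Local Open Scope ring_scope.

Notation "x %:F" := (tofrac x) : ring_scope.

(* (s^e : s^(e-1) t : ... : t^e : 0 : ... : 0); used both at points of K^2 and
   at the two variables s = 'X_0, t = 'X_1 of the coordinate ring of P^1. *)
Definition rnc (A : nzRingType) (e n : nat) (s t : A) (i : 'I_n.+1) : A :=
  if (i <= e)%N then s ^+ (e - i) * t ^+ i else 0.

Section RationalNormalCurve.

Variables (K : closedFieldType) (e n : nat).

(* The equations of the image C of P^1. *)
Definition vanishes_on_rnc (G : {mpoly K[n.+1]}) : Prop :=
  forall s t : K, (s, t) != (0, 0) -> G.@[rnc e s t] = 0.

(* G |-> G(s^e, s^(e-1) t, ..., t^e, 0, ..., 0) in K[s, t]. *)
Definition rnc_pullback (G : {mpoly K[n.+1]}) : {mpoly K[2]} :=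
  G \mPo [tuple rnc e ('X_ord0 : {mpoly K[2]}) 'X_ord_max i | i < n.+1].

(* The Jacobian criterion for the hypersurface F = 0 (K is algebraically
   closed). *)
Definition smooth_hypersurface (d : nat) (F : {mpoly K[n.+1]}) : Prop :=
  [/\ F \is d.-homog, F != 0 &
      forall p : 'I_n.+1 -> K, (exists i, p i != 0) -> F.@[p] = 0 ->
        exists i, (mderiv i F).@[p] != 0].

(* [hloc M g k] is the degree k part of the localisation M[1/g], as a subset of
   the fraction field, where M is a homogeneous ideal of K[x_0, ..., x_(m-1)]
   and g is a nonzero form. *)
Definition hloc (m : nat) (M : {mpoly K[m]} -> Prop) (g : {mpoly K[m]})
    (k : int) (x : {fraction {mpoly K[m]}}) : Prop :=
  exists j c dg : nat, exists a : {mpoly K[m]},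
    [/\ M a, a \is c.-homog, g \is dg.-homog, c%:Z = k + (j * dg)%N%:Z
      & x = a%:F / g%:F ^+ j].

(* The affine opens D_+(g) of P^n that meet C.  Their traces on C form a basis
   of the nonempty opens of C = P^1; the trace of D_+(g) is the set of points
   (s : t) where [rnc_pullback g] does not vanish. *)
Record basic_open := BasicOpen {
  eqn :> {mpoly K[n.+1]};
  eqn_homog : exists2 m : nat, (0 < m)%N & eqn \is m.-homog;
  eqn_meets : rnc_pullback eqn != 0
}.

(* If eqn U divides eqn U', then D_+(eqn U') is contained in D_+(eqn U); any
   two basic opens have a common refinement D_+(g g') for this relation. *)
Definition refines (U' U : basic_open) : Prop :=
  exists q : {mpoly K[n.+1]}, eqn U' = eqn U * q.

(* Sections of O_{P^1}(k) over the trace of U on C = P^1. *)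
Definition OP1 (k : int) (U : basic_open) : {fraction {mpoly K[2]}} -> Prop :=
  hloc (fun=> True) (rnc_pullback U) k.

(* A presheaf of O_{P^1}-modules on the basis of traces.  The sections over U
   are the elements of [car] satisfying [sec U], up to the equality [eqs U];
   [res U U' x x'] means that x' is the restriction to U' of x. *)
Record omodule := OModule {
  car : Type;
  sec : basic_open -> car -> Prop;
  eqs : basic_open -> car -> car -> Prop;
  add : car -> car -> car;
  scale : {fraction {mpoly K[2]}} -> car -> car;
  res : basic_open -> basic_open -> car -> car -> Prop
}.

Definition isomorphic (M N : omodule) : Prop :=
  exists Phi : basic_open -> car M -> car N,
  [/\ (forall U x, sec U x -> sec U (Phi U x)),
      (forall U x y, sec U x -> sec U y ->
         eqs U x y <-> eqs U (Phi U x) (Phi U y)),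
      (forall U y, sec U y -> exists2 x, sec U x & eqs U (Phi U x) y) &
  [/\ (forall U x y, sec U x -> sec U y ->
         eqs U (Phi U (add x y)) (add (Phi U x) (Phi U y))),
      (forall U c x, OP1 0 U c -> sec U x ->
         eqs U (Phi U (scale c x)) (scale c (Phi U x))) &
      (forall U U' x x', refines U' U -> sec U x -> sec U' x' ->
         res U U' x x' -> res U U' (Phi U x) (Phi U' x'))]].

(* The direct sum of the O(k_i), for the list k of the k_i. *)
Definition split_bundle (k : seq int) : omodule :=
  @OModule ('I_(size k) -> {fraction {mpoly K[2]}})
    (fun U v => forall i : 'I_(size k), OP1 (nth 0 k i) U (v i))
    (fun _ v w => forall i, v i = w i)
    (fun v w i => v i + w i)
    (fun c v i => c * v i)
    (fun _ _ v v' => forall i, v' i = v i).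

Section NormalBundle.

Variable F : {mpoly K[n.+1]}.

(* S_(g) acts on O_{P^1}(U) through p / g^j |-> rnc_pullback p /
   (rnc_pullback g)^j; with I the ideal of C in P^n, a section of the normal
   bundle Hom(I_{C/X} / I_{C/X}^2, O_C) of C in X = {F = 0} is an S_(g)-linear
   map I_(g) -> O_{P^1}(U) that factors through I_{C/X} = I / (F).  Such a map
   kills I^2 automatically, because I acts as 0 on O_C. *)
Definition normal_section (U : basic_open)
    (phi : {fraction {mpoly K[n.+1]}} -> {fraction {mpoly K[2]}}) : Prop :=
  let I := hloc vanishes_on_rnc U 0 in
  [/\ (forall x, I x -> OP1 0 U (phi x)),
      (forall x y, I x -> I y -> phi (x + y) = phi x + phi y),
      (forall (j m : nat) (p : {mpoly K[n.+1]}) x,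
         eqn U \is m.-homog -> p \is (j * m).-homog -> I x ->
         phi (p%:F / (eqn U)%:F ^+ j * x)
         = (rnc_pullback p)%:F / (rnc_pullback U)%:F ^+ j * phi x) &
      (forall x, hloc (fun a => exists q, a = F * q) U 0 x -> phi x = 0)].

(* N_{C/X} as a bundle on P^1.  The restriction of phi to U' is the unique
   section over U' that agrees with phi on I_(eqn U). *)
Definition normal_bundle : omodule :=
  @OModule ({fraction {mpoly K[n.+1]}} -> {fraction {mpoly K[2]}})
    normal_section
    (fun U phi psi =>
       forall x, hloc vanishes_on_rnc U 0 x -> phi x = psi x)
    (fun phi psi x => phi x + psi x)
    (fun c phi x => c * phi x)
    (fun U _ phi phi' =>
       forall x, hloc vanishes_on_rnc U 0 x -> phi' x = phi x).

End NormalBundle.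

End RationalNormalCurve.

Arguments split_bundle {K} e n k.

(* Main.v *)
Require Import Defs.
From HB Require Import structures.
From mathcomp Require Import all_boot all_order all_algebra.
From mathcomp Require Import mpoly.
From mathcomp Require Import ring zify.

From Stdlib Require Import ClassicalEpsilon.

Import GRing.Theory.
Local Open Scope ring_scope.

(** Let I be the homogeneous ideal of the curve C. The pullbacks to K[s, t] of
    the partial derivatives of a form a in I satisfy the two relations obtained
    by differentiating a(s^e, ..., t^e, 0, ..., 0) = 0, and solving them
    ([hasclass]) describes the class of a in I / I^2 by n - 1 binary forms. So
    the normal bundle of C in P^n is O(e+2)^(e-1) + O(e)^(n-e), and the class
    f = (f_0, ..., f_(n-2)) of the equation of a hypersurface X of degree d is a
    row of binary forms, that is, a map from this bundle to O(de) whose kernel is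
    the normal bundle of C in X.

    Every splitting type V of the statement is the kernel of a row of monomials:
    zero in the first l0 places, where the summands of V are those of the normal
    bundle in P^n, and s^(al_l) t^(be_l) afterwards, with exponents such that the
    vectors - t^(q_l) e_l + s^(p_l) e_(l+1) span the kernel and generate the
    remaining summands of V ([chain_exact]). Here l0 = 0 in the first case and
    l0 = e - 1 in the second. Since sections of the normal bundle are given as
    linear maps on the localised ideal, the isomorphism is obtained by showing
    that such a map is determined by regular functions, its coordinates, which
    can be prescribed ([section_values], [normal_section_coords],
    [represents_inj], [represents_section], [normal_bundle_split]).

    It remains to find a smooth X with the given class. Explicit combinations of
    the minors x_i x_(j+1) - x_(i+1) x_j lift every monomial class
    ([lift_class]). The first nonzero entry of the row is a power of s and the
    last one a power of t, so the gradient of any lift does not vanish on C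
    ([smooth_of_class]). Adding forms in I^2 does not change the class, and off C
    a Bertini argument applies ([smooth_member]): points where the gradients of
    the forms in I^2 of degree d have rank r contribute singular members in
    codimension r minus the dimension of the set of these points. The rank is
    n + 1, except for d = 4 at points on the secants of C, where it is still
    larger than the dimension of the secant variety if n >= 4. For quartic
    surfaces in P^3 there are only two classes, of which smooth representatives
    are written down ([conic_quartic], [twisted_quartic]); for n = 2 there is no
    V as in the statement. *)

Set Implicit Arguments.
Unset Strict Implicit.
Unset Printing Implicit Defensive.

(** * Nonvanishing and algebraic dependence of polynomials *)

Section Points.

Variable K : fieldType.
Hypothesis charK : [pchar K] =i pred0.

Lemma natr_inj_pchar0 : injective (fun i : nat => i%:R : K).
Proof.
suff H i j : (i <= j)%N -> i%:R = j%:R :> K -> i = j.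
  move=> i j eq_ij; case: (leqP i j) => [/H|/ltnW/H h]; first exact.
  by apply/esym/h.
move=> le_ij /eqP; rewrite eq_sym -subr_eq0 -natrB //.
by move/pcharf0P: charK => ->; rewrite subn_eq0 => le_ji; apply/eqP; lia.
Qed.

Lemma poly_nonroot (p : {poly K}) : p != 0 -> exists x, p.[x] != 0.
Proof.
move=> pN0; pose rs : seq K := [seq i%:R | i <- iota 0 (size p)].
have [/(max_poly_roots pN0)|] := boolP (all (root p) rs).
  rewrite size_map size_iota ltnn => h.
  by suff: false by []; apply: h; rewrite map_inj_uniq ?iota_uniq //; exact: natr_inj_pchar0.
by case/allPn => x _ /negP xN; exists x; apply/negP.
Qed.

(** Among the monomials of [p], those with a fixed exponent of the last
    variable give a nonzero polynomial in one variable less; at a point where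
    it does not vanish, [p] becomes a nonzero polynomial in the last variable,
    and [K] is infinite. *)
Lemma mpoly_nonroot (n : nat) (p : {mpoly K[n]}) :
  p != 0 -> exists v, p.@[v] != 0.
Proof.
elim: n p => [|n IHn] p pN0.
  exists (fun=> 0); rewrite (nvar0_mpolyC p) mevalC.
  by rewrite -(mpolyC_eq0 0) -nvar0_mpolyC.
have [m0 m0p]: exists m0, m0 \in msupp p.
  by exists (mlead p); apply: mlead_supp.
pose wd := widen_ord (leqnSn n).
pose rm (m : 'X_{1..n.+1}) := [multinom m (wd i) | i < n].
have rmP (m m' : 'X_{1..n.+1}) : m ord_max = m' ord_max -> rm m = rm m' -> m = m'.
  move=> eqM eqr; apply/mnmP => i; case: (unliftP ord_max i) => [j ->|-> //].
  have -> : lift ord_max j = wd j by apply: val_inj; rewrite /= /bump leqNgt ltn_ord.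
  by move/mnmP/(_ j): eqr; rewrite !mnmE.
pose c : {mpoly K[n]} :=
  \sum_(m <- msupp p | m ord_max == m0 ord_max) p@_m *: 'X_[rm m].
have cN0 : c != 0.
  apply/eqP => /(congr1 (mcoeff (rm m0))); rewrite mcoeff0 raddf_sum /=.
  rewrite big_mkcond (bigD1_seq m0) ?msupp_uniq //= big1 ?addr0; last first.
    move=> m neq; case: eqP => [eqM|//]; rewrite mcoeffZ mcoeffX.
    by case: eqP => [/(rmP _ _ eqM) eqm|]; [rewrite eqm eqxx in neq|rewrite mulr0].
  rewrite eqxx.
  rewrite mcoeffZ mcoeffX eqxx mulr1 => /eqP.
  by rewrite -[_ == 0]negbK -mcoeff_msupp m0p.
have [v vN0] := IHn c cN0.
pose q : {poly K} := \sum_(m <- msupp p)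
  (p@_m * \prod_(i < n) v i ^+ m (wd i)) *: 'X^(m ord_max).
have [|x xN0] := @poly_nonroot q.
  apply/eqP => /polyP/(_ (m0 ord_max)); rewrite coef0 coef_sum.
  move/eqP; apply/negP; move: vN0; rewrite [in X in X -> _]/c raddf_sum /=.
  congr (_ != 0); rewrite big_mkcond /=; apply: eq_bigr => m _.
  rewrite coefZ coefXn eq_sym; case: eqP => _; rewrite ?mulr0 // mulr1.
  rewrite mevalZ mevalX; congr (_ * _).
  by apply: eq_bigr => i _; rewrite mnmE.
exists (fun i => if unlift ord_max i is Some j then v j else x).
move: xN0; congr (_ != 0); rewrite horner_sum mevalE; apply: eq_bigr => m _.
rewrite hornerZ hornerXn big_ord_recr /= unlift_none mulrA; congr (_ * _ * _).
apply: eq_bigr => i _; congr (_ ^+ _).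
have -> : widen_ord (leqnSn n) i = lift ord_max i by apply: val_inj; rewrite /= /bump leqNgt ltn_ord.
by rewrite liftK.
Qed.

End Points.

Section Dimension.

Variable K : fieldType.

Lemma msizeM_bound (n a b : nat) (p q : {mpoly K[n]}) :
  (msize p <= a.+1)%N -> (msize q <= b.+1)%N -> (msize (p * q) <= (a + b).+1)%N.
Proof.
move=> ha hb; have [->|pN0] := eqVneq p 0; first by rewrite mul0r msize0.
have [->|qN0] := eqVneq q 0; first by rewrite mulr0 msize0.
by rewrite msizeM_proper ?mulf_neq0 ?mleadc_eq0 //; lia.
Qed.

Lemma msizeX_bound (n a k : nat) (p : {mpoly K[n]}) :
  (msize p <= a.+1)%N -> (msize (p ^+ k) <= (k * a).+1)%N.
Proof.
move=> ha; elim: k => [|k IHk]; first by rewrite expr0 msize1.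
by rewrite exprS mulSn; apply: msizeM_bound.
Qed.

(** There are [D ^ N] monomials in the [y i] with exponents below [D], and
    they lie in a space of dimension at most a constant times [D ^ M]. For
    large [D] the former number exceeds the latter. *)
Lemma mpoly_dependent (M N : nat) (y : 'I_N -> {mpoly K[M]}) : (M < N)%N ->
  exists2 P : {mpoly K[N]}, P != 0 & forall z, P.@[fun i => (y i).@[z]] = 0.
Proof.
(* The monomials with exponents below [D] have degree below [B <= C * D], and
   [D > C ^ M] gives [(C * D) ^ M < D ^ M.+1 <= D ^ N]. *)
move=> lt_MN; pose dl := (\max_i msize (y i))%N.
have ydl i : (msize (y i) <= dl.+1)%N.
  by apply: leqW; apply: (leq_bigmax i).
pose C := (N * dl).+1; pose D := (C ^ M).+1; pose B := (N * (D * dl)).+1.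
pose mon (a : {ffun 'I_N -> 'I_D}) := \prod_i y i ^+ a i.
have szm a : (msize (mon a) <= B)%N.
  rewrite /mon /B -[X in (X * _)%N]card_ord -sum_nat_const.
  elim/big_rec2: _ => [|i x p _]; first by rewrite msize1.
  move=> hp; apply: msizeM_bound hp.
  apply: leq_trans (msizeX_bound _ (ydl i)) _.
  by rewrite ltnS leq_mul2r (ltnW (ltn_ord (a i))) orbT.
pose A : 'M[K]_(#|{ffun 'I_N -> 'I_D}|, #|{ffun 'I_M -> 'I_B}|) :=
  \matrix_(a, b) (mon (enum_val a))@_[multinom ((enum_val b : {ffun 'I_M -> 'I_B}) i : nat) | i < M].
have nfree : ~~ row_free A.
  apply/negP; rewrite /row_free => /eqP rkA.
  move: (rank_leq_col A); rewrite rkA !card_ffun !card_ord leqNgt => /negP; apply.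
  apply: (@leq_ltn_trans ((C * D) ^ M)%N).
    have leBCD : (B <= C * D)%N.
      by rewrite /B /C mulSn [(D * dl)%N]mulnC mulnA -add1n leq_add2r.
    by case: (posnP M) => [->|M_gt0]; rewrite ?expn0 // leq_exp2r.
  rewrite expnMn; apply: (@leq_trans (D ^ M.+1)%N); last exact: leq_pexp2l.
  by rewrite expnS ltn_pmul2r ?ltnSn // expn_gt0.
move: nfree; rewrite -kermx_eq0 => /rowV0Pn[c /sub_kermxP cA cN0].
pose toM (a : 'I_#|{ffun 'I_N -> 'I_D}|) := [multinom ((enum_val a : {ffun 'I_N -> 'I_D}) i : nat) | i < N].
have toMI : injective toM.
  move=> a b /mnmP eqab; apply: enum_val_inj; apply/ffunP => i; apply: val_inj.
  by have := eqab i; rewrite !mnmE.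
exists (\sum_a c 0 a *: 'X_[toM a]).
  have [a aN0] : exists a, c 0 a != 0.
    by apply/existsP; apply: contraNT cN0 => /existsPn h; apply/eqP/rowP => a;
      rewrite mxE; apply/eqP; rewrite -[_ == _]negbK.
  apply/eqP => /(congr1 (mcoeff (toM a))); rewrite mcoeff0 raddf_sum /=.
  rewrite (bigD1 a) //= big1 ?addr0 => [|b bNa].
    by rewrite mcoeffZ mcoeffX eqxx mulr1; apply/eqP.
  by rewrite mcoeffZ mcoeffX (inj_eq toMI) (negbTE bNa) mulr0.
have P0 : \sum_a c 0 a *: mon (enum_val a) = 0.
  apply/mpolyP => m; rewrite mcoeff0 raddf_sum /=.
  case: (leqP B (mdeg m)) => [leB|ltB].
    apply: big1 => a _; rewrite mcoeffZ memN_msupp_eq0 ?mulr0 //.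
    by apply: msize_mdeg_ge; apply: leq_trans (szm _) leB.
  have mB i : (m i < B)%N.
    apply: leq_ltn_trans ltB; rewrite mdegE (bigD1 i) //=; exact: leq_addr.
  pose b := enum_rank [ffun i => Ordinal (mB i)].
  move/rowP/(_ b): cA; rewrite !mxE => cA; rewrite -[RHS]cA; apply: eq_bigr => a _.
  rewrite mxE mcoeffZ; congr (_ * mcoeff _ _); apply/mnmP => i.
  by rewrite mnmE /b enum_rankK ffunE.
move=> z; rewrite raddf_sum /= -[RHS](@meval0 _ K z) -P0 raddf_sum /=.
apply: eq_bigr => a _; rewrite !mevalZ mevalX /mon rmorph_prod /=; congr (_ * _).
by apply: eq_bigr => i _; rewrite mnmE rmorphXn.
Qed.

(** Where the minor on the columns [g] is invertible, Cramer's rule expresses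
    the [lam (g k)] in terms of [z] and of the remaining coordinates of [lam].
    Dividing these remaining coordinates by the determinant makes the
    parametrisation polynomial; it has [m + (N - r) < N] parameters, so its
    coordinates are algebraically dependent. *)
Lemma kernel_minor_avoid (m r N : nat) (A : 'I_r -> 'I_N -> {mpoly K[m]})
    (g : 'I_r -> 'I_N) : (m < r)%N ->
  exists2 P : {mpoly K[N]}, P != 0 & forall lam z,
    (forall k, \sum_i (A k i).@[z] * lam i = 0) ->
    \det (\matrix_(k, l) (A k (g l)).@[z]) != 0 -> P.@[lam] = 0.
Proof.
move=> lt_mr; have [/injectiveP gI|/injectivePn[i [j neq eqg]]] := boolP (injectiveb g);
  last first.
  exists 1; first exact: oner_neq0.
  move=> lam z _ /eqP[]; rewrite -det_tr (determinant_alternate neq) // => k.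
  by rewrite !mxE eqg.
pose C := [set i | i \notin codom g].
have cardC : (r + #|C| = N)%N.
  have := cardsC [set i | i \in codom g].
  rewrite card_ord cardsE card_codom // card_ord => eqN; apply: etrans eqN.
  by congr (_ + _)%N; apply: eq_card => i; rewrite !inE.
pose h (k : 'I_#|C|) := enum_val k.
have hC k : h k \notin codom g by have := enum_valP k; rewrite inE.
(* The first [m] parameters are the coordinates of [z], the others are the
   [lam i / \det] for [i] not in the image of [g]. *)
pose up (k : 'I_m) : 'I_(m + #|C|) := lshift _ k.
pose A' k i : {mpoly K[m + #|C|]} := A k i \mPo [tuple 'X_(up k) | k < m].
pose mu i : {mpoly K[m + #|C|]} := \sum_(k | h k == i) 'X_(rshift m k).
pose Mx : 'M_r := \matrix_(k, l) A' k (g l).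
pose y i := \det Mx * mu i
  - \sum_(k | g k == i) \sum_l (\adj Mx) k l * \sum_j A' l j * mu j.
have [|P PN0 Py] := @mpoly_dependent (m + #|C|) N y; first by lia.
exists P => // lam z eqs.
set Mz := \matrix_(k, l) _ => dN0.
pose w i := match split i with inl k => z k | inr k => lam (h k) / \det Mz end.
suff yE i : (y i).@[w] = lam i.
  by rewrite -[RHS](Py w); apply: meval_eq => i; rewrite yE.
have A'E k j : (A' k j).@[w] = (A k j).@[z].
  rewrite comp_mpoly_meval; apply: meval_eq => l.
  by rewrite tnth_mktuple mevalXU /w -[up l]/(unsplit (inl l)) unsplitK.
have muE j : (mu j).@[w] = if j \in codom g then 0 else lam j / \det Mz.
  rewrite /mu raddf_sum /=; case: ifPn => [jg|jg].
    by apply: big1 => k /eqP hk; have := hC k; rewrite hk jg.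
  have jC : j \in C by rewrite inE.
  rewrite (big_pred1 (enum_rank_in jC j)) => [|k].
    set l := enum_rank_in _ _; rewrite mevalXU /w -[rshift m l]/(unsplit (inr l)).
    by rewrite unsplitK /h enum_rankK_in.
  rewrite /=; apply/eqP/eqP => [hk|->]; last by rewrite /h enum_rankK_in.
  by apply: enum_val_inj; rewrite enum_rankK_in.
have MxE : map_mx (meval w) Mx = Mz by apply/matrixP => k l; rewrite !mxE A'E.
have detE : (\det Mx).@[w] = \det Mz by rewrite -MxE det_map_mx.
have adjE k l : ((\adj Mx) k l).@[w] = (\adj Mz) k l.
  by rewrite -MxE -map_mx_adj [RHS]mxE.
rewrite /y mevalB mevalM detE muE [X in _ - X](raddf_sum (meval w)) /=.
case: ifPn => [/codomP[k0 ->]|iN]; last first.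
  rewrite big1 ?meval0 ?subr0 => [|k /eqP gk]; first by rewrite mulrC divfK.
  by move: iN; rewrite -gk codom_f.
rewrite (big_pred1 k0) => [|k]; last by rewrite /= (inj_eq gI).
rewrite mulr0 sub0r [X in - X](raddf_sum (meval w)) /=.
have sumE l : (\sum_j A' l j * mu j).@[w] = - (\sum_k Mz l k * lam (g k)) / \det Mz.
  rewrite raddf_sum /=; under eq_bigr do rewrite mevalM A'E muE.
  have := eqs l; rewrite (bigID (fun j => j \in codom g)) /=.
  have -> : \sum_(j | j \in codom g) (A l j).@[z] * lam j = \sum_k Mz l k * lam (g k).
    rewrite (reindex_omap g (fun j => [pick k | g k == j])) /=; last first.
      by move=> j /codomP[k ->]; case: pickP => [k' /eqP/gI->|/(_ k)] //=; rewrite eqxx.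
    apply: eq_big => [k|k _]; last by rewrite mxE.
    by rewrite codom_f; case: pickP => [k' /eqP/gI->|/(_ k)]; rewrite eqxx.
  move/eqP; rewrite addrC addr_eq0 => /eqP <-; rewrite mulr_suml.
  rewrite [RHS]big_mkcond; apply: eq_bigr => j _; case: ifP => _ /=; rewrite ?mulr0 //.
  by rewrite mulrA.
under eq_bigr do rewrite mevalM adjE sumE mulNr mulrN mulrA.
rewrite sumrN opprK -mulr_suml.
have -> : \sum_l (\adj Mz) k0 l * (\sum_k Mz l k * lam (g k)) = \det Mz * lam (g k0).
  pose u : 'cV_r := \col_k lam (g k).
  have -> : \det Mz * lam (g k0) = ((\det Mz)%:M *m u) k0 0.
    by rewrite mul_scalar_mx !mxE.
  rewrite -mul_adj_mx -mulmxA [RHS]mxE; apply: eq_bigr => l _; congr (_ * _).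
  by rewrite [RHS]mxE; apply: eq_bigr => k _; rewrite [u _ _]mxE.
by rewrite mulrC mulrA mulVf ?mul1r.
Qed.

(** The pairs [(lam, z)] such that [lam] is in the kernel of a matrix of rank
    [r] form a variety of dimension [m + (N - r) < N], so the values of [lam]
    that occur are not dense. The invertible minor may depend on the pair, and
    the product over all choices of columns covers every case. *)
Lemma kernel_avoid (m r N : nat) (A : 'I_r -> 'I_N -> {mpoly K[m]}) : (m < r)%N ->
  exists2 P : {mpoly K[N]}, P != 0 & forall lam z,
    (forall k, \sum_i (A k i).@[z] * lam i = 0) ->
    (forall v : 'I_r -> K, (forall i, \sum_k v k * (A k i).@[z] = 0) -> forall k, v k = 0) ->
    P.@[lam] = 0.
Proof.
move=> lt_mr.
have /fin_all_exists2[P PN0 PE] (g : {ffun 'I_r -> 'I_N}) :=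
  kernel_minor_avoid A g lt_mr.
exists (\prod_g P g); first by apply/prodf_neq0 => g _; apply: PN0.
move=> lam z eqs indep.
pose Az : 'M_(N, r) := \matrix_(i, k) (A k i).@[z].
have full : row_full Az.
  rewrite -col_leq_rank -mxrank_tr; apply: eq_leq; apply/esym/eqP; rewrite -/(row_free _).
  rewrite -kermx_eq0; apply/rowV0P => v /sub_kermxP/rowP vA.
  apply/rowP => k; rewrite mxE; apply: (indep (fun k => v 0 k)) => i.
  have := vA i; rewrite !mxE => E; rewrite -[RHS]E.
  by apply: eq_bigr => l _; rewrite !mxE.
rewrite rmorph_prod /=.
apply/eqP/prodf_eq0; exists (fullrankfun full) => //; apply/eqP.
apply: (PE _ lam z eqs); have := fullrowsub_unit full.
rewrite unitmxE unitfE -det_tr; congr (\det _ != 0).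
by apply/matrixP => k l; rewrite !mxE.
Qed.

End Dimension.

(** * Restriction of forms to the curve *)

Section Pullback.

Variables (K : closedFieldType) (e n : nat).
Implicit Types (a b p : {mpoly K[n.+1]}).

Notation pb := (@rnc_pullback K e n).
Notation s := ('X_ord0 : {mpoly K[2]}).
Notation t := ('X_ord_max : {mpoly K[2]}).

HB.instance Definition _ := GRing.RMorphism.copy (@rnc_pullback K e n)
  (comp_mpoly [tuple rnc e s t i | i < n.+1]).
HB.instance Definition _ := GRing.Linear.copy (@rnc_pullback K e n)
  (comp_mpoly [tuple rnc e s t i | i < n.+1]).

Lemma pullbackX (i : 'I_n.+1) : pb 'X_i = rnc e s t i.
Proof. by rewrite /rnc_pullback comp_mpolyXU -tnth_nth tnth_mktuple. Qed.

Lemma pullback_meval a v : (pb a).@[v] = a.@[rnc e (v ord0) (v ord_max)].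
Proof.
rewrite comp_mpoly_meval; apply: meval_eq => i; rewrite tnth_mktuple /rnc.
by case: ifP => _; rewrite ?meval0 // mevalM !rmorphXn /= !mevalXU.
Qed.

Lemma rnc_homog (i : 'I_n.+1) : rnc e s t i \is e.-homog.
Proof.
rewrite /rnc; case: ifP => [le_ie|_]; last exact: dhomog0.
have hX (j : 'I_2) : ('X_j : {mpoly K[2]}) \is 1.-homog by rewrite dhomogX /= mdeg1.
have := dhomogM (dhomogMn (e - i) (hX ord0)) (dhomogMn i (hX ord_max)).
by rewrite !mul1n subnK.
Qed.

Lemma pullback_homog c a : a \is c.-homog -> pb a \is (e * c).-homog.
Proof.
move=> /dhomogP homa; rewrite (mpolyE a) raddf_sum big_seq /=; apply: rpred_sum => m /homa mc.
rewrite linearZ_LR /=; apply: rpredZ; rewrite /rnc_pullback comp_mpolyX.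
rewrite -mc /= mdegE big_distrr /=.
elim/big_rec2: _ => [|i p k _ homp]; first exact: dhomog1.
by apply: dhomogM homp; apply: dhomogMn; rewrite tnth_mktuple; apply: rnc_homog.
Qed.

Hypothesis charK : [pchar K] =i pred0.

(** A polynomial in [s] and [t] that vanishes wherever [s] does not is zero.
    *)
Lemma vanishesP a : vanishes_on_rnc e a <-> pb a = 0.
Proof.
split=> [van|a0 u v _]; last first.
  pose w (i : 'I_2) := if i == ord0 then u else v.
  by rewrite (_ : rnc e u v = rnc e (w ord0) (w ord_max)) // -pullback_meval a0 meval0.
have: s * pb a = 0.
  apply/eqP/negPn/negP => /(mpoly_nonroot charK)[w]; rewrite mevalM mevalXU.
  rewrite mulf_eq0 negb_or => /andP[w0 /negP[]]; rewrite pullback_meval van //.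
  by rewrite -pair_eqE /= negb_and w0.
by move/eqP; rewrite mulf_eq0 -msupp_eq0 msuppX /= => /eqP.
Qed.

Hypotheses (e_gt0 : (0 < e)%N) (e_len : (e <= n)%N).

Definition xv (i : nat) : {mpoly K[n.+1]} := 'X_(inord i).

Lemma xv_homog i : xv i \is 1.-homog.
Proof. by rewrite dhomogX /= mdeg1. Qed.

Lemma pullback_xv i : (i <= e)%N -> pb (xv i) = s ^+ (e - i) * t ^+ i.
Proof.
move=> le_ie; rewrite /xv pullbackX /rnc inordK ?le_ie //.
by rewrite ltnS; apply: leq_trans le_ie e_len.
Qed.

Lemma pullback_xv0 i : (e < i <= n)%N -> pb (xv i) = 0.
Proof.
by case/andP=> lt_ei le_in; rewrite /xv pullbackX /rnc inordK ?ltnS // leqNgt lt_ei.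
Qed.

(** The curve is projectively normal: split off a coordinate [xv i] whose
    pullback divides the monomial. *)
Lemma pullback_monomial (c al be : nat) : (al + be = e * c)%N ->
  exists2 p, p \is c.-homog & pb p = s ^+ al * t ^+ be.
Proof.
elim: c al be => [|c IHc] al be albe.
  exists 1; first exact: dhomog1.
  have [-> ->] : al = 0%N /\ be = 0%N by lia.
  by rewrite rmorph1 !expr0 mulr1.
pose i := minn be e.
have le_ie : (i <= e)%N by rewrite geq_minr.
have [|p homp pE] := IHc (al - (e - i))%N (be - i)%N.
  by rewrite /i; move: albe; rewrite mulnS; lia.
exists (xv i * p); first exact: (dhomogM (xv_homog i) homp).
rewrite rmorphM /= pE pullback_xv // mulrACA -!exprD.
by congr (s ^+ _ * t ^+ _); rewrite /i; move: albe; rewrite mulnS; lia.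
Qed.

End Pullback.

(** * Division by the square of a linear form *)

Section DoubleLine.

Definition shift1 (R : nzRingType) (rho : nat -> R) (i : nat) : R :=
  if i is j.+1 then rho j else 0.

(** The coefficient of [z ^ i] in [(y - x z) ^ 2 * \sum_i rho_i z ^ i]. *)
Definition dblmul (R : nzRingType) (x y : R) (rho : nat -> R) (i : nat) : R :=
  y ^+ 2 * rho i - 2%:R * x * y * shift1 rho i + x ^+ 2 * shift1 (shift1 rho) i.

(** Division of power series by [(y - x z) ^ 2]; the pair carries the last two
    coefficients of the quotient. *)
Fixpoint dbldiv_rec (L : fieldType) (x y : L) (u : nat -> L) (r : nat) : L * L :=
  if r is r'.+1 then
    let: (p, q) := dbldiv_rec x y u r' in
    ((u r + 2%:R * x * y * p - x ^+ 2 * q) / y ^+ 2, p)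
  else (u 0 / y ^+ 2, 0).

Definition dbldiv (L : fieldType) (x y : L) (u : nat -> L) (r : nat) : L :=
  (dbldiv_rec x y u r).1.

Variables (L : fieldType) (x y : L).
Hypothesis yN0 : y != 0.

Lemma dblmulK u i : dblmul x y (dbldiv x y u) i = u i.
Proof.
have E j : dbldiv_rec x y u j = (dbldiv x y u j, shift1 (dbldiv x y u) j).
  by case: j => //= j; rewrite /dbldiv /=; case: dbldiv_rec.
rewrite /dblmul; case: i => [|i].
  by rewrite /dbldiv /= !mulr0 subr0 addr0 mulrC divfK ?expf_neq0.
rewrite {1}/dbldiv /= E /= mulrC divfK ?expf_neq0 //.
by ring.
Qed.

Lemma dblmul_inj (r : nat) (rho rho' : nat -> L) :
  (forall i, (i <= r)%N -> dblmul x y rho i = dblmul x y rho' i) -> rho r = rho' r.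
Proof.
elim/ltn_ind: r => r IHr eqr.
have IH i : (i < r)%N -> rho i = rho' i.
  by move=> lt_ir; apply: IHr => // j le_ji; apply: eqr; apply: leq_trans le_ji (ltnW lt_ir).
have := eqr r (leqnn r); rewrite /dblmul.
have -> : shift1 rho r = shift1 rho' r by case: (r) IH => //= j; apply.
have -> : shift1 (shift1 rho) r = shift1 (shift1 rho') r.
  by case: (r) IH => //= -[|j] //= h; apply: h; apply: ltnW.
move/addIr/addIr/mulfI; apply; exact: expf_neq0.
Qed.

Lemma dbldiv_unique (r : nat) (u rho : nat -> L) :
  (forall i, (i <= r)%N -> u i = dblmul x y rho i) -> dbldiv x y u r = rho r.
Proof. by move=> uE; apply: dblmul_inj => i /uE <-; rewrite dblmulK. Qed.

Lemma dbldivD u v r : dbldiv x y (fun i => u i + v i) r = dbldiv x y u r + dbldiv x y v r.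
Proof.
rewrite (@dbldiv_unique _ _ (fun i => dbldiv x y u i + dbldiv x y v i)) // => i _.
rewrite -{1}(dblmulK u i) -{1}(dblmulK v i) /dblmul.
by case: i => [|[|i]] /=; ring.
Qed.

Lemma dbldivZ c u r : dbldiv x y (fun i => c * u i) r = c * dbldiv x y u r.
Proof.
rewrite (@dbldiv_unique _ _ (fun i => c * dbldiv x y u i)) // => i _.
by rewrite -{1}(dblmulK u i) /dblmul; case: i => [|[|i]] /=; ring.
Qed.

End DoubleLine.

(** * The class of an equation in the conormal module *)

Section ConormalClass.

Variables (K : closedFieldType) (e n : nat).
Hypotheses (e_ge2 : (2 <= e)%N) (e_len : (e <= n)%N).
Implicit Types (a b p : {mpoly K[n.+1]}) (f : nat -> {mpoly K[2]}).

Notation pb := (@rnc_pullback K e n).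
Notation s := ('X_ord0 : {mpoly K[2]}).
Notation t := ('X_ord_max : {mpoly K[2]}).
Notation xv := (@xv K n).

Let e_gt0 : (0 < e)%N. Proof. exact: ltnW. Qed.

(** The differential of [a] along the affine cone over the curve. *)
Definition gr a (k : nat) : {mpoly K[2]} := pb a^`M(inord k).

Lemma grD a b k : gr (a + b) k = gr a k + gr b k.
Proof. by rewrite /gr mderivD rmorphD. Qed.

Lemma grB a b k : gr (a - b) k = gr a k - gr b k.
Proof. by rewrite /gr mderivB rmorphB. Qed.

Lemma grM p a k : gr (p * a) k = gr p k * pb a + pb p * gr a k.
Proof. by rewrite /gr mderivM rmorphD !rmorphM. Qed.

Lemma gr_xv i k : (i <= n)%N -> (k <= n)%N -> gr (xv i) k = (i == k)%:R.
Proof.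
move=> le_in le_kn; rewrite /gr mderivX mnm1E -val_eqE /= !inordK //.
case: eqP => [->|_]; last by rewrite scale0r rmorph0.
rewrite scale1r (_ : _ - _ = 0)%MM ?mpolyX0 ?rmorph1 //.
by apply/mnmP => l; rewrite mnmBE mnm0E subnn.
Qed.

(** Only the first [e.-1] entries of a class belong to the normal bundle of
    the curve in its linear span. *)
Definition truncate f (r : nat) : {mpoly K[2]} := if (r < e.-1)%N then f r else 0.

(** If [a] vanishes on the curve, then differentiating [pb a = 0] by [s] and
    by [t] shows that [\sum_k gr a k z ^ k] (sum over [k <= e]) has a double
    zero at [z = t / s], so it is [(t - s z) ^ 2] times a polynomial of degree
    [e - 2]. The [e - 1] coefficients of this quotient, followed by the
    derivatives in the [n - e] directions transverse to the span of the curve,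
    are the coordinates of the class of [a] in the conormal module. If [a] has
    degree [c], they have degree [e * c - (e + 2)], respectively [e * c - e].
    *)
Definition hasclass a f : Prop :=
  (forall k, (k <= e)%N -> gr a k = dblmul s t (truncate f) k) /\
  (forall j, (e < j <= n)%N -> gr a j = f j.-2).

Lemma hasclass_ext a f f' :
  (forall l, (l < n.-1)%N -> f l = f' l) -> hasclass a f -> hasclass a f'.
Proof.
move=> ff' [h1 h2]; split=> [k le_ke|j le_ej]; last by rewrite -ff' ?h2 //; lia.
have E r : truncate f r = truncate f' r.
  by rewrite /truncate; case: ifP => // lt_re; rewrite ff' //; lia.
by rewrite h1 // /dblmul; case: k le_ke => [|[|k]] _ /=; rewrite !E.
Qed.

Lemma hasclassD a b f f' :
  hasclass a f -> hasclass b f' -> hasclass (a + b) (fun l => f l + f' l).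
Proof.
move=> [h1 h2] [h1' h2']; split=> [k le_ke|j le_ej]; last by rewrite grD h2 ?h2'.
rewrite grD h1 // h1' // /dblmul.
have E r : truncate (fun l => f l + f' l) r = truncate f r + truncate f' r.
  by rewrite /truncate; case: ifP; rewrite ?addr0.
by case: k le_ke => [|[|k]] _ /=; rewrite !E; ring.
Qed.

Lemma hasclassM p a f : pb a = 0 ->
  hasclass a f -> hasclass (p * a) (fun l => pb p * f l).
Proof.
move=> a0 [h1 h2]; split=> [k le_ke|j le_ej]; rewrite grM a0 mulr0 add0r;
  last by rewrite h2.
rewrite h1 // /dblmul.
have E r : truncate (fun l => pb p * f l) r = pb p * truncate f r.
  by rewrite /truncate; case: ifP; rewrite ?mulr0.
by case: k le_ke => [|[|k]] _ /=; rewrite !E; ring.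
Qed.

Lemma hasclass0 : hasclass 0 (fun=> 0).
Proof.
by split=> [k _|j _]; rewrite /gr mderiv0 rmorph0 // /dblmul;
  case: k => [|[|k]]; rewrite /= /truncate ?if_same; ring.
Qed.

(** The class only depends on [a] modulo the square of the ideal. *)
Lemma hasclass_sqr0 a b : pb a = 0 -> pb b = 0 -> hasclass (a * b) (fun=> 0).
Proof.
move=> a0 b0; have [h1 h2] := hasclass0.
have g0 k : gr (a * b) k = gr 0 k.
  by rewrite grM a0 b0 mulr0 mul0r addr0 /gr mderiv0 rmorph0.
by split=> [k|j]; rewrite g0; [apply: h1|apply: h2].
Qed.

Lemma hasclass_sum (I : Type) (r : seq I) (P : pred I) (a : I -> {mpoly K[n.+1]})
    (f : I -> nat -> {mpoly K[2]}) :
  (forall i, P i -> hasclass (a i) (f i)) ->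
  hasclass (\sum_(i <- r | P i) a i) (fun l => \sum_(i <- r | P i) f i l).
Proof.
move=> hc; elim: r => [|i r IHr].
  by rewrite big_nil; apply: hasclass_ext hasclass0 => l _; rewrite big_nil.
rewrite big_cons; apply: hasclass_ext (_ : hasclass _ (fun l => if P i then
  f i l + \sum_(i <- r | P i) f i l else \sum_(i <- r | P i) f i l)).
  by move=> l _; rewrite big_cons.
by case: ifP => // Pi; apply: hasclassD => //; apply: hc.
Qed.

Definition delta (r : nat) (h : {mpoly K[2]}) (l : nat) : {mpoly K[2]} :=
  if l == r then h else 0.

Lemma hasclass_xv p l : (e.-1 <= l)%N -> (l.+1 < n)%N ->
  hasclass (xv l.+2 * p) (delta l (pb p)).
Proof.
move=> le_el lt_ln.
have x0 : pb (xv l.+2) = 0 by apply: pullback_xv0 => //; lia.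
have g k : (k <= n)%N -> gr (xv l.+2 * p) k = (l.+2 == k)%:R * pb p.
  by move=> le_kn; rewrite grM x0 mul0r addr0 gr_xv.
split=> [k le_ke|j /andP[lt_ej le_jn]]; rewrite g //; last 2 first.
- by apply: leq_trans le_ke e_len.
- rewrite /delta (_ : (j.-2 == l) = (l.+2 == j)); last by lia.
  by case: eqP; rewrite ?mul1r ?mul0r.
have E r : truncate (delta l (pb p)) r = 0.
  by rewrite /truncate /delta; case: ifP => // ?; case: eqP => // ?; lia.
have -> : (l.+2 == k) = false by lia.
by rewrite /dblmul; case: k le_ke => [|[|k]] _ /=; rewrite !E; ring.
Qed.

Definition minor (i j : nat) : {mpoly K[n.+1]} := xv i * xv j.+1 - xv i.+1 * xv j.

Lemma minor_homog i j : minor i j \is 2.-homog.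
Proof. by apply: rpredB; apply: (@dhomogM _ _ _ 1 _ 1); apply: xv_homog. Qed.

Lemma pullback_minor i j : (i < e)%N -> (j < e)%N -> pb (minor i j) = 0.
Proof.
move=> lt_ie lt_je; rewrite rmorphB !rmorphM /= !pullback_xv ?(ltnW lt_ie) ?(ltnW lt_je) //.
apply/eqP; rewrite subr_eq0; apply/eqP.
rewrite mulrACA [RHS]mulrACA -!exprD; congr (s ^+ _ * t ^+ _); lia.
Qed.

(** All terms of the equation of index [k] are multiples of one monomial [m],
    so the claim reduces to an identity between indicator functions of
    intervals. *)
Lemma hasclass_minor i j : (i <= j)%N -> (j < e)%N ->
  hasclass (minor i j) (fun r => if (i <= r < j)%N then
    s ^+ (e + r - (i + j).+1) * t ^+ (i + j - r.+1) else 0).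
Proof.
move=> le_ij lt_je.
set f := fun r => _.
have g k : (k <= n)%N -> gr (minor i j) k = (i == k)%:R * pb (xv j.+1)
    + (j.+1 == k)%:R * pb (xv i) - (i.+1 == k)%:R * pb (xv j) - (j == k)%:R * pb (xv i.+1).
  move=> le_kn; rewrite /minor grB !grM !gr_xv //; try lia.
  by rewrite [pb _ * _]mulrC [pb (xv i.+1) * _]mulrC opprD addrA.
split=> [k le_ke|l /andP[lt_el le_ln]]; last first.
  rewrite g // /f.
  have [-> -> -> ->] : [/\ (i == l) = false, (j.+1 == l) = false, (i.+1 == l) = false
    & (j == l) = false] by split; lia.
  by rewrite !mul0r !subr0 addr0; case: ifP => // ?; lia.
rewrite g ?(leq_trans le_ke) // !pullback_xv; try lia.
pose m := s ^+ (e + k - (i + j).+1) * t ^+ ((i + j).+1 - k).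
have E1 l c : (l + k = (i + j).+1)%N -> (l <= e)%N ->
    c * (s ^+ (e - l) * t ^+ l) = c * m.
  by move=> lk le_le; congr (_ * (s ^+ _ * t ^+ _)); lia.
have E0 l l' : (l == k)%:R * (s ^+ (e - l') * t ^+ l') = (l == k)%:R * m
    \/ (l + l' != (i + j).+1)%N \/ (e < l')%N.
  have [lk|_] := eqVneq l k; last by left; rewrite !mul0r.
  have [h|_] := eqVneq (l + l')%N (i + j).+1; last by right; left.
  have [h'|] := leqP l' e; last by right; right.
  by left; apply: E1; lia.
have -> : (i == k)%:R * (s ^+ (e - j.+1) * t ^+ j.+1) = (i == k)%:R * m.
  by case: (E0 i j.+1) => [//|[]]; lia.
have -> : (j.+1 == k)%:R * (s ^+ (e - i) * t ^+ i) = (j.+1 == k)%:R * m.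
  by case: (E0 j.+1 i) => [//|[]]; lia.
have -> : (i.+1 == k)%:R * (s ^+ (e - j) * t ^+ j) = (i.+1 == k)%:R * m.
  by case: (E0 i.+1 j) => [//|[]]; lia.
have -> : (j == k)%:R * (s ^+ (e - i.+1) * t ^+ i.+1) = (j == k)%:R * m.
  by case: (E0 j i.+1) => [//|[]]; lia.
have fE r : truncate f r = f r.
  by rewrite /truncate /f; case: ifP => // lt; case: ifP => // ?; lia.
have -> : dblmul s t (truncate f) k = t ^+ 2 * f k - 2%:R * s * t * shift1 f k
    + s ^+ 2 * shift1 (shift1 f) k.
  by rewrite /dblmul; case: (k) => [|[|r]] /=; rewrite ?fE.
have -> : t ^+ 2 * f k = (i <= k < j)%:R * m.
  rewrite /f; case: ifP => [h|_]; rewrite ?mulr0 ?mul0r // mul1r mulrCA -exprD.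
  by congr (s ^+ _ * t ^+ _); lia.
have -> : 2%:R * s * t * shift1 f k = 2%:R * ((i < k <= j)%:R * m).
  rewrite -!mulrA; congr (_ * _); rewrite /shift1 /f; case: (k) @m {E1 E0 le_ke g} => [|r] m.
    by rewrite ltn0 /= !mulr0 mul0r.
  rewrite [(i < r.+1)%N]ltnS; case: ifP => h; rewrite ?mulr0 ?mul0r // mul1r.
  rewrite mulrA mulrACA -!exprS.
  by congr (s ^+ _ * t ^+ _); lia.
have -> : s ^+ 2 * shift1 (shift1 f) k = (i.+1 < k <= j.+1)%:R * m.
  rewrite /shift1 /f; case: (k) @m {E1 E0 le_ke g} => [|[|r]] m; rewrite ?mulr0 ?mul0r //.
  rewrite [(i.+1 < r.+2)%N]ltnS [(r.+2 <= j.+1)%N]ltnS.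
  case: ifP => h; rewrite ?mulr0 ?mul0r // mul1r mulrA -exprD.
  by congr (s ^+ _ * t ^+ _); lia.
have : ((i == k) + (j.+1 == k) + (i < k <= j) + (i < k <= j) =
        (i <= k < j) + (i.+1 < k <= j.+1) + (i.+1 == k) + (j == k))%N by lia.
move/(congr1 (fun c : nat => c%:R : {mpoly K[2]})); rewrite !natrD => E.
apply/eqP; rewrite -subr_eq0; apply/eqP.
set c1 := (i == k)%:R in E *; set c2 := (j.+1 == k)%:R in E *.
set c3 := (i < k <= j)%:R in E *; set c4 := (i <= k < j)%:R in E *.
set c5 := (i.+1 < k <= j.+1)%:R in E *; set c6 := (i.+1 == k)%:R in E *.
set c7 := (j == k)%:R in E *.
transitivity ((c1 + c2 + c3 + c3 - (c4 + c5 + c6 + c7)) * m); first by ring.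
by rewrite E subrr mul0r.
Qed.

(** The classes of [minor be r.+1] and [minor be r] are proportional, with
    ratio [t / s], except at the entry [r]. This combination and its mirror
    image [edgeR] isolate that entry. *)
Definition edgeL (be r : nat) : {mpoly K[n.+1]} :=
  xv 0 * minor be r.+1 - xv 1 * minor be r.

Definition edgeR (al r : nat) : {mpoly K[n.+1]} :=
  xv e * minor r (e - al.+1) - xv e.-1 * minor r.+1 (e - al.+1).

Lemma edge_homog i j k k' l l' :
  xv i * minor k k' - xv j * minor l l' \is 3.-homog.
Proof. by apply: rpredB; apply: (@dhomogM _ _ _ 1 _ 2); rewrite ?xv_homog ?minor_homog. Qed.

Lemma pullback_edgeL be r : (be < e)%N -> (r.+1 < e)%N -> pb (edgeL be r) = 0.
Proof.
by move=> ? ?; rewrite rmorphB !rmorphM /= !pullback_minor ?mulr0 ?subr0 //; lia.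
Qed.

Lemma pullback_edgeR al r : (al < e)%N -> (r.+1 < e)%N -> pb (edgeR al r) = 0.
Proof.
by move=> ? ?; rewrite rmorphB !rmorphM /= !pullback_minor ?mulr0 ?subr0 //; lia.
Qed.

Lemma hasclassB a b f f' :
  hasclass a f -> hasclass b f' -> hasclass (a - b) (fun l => f l - f' l).
Proof.
move=> ha [h1 h2]; apply: hasclassD ha _.
have grN k : gr (- b) k = - gr b k by rewrite /gr mderivN rmorphN.
split=> [k le_ke|j le_ej]; rewrite grN; last by rewrite h2.
rewrite h1 //.
have E r : truncate (fun l => - f' l) r = - truncate f' r.
  by rewrite /truncate; case: ifP; rewrite ?oppr0.
by rewrite /dblmul; case: k le_ke => [|[|k]] _ /=; rewrite !E; ring.
Qed.

Lemma hasclass_edgeL be r : (be <= r)%N -> (r.+1 < e)%N ->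
  hasclass (edgeL be r) (delta r (s ^+ (e.-1.*2 - be) * t ^+ be)).
Proof.
move=> le_ber lt_re.
have M0 i j : (i < e)%N -> (j < e)%N -> pb (minor i j) = 0 by exact: pullback_minor.
apply: hasclass_ext (hasclassB
  (hasclassM (xv 0) (M0 _ _ _ _) (hasclass_minor (_ : be <= r.+1)%N _))
  (hasclassM (xv 1) (M0 _ _ _ _) (hasclass_minor le_ber _))); try lia.
move=> l _; rewrite !pullback_xv; try lia.
rewrite expr0 mulr1 subn0 expr1 /delta.
have [->|neq] := eqVneq l r.
  rewrite ltnn andbF mulr0 subr0 le_ber ltnSn /= mulrA -exprD.
  by congr (s ^+ _ * t ^+ _); lia.
have -> : (l < r.+1)%N = (l < r)%N by lia.
case: ifP => [h|_]; last by rewrite !mulr0 subr0.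
apply/eqP; rewrite subr_eq0 mulrA -exprD mulrACA -exprD -exprS; apply/eqP.
by congr (s ^+ _ * t ^+ _); lia.
Qed.

Lemma hasclass_edgeR al r : (al + r.+1 < e)%N ->
  hasclass (edgeR al r) (delta r (s ^+ al * t ^+ (e.-1.*2 - al))).
Proof.
move=> lt_are.
have M0 i j : (i < e)%N -> (j < e)%N -> pb (minor i j) = 0 by exact: pullback_minor.
apply: hasclass_ext (hasclassB
  (hasclassM (xv e) (M0 _ _ _ _) (hasclass_minor (_ : r <= e - al.+1)%N _))
  (hasclassM (xv e.-1) (M0 _ _ _ _) (hasclass_minor (_ : r.+1 <= e - al.+1)%N _))); try lia.
move=> l _; rewrite !pullback_xv; try lia.
rewrite subnn expr0 mul1r (_ : e - e.-1 = 1)%N ?expr1; last by lia.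
rewrite /delta; have [->|neq] := eqVneq l r.
  rewrite leqnn ltnn /= mulr0 subr0 (_ : (r < e - al.+1)%N); last by lia.
  rewrite mulrCA -exprD.
  by congr (s ^+ _ * t ^+ _); lia.
have -> : (r < l)%N = (r <= l)%N by lia.
case: ifP => [h|_]; last by rewrite !mulr0 subr0.
apply/eqP; rewrite subr_eq0 mulrCA -exprD mulrACA -exprD -exprS; apply/eqP.
by congr (s ^+ _ * t ^+ _); lia.
Qed.

(** Along the span of the curve, each of three families covers a range of
    exponents: [edgeL] handles the small powers of [t], [edgeR] the small
    powers of [s], and [minor r r.+1] times a form all others. *)
Lemma lift_delta (d r al be : nat) : (3 <= d)%N -> (r.+1 < n)%N ->
  (al + be + (if r < e.-1 then e + 2 else e) = d * e)%N ->
  exists F : {mpoly K[n.+1]},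
    [/\ F \is d.-homog, pb F = 0 & hasclass F (delta r (s ^+ al * t ^+ be))].
Proof.
move=> d_ge3 lt_rn; case: ifP => lt_re albe; last first.
  have [|p homp pE] := @pullback_monomial K e n e_gt0 e_len d.-1 al be.
    by rewrite mulnC -subn1 mulnBl mul1n; lia.
  exists (xv r.+2 * p); split.
  - rewrite -[X in X.-homog](@prednK d); last by lia.
    exact: (dhomogM (xv_homog _ _ _) homp).
  - by rewrite rmorphM /= pullback_xv0 ?mul0r //; lia.
  - by rewrite -pE; apply: hasclass_xv; lia.
have dE : (d = (d - 3) + 3)%N by lia.
have dEe : (d * e = (d - 3) * e + 3 * e)%N by rewrite -mulnDl -dE.
have [le_ber|lt_rbe] := leqP be r.
  exists (xv 0 ^+ (d - 3) * edgeL be r); split.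
  - have := dhomogM (dhomogMn (d - 3) (xv_homog K n 0)) (edge_homog _ _ _ _ _ _).
    by rewrite mul1n -dE; apply.
  - by rewrite rmorphM /= pullback_edgeL ?mulr0 //; lia.
  apply: hasclass_ext (hasclassM _ _ (hasclass_edgeL le_ber _)); try lia; last first.
    by apply: pullback_edgeL; lia.
  move=> l _; rewrite /delta; case: eqP => _; last by rewrite mulr0.
  rewrite rmorphXn /= pullback_xv // expr0 mulr1 subn0 -exprM mulrA -exprD.
  by congr (s ^+ _ * _); lia.
have [le_alr|lt_ral] := leqP (al + r.+2) e.
  exists (xv e ^+ (d - 3) * edgeR al r); split.
  - have := dhomogM (dhomogMn (d - 3) (xv_homog K n e)) (edge_homog _ _ _ _ _ _).
    by rewrite mul1n -dE; apply.
  - by rewrite rmorphM /= pullback_edgeR ?mulr0 //; lia.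
  apply: hasclass_ext (hasclassM _ _ (hasclass_edgeR _)); try lia; last first.
    by apply: pullback_edgeR; lia.
  move=> l _; rewrite /delta; case: eqP => _; last by rewrite mulr0.
  rewrite rmorphXn /= pullback_xv // subnn expr0 mul1r -exprM mulrCA -exprD.
  by congr (_ * t ^+ _); lia.
have [|p homp pE] := @pullback_monomial K e n e_gt0 e_len (d - 2) (al - (e - r.+2)) (be - r).
  have d2E : ((d - 2) * e = (d - 3) * e + e)%N.
    by rewrite -mulSnr (_ : (d - 3).+1 = (d - 2)%N) //; lia.
  by rewrite mulnC d2E; lia.
exists (p * minor r r.+1); split.
- have := dhomogM homp (minor_homog r r.+1).
  by rewrite subnK //; lia.
- by rewrite rmorphM /= pullback_minor ?mulr0 //; lia.
apply: hasclass_ext (hasclassM _ _ (hasclass_minor (_ : r <= r.+1)%N _)); try lia; last first.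
  by apply: pullback_minor; lia.
move=> l _; rewrite /delta ltnS -eqn_leq eq_sym.
case: eqP => [->|_]; last by rewrite mulr0.
by rewrite pE mulrACA -!exprD; congr (s ^+ _ * t ^+ _); lia.
Qed.

(** By additivity it is enough to lift classes with one nonzero entry. *)
Lemma lift_class (d : nat) (f : nat -> {mpoly K[2]}) : (3 <= d)%N ->
  (forall l, (l < n.-1)%N -> f l = 0 \/ exists al be,
     f l = s ^+ al * t ^+ be /\
     (al + be + (if l < e.-1 then e + 2 else e) = d * e)%N) ->
  exists F : {mpoly K[n.+1]}, [/\ F \is d.-homog, pb F = 0 & hasclass F f].
Proof.
move=> d_ge3 fE.
have /fin_all_exists[F FP] (l : 'I_n.-1) : exists F : {mpoly K[n.+1]},
    [/\ F \is d.-homog, pb F = 0 & hasclass F (delta l (f l))].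
  have [f0|[al [be [-> albe]]]] := fE l (ltn_ord l).
    exists 0; split; [exact: dhomog0|exact: rmorph0|].
    by apply: hasclass_ext hasclass0 => i _; rewrite /delta f0 if_same.
  by apply: lift_delta => //; have := ltn_ord l; lia.
exists (\sum_l F l); split.
- by apply: rpred_sum => l _; have [] := FP l.
- by rewrite rmorph_sum big1 // => l _; have [] := FP l.
have : hasclass (\sum_l F l) (fun i => \sum_(l < n.-1) delta l (f l) i).
  by apply: hasclass_sum => l _; have [] := FP l.
apply: hasclass_ext.
move=> l lt_ln; rewrite (bigD1 (Ordinal lt_ln)) //= /delta eqxx big1 ?addr0 // => i.
by rewrite -val_eqE eq_sym /= => /negbTE->.
Qed.

(** Multiplication by [(v - u z) ^ 2] is injective: if [v] is nonzero the
    lowest nonzero coefficient of the quotient survives, and otherwise the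
    highest one does. *)
Lemma hasclass_grad_neq0 a f (u v : K) l :
  let w (i : 'I_2) := if i == ord0 then u else v in
  hasclass a f -> (u, v) != (0, 0) -> (l < n.-1)%N -> (f l).@[w] != 0 ->
  exists k, (a^`M(k)).@[rnc e u v] != 0.
Proof.
move=> w [h1 h2] uvN0 lt_ln flN0.
suff [k _ kN0] : exists2 k, (k <= n)%N & (gr a k).@[w] != 0.
  by exists (inord k); move: kN0; rewrite pullback_meval.
have [lt_le|le_el] := ltnP l e.-1; last first.
  by exists l.+2; [lia|rewrite h2 //; lia].
have wE : (s.@[w] = u) * (t.@[w] = v) by rewrite !mevalXU.
pose g r := (truncate f r).@[w].
have E k : (k <= e)%N -> (gr a k).@[w] = v ^+ 2 * g k - 2%:R * u * v * shift1 g k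
    + u ^+ 2 * shift1 (shift1 g) k.
  move=> le_ke; rewrite h1 // /dblmul !expr2 mevalD mevalB !mevalM rmorph_nat !wE.
  by case: k le_ke => [|[|k]] _ //=; rewrite ?meval0.
have glN0 : g l != 0 by rewrite /g /truncate lt_le.
have [vE0|vN0] := eqVneq v 0.
  have ub r : g r != 0 -> (r <= e.-2)%N.
    by rewrite /g /truncate; case: ifP; rewrite ?meval0 ?eqxx //; lia.
  have exg : exists r, g r != 0 by exists l.
  case: (ex_maxnP exg ub) => r grN0 _.
  exists r.+2; first by have := ub r grN0; lia.
  rewrite E ?vE0 /=; last by have := ub r grN0; lia.
  rewrite expr0n /= mul0r mulr0 mul0r subr0 add0r mulf_neq0 // expf_neq0 //.
  by apply: contraNneq uvN0 => ->; rewrite vE0.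
have exg : exists r, g r != 0 by exists l.
case: (ex_minnP exg) => r grN0 min_r.
have le_rl : (r <= l)%N by apply: min_r.
exists r; first by lia.
have g0 i : (i < r)%N -> g i = 0.
  by move=> lt_ir; apply/eqP; apply: contraTT lt_ir => /min_r; rewrite -leqNgt.
rewrite E; last by lia.
have -> : shift1 g r = 0 by case: (r) g0 => //= k; apply.
have -> : shift1 (shift1 g) r = 0 by case: (r) g0 => [|[|k]] //= h; apply: h; lia.
by rewrite !mulr0 subr0 addr0 mulf_neq0 ?expf_neq0.
Qed.

End ConormalClass.

(** * Homogeneous localisations of K[s, t] *)

Section FieldIdentities.

Variables (F : fieldType) (h : F).
Hypothesis hN0 : h != 0.

Lemma cross_mult_div (j j' : nat) (x S T a b : F) :
  S * x = a / h ^+ j -> T * x = b / h ^+ j' -> (a * h ^+ j') * T = (b * h ^+ j) * S.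
Proof.
have hj k : h ^+ k != 0 by rewrite expf_neq0.
move=> aE bE; have -> : a = S * x * h ^+ j by rewrite aE divfK.
have -> : b = T * x * h ^+ j' by rewrite bE divfK.
by ring.
Qed.

Lemma div_cancel (j j' : nat) (x S a b : F) : S != 0 ->
  S * x = a / h ^+ j -> a * h ^+ j' = b * S -> x = b / h ^+ (j + j').
Proof.
have hj k : h ^+ k != 0 by rewrite expf_neq0.
move=> SN0 xE abE; apply: (mulfI SN0); rewrite xE; apply: (mulIf (hj (j + j')%N)).
by rewrite mulrA divfK // {1}exprD mulrA divfK // abE mulrC.
Qed.

End FieldIdentities.

Section Homog.

Variable K : closedFieldType.
Notation s := ('X_ord0 : {mpoly K[2]}).
Notation t := ('X_ord_max : {mpoly K[2]}).

Lemma meval_homog (m c : nat) (a : {mpoly K[m]}) (x : K) v : a \is c.-homog ->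
  a.@[fun i => x * v i] = x ^+ c * a.@[v].
Proof.
move=> /dhomogP homa; rewrite !mevalE mulr_sumr big_seq [RHS]big_seq.
apply: eq_bigr => m' /homa /= <-; rewrite mulrCA; congr (_ * _).
rewrite mdegE -prodrXr -big_split /=.
by apply: eq_bigr => i _; rewrite exprMn.
Qed.

(** The homogeneous components of [b] in the wrong degrees are killed by [a].
    *)
Lemma homog_cancel (m c d : nat) (a b : {mpoly K[m]}) :
  a != 0 -> a \is c.-homog -> a * b \is d.-homog -> b != 0 ->
  (c <= d)%N /\ b \is (d - c).-homog.
Proof.
move=> aN0 homa homab bN0.
have hc i : (c + i)%N != d -> pihomog mdeg i b = 0.
  move=> neq; have := pihomog_ne0 (_ : d != (c + i)%N) homab.
  rewrite eq_sym neq => /(_ isT).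
  rewrite {1}(pihomog_partitionE (leq_maxl (msize b) i.+1)).
  have lt_i : (i < maxn (msize b) i.+1)%N by exact: leq_maxr.
  rewrite mulr_sumr raddf_sum (bigD1 (Ordinal lt_i)) //= big1 ?addr0 => [|j].
    rewrite pihomog_dE; last by apply: dhomogM => //; apply: pihomogP.
    by move/eqP; rewrite mulf_eq0 (negbTE aN0) => /eqP.
  rewrite -val_eqE /= => neqj; apply: (@pihomog_ne0 _ _ _ (c + j)).
    by rewrite eqn_add2l.
  by apply: dhomogM => //; apply: pihomogP.
have bE := pihomog_partitionE (leqnn (msize b)).
have le_cd : (c <= d)%N.
  rewrite leqNgt; apply: contra bN0 => lt_dc; rewrite bE big1 // => i _.
  by apply: hc; lia.
split=> //; rewrite bE; apply: rpred_sum => i _.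
have [ci|/hc->] := eqVneq (c + i)%N d; last exact: dhomog0.
by rewrite -ci addKn; apply: pihomogP.
Qed.

Lemma coprime_powers (l l' : nat) (a b : {mpoly K[2]}) :
  a * t ^+ l' = b * s ^+ l -> exists a', a = a' * s ^+ l.
Proof.
move=> eqab; pose ms := (U_(ord0) *+ l : 'X_{1..2})%MM.
exists (\sum_(m <- msupp a) a@_m *: 'X_[m - ms]).
rewrite {1}(mpolyE a) mulr_suml big_seq [RHS]big_seq; apply: eq_bigr => m ma.
rewrite mpolyXn -/ms -scalerAl -mpolyXD submK //.
apply/mnm_lepP => i; rewrite /ms mulmnE mnm1E.
have [<-|] := eqVneq ord0 i; last by [].
rewrite mul1n leqNgt; apply/negP => lt_ml.
move: ma; rewrite mcoeff_msupp -(mcoeffMX a (U_(ord_max) *+ l')%MM m) -mpolyXn.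
rewrite addmC eqab mpolyXn => /negP[]; apply/eqP/memN_msupp_eq0/negP.
rewrite (perm_mem (msuppMX _ _)) => /mapP[m' _ /mnmP/(_ ord0)]; rewrite !mnmDE !mulmnE !mnm1E /=.
by rewrite mul1n; lia.
Qed.

Lemma X_homog2 (i : 'I_2) : ('X_i : {mpoly K[2]}) \is 1.-homog.
Proof. by rewrite dhomogX /= mdeg1. Qed.

End Homog.

(** The formula of [hloc], with any field that contains the polynomial ring in
    place of its fraction field. *)
Definition floc (K : closedFieldType) (m : nat) (L : fieldType)
    (iota : {mpoly K[m]} -> L) (M : {mpoly K[m]} -> Prop) (g : {mpoly K[m]})
    (k : int) (x : L) : Prop :=
  exists j c dg : nat, exists a : {mpoly K[m]},
    [/\ M a, a \is c.-homog, g \is dg.-homog, c%:Z = k + (j * dg)%N%:Z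
      & x = iota a / iota g ^+ j].

Section Regular.

Variables (K : closedFieldType) (L : fieldType) (iota : {rmorphism {mpoly K[2]} -> L}).
Hypothesis iotaI : injective iota.
Variables (h : {mpoly K[2]}) (dg : nat).
Hypotheses (hN0 : h != 0) (homh : h \is dg.-homog) (dg_gt0 : (0 < dg)%N).

Notation s := ('X_ord0 : {mpoly K[2]}).
Notation t := ('X_ord_max : {mpoly K[2]}).
Notation O := (floc iota (fun=> True) h).

Let hF0 : iota h != 0. Proof. by rewrite (raddf_eq0 _ iotaI). Qed.

Lemma flocI k j c a : a \is c.-homog -> c%:Z = k + (j * dg)%N%:Z ->
  O k (iota a / iota h ^+ j).
Proof. by move=> homa cE; exists j, c, dg, a. Qed.

Lemma flocE k x : O k x -> exists j c a,
  [/\ a \is c.-homog, c%:Z = k + (j * dg)%N%:Z & x = iota a / iota h ^+ j].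
Proof.
move=> [j [c [dg' [a [_ homa homh' cE xE]]]]]; exists j, c, a; split=> //.
by rewrite (dhomog_uniq hN0 homh homh').
Qed.

Lemma floc_poly c a : a \is c.-homog -> O c (iota a).
Proof.
by move=> homa; rewrite -[iota a]divr1 -(expr0 (iota h)); apply: flocI homa _; rewrite mul0n addr0.
Qed.

Lemma floc0 k : O k 0.
Proof.
exists (absz k), (absz (k + (absz k * dg)%N%:Z)), dg, 0; split=> //; first exact: dhomog0.
  by rewrite gez0_abs //; nia.
by rewrite rmorph0 mul0r.
Qed.

Lemma flocM k k' x y : O k x -> O k' y -> O (k + k') (x * y).
Proof.
move=> /flocE[j [c [a [homa cE ->]]]] /flocE[j' [c' [a' [homa' c'E ->]]]].
rewrite mulf_div -exprD -rmorphM.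
by apply: flocI (dhomogM homa homa') _; rewrite PoszD cE c'E mulnDl PoszD; ring.
Qed.

Lemma flocD k x y : O k x -> O k y -> O k (x + y).
Proof.
move=> /flocE[j [c [a [homa cE ->]]]] /flocE[j' [c' [a' [homa' c'E ->]]]].
rewrite (addf_div _ _ (expf_neq0 j hF0) (expf_neq0 j' hF0)) -exprD.
rewrite -!rmorphXn -!rmorphM -rmorphD rmorphXn.
have E : (c + dg * j' = c' + dg * j)%N.
  by rewrite ![(dg * _)%N]mulnC; lia.
apply: (@flocI _ _ (c + dg * j')); last by rewrite PoszD cE; lia.
apply: rpredD; first by apply: dhomogM homa _; apply: dhomogMn.
by rewrite E; apply: dhomogM homa' _; apply: dhomogMn.
Qed.

Lemma floc_monomial al be : O (al + be)%N (iota s ^+ al * iota t ^+ be).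
Proof.
rewrite -!rmorphXn -rmorphM; apply: floc_poly.
have := dhomogM (dhomogMn al (X_homog2 K ord0)) (dhomogMn be (X_homog2 K ord_max)).
by rewrite !mul1n.
Qed.

(** P^1 is covered by the opens where [s] and [t] do not vanish: if powers of
    [s] and of [t] both clear the denominator, there is none, because [s] and
    [t] are coprime. *)
Lemma floc_coprime k (l l' : nat) x :
  O (k + l%:Z) (iota s ^+ l * x) -> O (k + l'%:Z) (iota t ^+ l' * x) -> O k x.
Proof.
move=> /flocE[j [c [a [homa cE sE]]]] /flocE[j' [c' [a' [homa' c'E tE]]]].
have sN0 : iota s != 0 by rewrite (raddf_eq0 _ iotaI) -msupp_eq0 msuppX.
have eqab : (a * h ^+ j') * t ^+ l' = (a' * h ^+ j) * s ^+ l.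
  apply/eqP; rewrite -(inj_eq iotaI) !rmorphM !rmorphXn; apply/eqP.
  exact: cross_mult_div sE tE.
have [b bE] := coprime_powers eqab.
have xE : x = iota b / iota h ^+ (j + j').
  apply: div_cancel (expf_neq0 l sN0) sE _ => //.
  by rewrite -!rmorphXn -!rmorphM bE.
have [b0|bN0] := eqVneq b 0.
  by rewrite xE b0 rmorph0 mul0r; apply: floc0.
have sl_homog : s ^+ l \is l.-homog.
  by have := dhomogMn l (X_homog2 K ord0); rewrite mul1n.
have homb := homog_cancel (_ : s ^+ l != 0) sl_homog (_ : s ^+ l * b \is (c + dg * j').-homog) bN0.
case: homb => [||le_l homb].
- by apply: expf_neq0; rewrite -msupp_eq0 msuppX.
- by rewrite mulrC -bE; apply: dhomogM homa _; apply: dhomogMn.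
rewrite xE; apply: flocI homb _.
by rewrite -subzn // PoszD cE; lia.
Qed.

End Regular.

(** * The conormal module up to torsion *)

Section FractionClass.

Variables (K : closedFieldType) (e n : nat).
Variables (L : fieldType) (iota : {rmorphism {mpoly K[2]} -> L}).
Hypothesis iotaI : injective iota.
Hypothesis charK : [pchar K] =i pred0.
Hypotheses (e_ge2 : (2 <= e)%N) (e_len : (e <= n)%N).
Implicit Types (a b p : {mpoly K[n.+1]}) (f : nat -> {mpoly K[2]}).

Notation pb := (@rnc_pullback K e n).
Notation s := ('X_ord0 : {mpoly K[2]}).
Notation t := ('X_ord_max : {mpoly K[2]}).
Notation xv := (@xv K n).
Notation gr := (@gr K e n).
Notation minor := (@minor K n).

Let e_gt0 : (0 < e)%N. Proof. exact: ltnW. Qed.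

Lemma embedX_neq0 (i : 'I_2) : iota 'X_i != 0.
Proof. by rewrite (raddf_eq0 _ iotaI) -msupp_eq0 msuppX. Qed.

Let sN0 : (iota s) != 0. Proof. exact: embedX_neq0. Qed.
Let tN0 : (iota t) != 0. Proof. exact: embedX_neq0. Qed.

Lemma embed_dblmul (x y : {mpoly K[2]}) f i :
  iota (dblmul x y f i) = dblmul (iota x) (iota y) (fun j => iota (f j)) i.
Proof.
rewrite /dblmul !expr2 rmorphD rmorphB !rmorphM rmorph_nat.
by case: i => [|[|i]] /=; rewrite ?rmorph0.
Qed.

(** The division of [hasclass] can be carried out for every [a], at the price
    of denominators. Starting from the constant coefficient introduces powers
    of [t] only, and [cls_rev] starts from the other end and introduces powers
    of [s] only. *)
Definition cls a (l : nat) : L :=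
  if (l < e.-1)%N then dbldiv (iota s) (iota t) (fun k => iota (gr a k)) l
  else iota (gr a l.+2).

Definition cls_rev a (l : nat) : L :=
  if (l < e.-1)%N then dbldiv (iota t) (iota s) (fun k => iota (gr a (e - k))) (e.-2 - l)
  else iota (gr a l.+2).

Lemma cls_hasclass a f l : hasclass e a f -> (l < n.-1)%N -> cls a l = iota (f l).
Proof.
move=> [h1 h2] lt_ln; rewrite /cls; case: ifP => lt_le; last by rewrite h2 //; lia.
rewrite (dbldiv_unique tN0 (rho := fun i => iota (truncate e f i))) ?/truncate ?lt_le //.
by move=> i le_il; rewrite h1 ?embed_dblmul //; lia.
Qed.

Lemma cls_rev_hasclass a f l : hasclass e a f -> (l < n.-1)%N -> cls_rev a l = iota (f l).
Proof.
move=> [h1 h2] lt_ln; rewrite /cls_rev; case: ifP => lt_le; last by rewrite h2 //; lia.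
rewrite (dbldiv_unique sN0 (rho := fun i => iota (truncate e f (e.-2 - i)))).
  by rewrite /truncate subKn; [rewrite lt_le|lia].
move=> i le_il; rewrite h1; last by lia.
rewrite embed_dblmul /dblmul.
have T0 r : (e.-1 <= r)%N -> truncate e f r = 0 by rewrite /truncate leqNgt => /negbTE->.
have [m mE] : exists m, (e - i = m.+2)%N by exists (e - i - 2)%N; lia.
rewrite mE /= (_ : e.-2 - i = m)%N; last by lia.
have -> : shift1 (fun i => iota (truncate e f (e.-2 - i))) i = iota (truncate e f m.+1).
  case: i {le_il} mE => [|i] mE /=; first by rewrite T0 ?rmorph0 //; lia.
  by rewrite (_ : e.-2 - i = m.+1)%N //; lia.
have -> : shift1 (shift1 (fun i => iota (truncate e f (e.-2 - i)))) i = iota (truncate e f m.+2).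
  case: i {le_il} mE => [|[|i]] mE /=; try by rewrite T0 ?rmorph0 //; lia.
  by rewrite (_ : e.-2 - i = m.+2)%N //; lia.
by ring.
Qed.

Lemma clsD a b l : cls (a + b) l = cls a l + cls b l.
Proof.
rewrite /cls; case: ifP => _; last by rewrite grD rmorphD.
rewrite -(dbldivD _ tN0); apply: dbldiv_unique => // i _.
by rewrite dblmulK // grD rmorphD.
Qed.

Lemma cls_revD a b l : cls_rev (a + b) l = cls_rev a l + cls_rev b l.
Proof.
rewrite /cls_rev; case: ifP => _; last by rewrite grD rmorphD.
rewrite -(dbldivD _ sN0); apply: dbldiv_unique => // i _.
by rewrite dblmulK // grD rmorphD.
Qed.

Lemma clsM p a l : pb a = 0 -> cls (p * a) l = iota (pb p) * cls a l.
Proof.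
move=> a0; rewrite /cls; case: ifP => _; last by rewrite grM a0 mulr0 add0r rmorphM.
rewrite -(dbldivZ _ tN0); apply: dbldiv_unique => // i _.
by rewrite dblmulK // grM a0 mulr0 add0r rmorphM.
Qed.

Lemma cls_revM p a l : pb a = 0 -> cls_rev (p * a) l = iota (pb p) * cls_rev a l.
Proof.
move=> a0; rewrite /cls_rev; case: ifP => _; last by rewrite grM a0 mulr0 add0r rmorphM.
rewrite -(dbldivZ _ sN0); apply: dbldiv_unique => // i _.
by rewrite dblmulK // grM a0 mulr0 add0r rmorphM.
Qed.

(** Modulo the [minor 0 j] and the [xv j] with [e < j], and up to a power of
    [xv 0], each form is congruent to a form in [xv 0] and [xv 1] alone, and
    the pullback is injective on the latter. So these elements generate the
    ideal of the curve up to powers of [xv 0], which can be cancelled in [L].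
    *)
Lemma conormal_vanish (chi : nat -> {mpoly K[n.+1]} -> L) :
  (forall c a b, a \is c.-homog -> b \is c.-homog -> pb a = 0 -> pb b = 0 ->
     chi c (a + b) = chi c a + chi c b) ->
  (forall c c' p a, p \is c.-homog -> a \is c'.-homog -> pb a = 0 ->
     chi (c + c')%N (p * a) = iota (pb p) * chi c' a) ->
  (forall j, (j < e)%N -> chi 2 (minor 0 j) = 0) ->
  (forall j, (e < j <= n)%N -> chi 1 (xv j) = 0) ->
  forall c a, a \is c.-homog -> pb a = 0 -> chi c a = 0.
Proof.
move=> chiD chiM chi_minor chi_x.
pose N c a := [/\ a \is c.-homog, pb a = 0 & chi c a = 0].
have ND c a b : N c a -> N c b -> N c (a + b).
  move=> [h1 h2 h3] [k1 k2 k3]; split; first exact: rpredD.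
    by rewrite rmorphD /= h2 k2 addr0.
  by rewrite chiD // h3 k3 addr0.
have NM c c' p a : p \is c.-homog -> N c' a -> N (c + c')%N (p * a).
  move=> homp [h1 h2 h3]; split; first exact: dhomogM.
    by rewrite rmorphM /= h2 mulr0.
  by rewrite chiM // h3 mulr0.
have N0 c : N c 0.
  split; [exact: dhomog0|exact: rmorph0|].
  have := @chiD c 0 0 (dhomog0 _ _ _) (dhomog0 _ _ _) (rmorph0 _) (rmorph0 _).
  by rewrite addr0 => /eqP; rewrite -subr_eq0 opprD addrA subrr add0r oppr_eq0 => /eqP.
pose sub (r : {mpoly K[2]}) : {mpoly K[n.+1]} := r \mPo [tuple xv 0; xv 1].
have subX0 : sub s = xv 0 by rewrite /sub comp_mpolyXU.
have subX1 : sub t = xv 1 by rewrite /sub comp_mpolyXU.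
have subM r r' : sub (r * r') = sub r * sub r' by rewrite /sub rmorphM.
have subD r r' : sub (r + r') = sub r + sub r' by rewrite /sub rmorphD.
have sub0 k : sub (s ^+ k) = xv 0 ^+ k by rewrite /sub rmorphXn /= -/(sub s) subX0.
have sub1 k : sub (t ^+ k) = xv 1 ^+ k by rewrite /sub rmorphXn /= -/(sub t) subX1.
have homs k : s ^+ k \is k.-homog by have := dhomogMn k (X_homog2 K ord0); rewrite mul1n.
have homt k : t ^+ k \is k.-homog by have := dhomogMn k (X_homog2 K ord_max); rewrite mul1n.
have homx i k : xv i ^+ k \is k.-homog by have := dhomogMn k (xv_homog K n i); rewrite mul1n.
have sub_homog c r : r \is c.-homog -> sub r \is c.-homog.
  move=> /dhomogP homr; rewrite (mpolyE r) /sub raddf_sum big_seq; apply: rpred_sum => m /homr /= <-.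
  rewrite /= comp_mpolyZ; apply: rpredZ; rewrite comp_mpolyX big_ord_recl big_ord1.
  rewrite mdegE big_ord_recl big_ord1.
  by apply: dhomogM; rewrite (tnth_nth 0) /=; apply: homx.
(* [Red] holds for the forms that admit such a reduction; it is closed under
   sums and products, and the generators satisfy it. *)
pose Red c a := a \is c.-homog /\ exists k r,
  r \is (k + c).-homog /\ N (k + c)%N (xv 0 ^+ k * a - sub r).
have RedX i : (i <= n)%N -> Red 1 (xv i).
  move=> le_in; split; first exact: xv_homog.
  have [lt_ei|le_ie] := ltnP e i.
    exists 0%N, 0; split; first exact: dhomog0.
    rewrite expr0 mul1r /sub rmorph0 subr0; split; first exact: xv_homog.
      by apply: pullback_xv0; rewrite // lt_ei.
    by apply: chi_x; rewrite lt_ei.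
  case: i le_in le_ie => [|i] le_in le_ie.
    by exists 0%N, s; split; [exact: (homs 1)|rewrite expr0 mul1r subX0 subrr; apply: N0].
  exists i, (t ^+ i.+1); rewrite addn1; split=> //; rewrite sub1.
  elim: i le_in le_ie => [|i IHi] le_in le_ie; first by rewrite expr0 mul1r subrr; apply: N0.
  have -> : xv 0 ^+ i.+1 * xv i.+2 - xv 1 ^+ i.+2 =
    xv 0 ^+ i * minor 0 i.+1 + xv 1 * (xv 0 ^+ i * xv i.+1 - xv 1 ^+ i.+1).
    by rewrite /minor ![_ ^+ _.+1]exprS; ring.
  apply: ND; last first.
    by apply: (@NM 1); [exact: xv_homog|apply: IHi; exact: ltnW].
  rewrite -addn2; apply: NM => //; split; [exact: minor_homog| |exact: chi_minor].
  exact: pullback_minor.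
have RedM c c' a a' : Red c a -> Red c' a' -> Red (c + c')%N (a * a').
  move=> [homa [k [r [homr Nr]]]] [homa' [k' [r' [homr' Nr']]]].
  split; first exact: dhomogM.
  exists (k + k')%N, (r * r'); rewrite addnACA; split; first exact: dhomogM.
  have -> : xv 0 ^+ (k + k') * (a * a') - sub (r * r') =
    (xv 0 ^+ k * a) * (xv 0 ^+ k' * a' - sub r') + sub r' * (xv 0 ^+ k * a - sub r).
    by rewrite subM exprD; ring.
  apply: ND; first by apply: NM => //; apply: dhomogM.
  by rewrite addnC; apply: NM => //; apply: sub_homog.
have RedD c a a' : Red c a -> Red c a' -> Red c (a + a').
  move=> [homa [k [r [homr Nr]]]] [homa' [k' [r' [homr' Nr']]]].
  split; first exact: rpredD.
  exists (k' + k)%N, (s ^+ k' * r + s ^+ k * r'); split.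
    apply: rpredD; first by rewrite -addnA; apply: dhomogM.
    by rewrite addnAC [(k' + c + k)%N]addnC; apply: dhomogM.
  have -> : xv 0 ^+ (k' + k) * (a + a') - sub (s ^+ k' * r + s ^+ k * r') =
    xv 0 ^+ k' * (xv 0 ^+ k * a - sub r) + xv 0 ^+ k * (xv 0 ^+ k' * a' - sub r').
    by rewrite subD !subM !sub0 exprD; ring.
  apply: ND; first by rewrite -addnA; apply: NM.
  by rewrite addnAC [(k' + c + k)%N]addnC; apply: NM.
have Red0 c : Red c 0.
  split; first exact: dhomog0.
  exists 0%N, 0; split; first exact: dhomog0.
  by rewrite mulr0 /sub rmorph0 subr0; apply: N0.
have RedC x : Red 0 x%:MP.
  have homC m : (x%:MP : {mpoly K[m]}) \is 0.-homog.
    by apply/dhomogP => m0; rewrite msuppC; case: ifP => // _; rewrite inE => /eqP->; exact: mdeg0.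
  split=> //; exists 0%N, x%:MP; split=> //.
  by rewrite expr0 mul1r /sub comp_mpolyC subrr; apply: N0.
have RedXm m : Red (mdeg m) 'X_[m].
  rewrite mpolyXE_id mdegE; elim/big_rec2: _ => [|i c p _ IH].
    by rewrite -mpolyC1; apply: RedC.
  apply: (fun h => RedM _ _ _ _ h IH); have RX : Red 1 'X_i.
    by rewrite -(inord_val i); apply: RedX; rewrite -ltnS.
  elim: (m i) => [|k IHk]; first by rewrite expr0 -mpolyC1; apply: RedC.
  by rewrite exprS -[k.+1]add1n; apply: RedM.
move=> c a homa a0.
have [_ [k [r [homr [Nr1 Nr2 Nr3]]]]] : Red c a.
  rewrite (mpolyE a) big_seq; elim/big_rec: _ => [|m b ma IH]; first exact: Red0.
  apply: RedD IH; have /dhomogP/(_ m ma)/= <- := homa.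
  by rewrite -mul_mpolyC -[mdeg m]add0n; apply: RedM.
(* The reduced form [sub r] vanishes on the curve, and at the point [(1 : w 1
   / w 0)] of the curve it takes the value of [r] at [w], up to a power of [w
   0]. *)
have r0 : r = 0.
  apply/eqP/negPn/negP => rN0.
  have srN0 : s * r != 0 by rewrite mulf_neq0 // -msupp_eq0 msuppX.
  have [w] := mpoly_nonroot charK srN0.
  rewrite mevalM mevalXU mulf_eq0 negb_or => /andP[w0 /negP[]].
  pose w' (i : 'I_2) : K := if i == ord0 then 1 else w ord_max / w ord0.
  have := congr1 (meval w') Nr2.
  rewrite rmorphB rmorphM /= a0 mulr0 sub0r mevalN meval0 pullback_meval.
  rewrite comp_mpoly_meval => /eqP; rewrite oppr_eq0 => /eqP r'0.
  rewrite (meval_eq (v2 := fun i => w ord0 * w' i)).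
    rewrite (meval_homog _ _ homr) -[X in _ * X]/(r.@[w']).
    rewrite (meval_eq (v2 := fun i => (tnth [tuple xv 0; xv 1] i).@[rnc e (w' ord0) (w' ord_max)])).
      by rewrite r'0 mulr0.
    move=> i; rewrite (tnth_nth 0); case: i => [[|[|//]] lti] /=;
      rewrite mevalXU /rnc inordK ?ltnS /= ?(leq_trans e_gt0) // ?e_gt0.
      by rewrite /w' /= expr1n mul1r expr0.
    by rewrite /w' /= expr1n mul1r expr1.
  move=> i; rewrite /w'; case: eqP => [->|iN0]; first by rewrite mulr1.
  rewrite mulrC divfK //; congr (w _); apply: val_inj.
  by case: i iN0 => [[|[|//]] lti] // h; case: h; apply: val_inj.
have := chiM k c (xv 0 ^+ k) a (homx _ _) homa a0.
move: Nr3; rewrite r0 /sub rmorph0 subr0 => -> /esym/eqP.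
rewrite mulf_eq0 (raddf_eq0 _ iotaI) rmorphXn expf_eq0 /= pullback_xv // expr0 mulr1.
by rewrite expf_eq0 -msupp_eq0 msuppX !andbF /= => /eqP.
Qed.

End FractionClass.

(** * The kernel of a row of monomials *)

Section Chain.

Variables (K : closedFieldType) (L : fieldType) (iota : {rmorphism {mpoly K[2]} -> L}).
Hypothesis iotaI : injective iota.
Variables (h : {mpoly K[2]}) (dg : nat).
Hypotheses (hN0 : h != 0) (homh : h \is dg.-homog) (dg_gt0 : (0 < dg)%N).

Notation s := (iota 'X_ord0).
Notation t := (iota 'X_ord_max).
Notation O := (floc iota (fun=> True) h).

Let sN0 : s != 0. Proof. exact: embedX_neq0. Qed.
Let tN0 : t != 0. Proof. exact: embedX_neq0. Qed.

Let OM := flocM (iota := iota) hN0 homh.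
Let OD := flocD iotaI hN0 homh dg_gt0.
Let O0 := floc0 iotaI hN0 homh dg_gt0.

Lemma floc_sum (I : eqType) (r : seq I) (P : pred I) (F : I -> L) k :
  (forall i, i \in r -> P i -> O k (F i)) -> O k (\sum_(i <- r | P i) F i).
Proof.
move=> OF; rewrite big_seq_cond; elim/big_ind: _ => [|x y|i /andP[ir Pi]].
- exact: O0.
- exact: OD.
- exact: OF.
Qed.

Lemma floc_const k (c : K) x : O k x -> O k (iota c%:MP * x).
Proof.
move=> Ox; rewrite -[k]add0r; apply: OM Ox; apply: (@floc_poly _ _ iota _ _ homh 0).
by apply/dhomogP => m; rewrite msuppC; case: ifP => // _; rewrite inE => /eqP->; exact: mdeg0.
Qed.

Lemma flocN k x : O k x -> O k (- x).
Proof.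
by move=> /(floc_const (-1)); rewrite mpolyCN rmorphN mpolyC1 rmorph1 mulN1r.
Qed.

Lemma floc_s : O 1 s. Proof. exact: (floc_poly iota homh (X_homog2 K ord0)). Qed.
Lemma floc_t : O 1 t. Proof. exact: (floc_poly iota homh (X_homog2 K ord_max)). Qed.

Lemma floc_exp k x j : O k x -> O (k * j%:Z) (x ^+ j).
Proof.
move=> Ox; elim: j => [|j IHj].
  by rewrite mulr0 expr0 -(rmorph1 iota); apply: (@floc_poly _ _ iota _ _ homh 0); apply: dhomog1.
by rewrite exprS (_ : k * j.+1%:Z = k + k * j%:Z); [apply: OM|lia].
Qed.

(** Each division by [y ^ 2] lowers the degree by two and only adds powers of
    [y] to the denominator. *)
Lemma dbldiv_regular (x y : L) (k : int) (u : nat -> L) (r : nat) :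
  O 1 x -> O 1 y -> y != 0 -> (forall i, O k (u i)) ->
  exists j : nat, O (k - 2 + j%:Z) (y ^+ j * dbldiv x y u r).
Proof.
move=> Ox Oy yN0 Ou.
pose Q k z := exists j : nat, O (k + j%:Z) (y ^+ j * z).
have Qadd k' z z' : Q k' z -> Q k' z' -> Q k' (z + z').
  move=> [j Oj] [j' Oj']; exists (j + j')%N; rewrite mulrDr; apply: OD.
    rewrite exprD mulrAC mulrC (_ : _ + _ = j'%:Z + (k' + j%:Z)); last by lia.
    by apply: OM => //; rewrite -[X in O X]mul1r; apply: floc_exp.
  rewrite exprD -mulrA (_ : _ + _ = j%:Z + (k' + j'%:Z)); last by lia.
  by apply: OM => //; rewrite -[X in O X]mul1r; apply: floc_exp.
have Qmul k' k'' z w : O k' w -> Q k'' z -> Q (k' + k'') (w * z).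
  by move=> Ow [j Oj]; exists j; rewrite mulrCA -addrA; apply: OM.
have Qdiv k' z : Q k' z -> Q (k' - 2) (z / y ^+ 2).
  move=> [j Oj]; exists (j + 2)%N; rewrite exprD -mulrA [y ^+ 2 * _]mulrC divfK ?expf_neq0 //.
  by rewrite (_ : _ + _ = k' + j%:Z) //; lia.
have Q0 k' : Q k' 0 by exists 0%N; rewrite mulr0; apply: O0.
have Qu i : Q k (u i) by exists 0%N; rewrite expr0 mul1r addr0; apply: Ou.
have [] : Q (k - 2) (dbldiv_rec x y u r).1 /\ Q (k - 2) (dbldiv_rec x y u r).2; last by [].
elim: r => [|r [Q1 Q2]] /=; first by split=> //; apply: Qdiv.
case: (dbldiv_rec _ _ _ _) Q1 Q2 => p q /= Qp Qq; split=> //; apply: Qdiv.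
have E2 : k = (2 + (k - 2))%R by lia.
apply: (Qadd); first apply: (Qadd) => //.
  rewrite {1}E2; apply: (Qmul) Qp; rewrite -mulrA -(rmorph_nat iota) -mpolyC_nat.
  by apply: floc_const; apply: (OM Ox Oy).
by rewrite {1}E2 -mulNr; apply: (Qmul) Qq; apply: flocN; apply: (floc_exp 2 Ox).
Qed.

Variables (e N l0 de : nat) (k : nat -> int) (q p al be : nat -> nat).
(** The normal bundle of the curve in P^n is the direct sum of the O(Ndeg l),
    for [l < n.-1]. *)
Definition Ndeg (l : nat) : nat := if (l < e.-1)%N then e.+2 else e.

Hypotheses (l0_leN : (l0 <= N)%N)
  (k_triv : forall l, (l < l0)%N -> k l = (Ndeg l)%:Z)
  (qE : forall l, (l0 <= l < N)%N -> (Ndeg l)%:Z = k l + (q l)%:Z)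
  (beS : forall l, (l0 <= l < N)%N -> be l.+1 = (be l + q l)%N)
  (alS : forall l, (l0 <= l < N)%N -> al l = (al l.+1 + p l)%N)
  (albe : forall l, (l0 <= l <= N)%N -> (al l + be l + Ndeg l = de)%N).

(** The class of the hypersurface: it induces a map from the normal bundle of
    the curve in P^n to O(d e), whose kernel is the normal bundle in the
    hypersurface. *)
Definition row (l : nat) : {mpoly K[2]} :=
  if (l < l0)%N then 0 else 'X_ord0 ^+ al l * 'X_ord_max ^+ be l.

(** Values of the linear form [w] on a basis of the kernel of [row]: the
    vectors [e_l] for [l < l0], then the vectors [- t ^ q_l e_l + s ^ p_l
    e_(l+1)], which generate the O(k_l). *)
Definition chain (w : nat -> L) (l : nat) : L :=
  if (l < l0)%N then w l else - t ^+ q l * w l + s ^+ p l * w l.+1.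

Lemma row_relation l : (l0 <= l < N)%N ->
  iota (row l) * t ^+ q l = iota (row l.+1) * s ^+ p l.
Proof.
move=> /andP[le_l0 lt_lN]; rewrite /row ltnNge le_l0 ltnNge leqW //= !rmorphM !rmorphXn /=.
by rewrite alS ?beS ?le_l0 // !exprD; ring.
Qed.

Lemma row_neq0 l : (l0 <= l)%N -> iota (row l) != 0.
Proof.
by move=> le_l0; rewrite /row ltnNge le_l0 /= rmorphM !rmorphXn mulf_neq0 ?expf_neq0.
Qed.

Lemma chain_mul c w l : chain (fun i => c * w i) l = c * chain w l.
Proof. by rewrite /chain; case: ifP => _; ring. Qed.

Lemma chain_add w w' l : chain (fun i => w i + w' i) l = chain w l + chain w' l.
Proof. by rewrite /chain; case: ifP => _; ring. Qed.

Lemma chain_row l : (l < N)%N -> chain (fun i => iota (row i)) l = 0.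
Proof.
move=> lt_lN; rewrite /chain; case: ifP => [lt_l|/negbT]; first by rewrite /row lt_l rmorph0.
rewrite -leqNgt => le_l0; have := @row_relation l; rewrite le_l0 lt_lN => /(_ isT) E.
by rewrite [s ^+ _ * _]mulrC -E; ring.
Qed.

(** The basis of the kernel is triangular. *)
Lemma chain_inj (v : nat -> L) :
  (forall i, (i < N)%N -> \sum_(l < N) v l * chain (fun l => (l == i)%:R) l = 0) ->
  forall l, (l < N)%N -> v l = 0.
Proof.
move=> hv; elim/ltn_ind => l IHl lt_lN; have := hv l lt_lN.
rewrite (bigD1 (Ordinal lt_lN)) //= big1 ?addr0 => [|i].
  rewrite /chain eqxx gtn_eqF //; case: ifP => _; first by rewrite mulr1.
  by rewrite mulr1 mulr0 addr0 => /eqP; rewrite mulf_eq0 oppr_eq0 expf_eq0 (negbTE tN0) andbF orbF => /eqP.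
rewrite -val_eqE /= => neq_il; have [lt_il|le_li] := ltnP i l; first by rewrite IHl ?mul0r.
rewrite /chain (negbTE neq_il) [i.+1 == l]gtn_eqF ?ltnS //.
by case: ifP => _; rewrite !mulr0 ?addr0 ?mulr0.
Qed.

(** The coordinates of [nu] in the basis of the kernel are quotients of the
    partial sums [A l.+1] by monomials. As the full sum is zero, [A l.+1] is
    also minus the sum of the remaining terms. The terms up to [l] are
    divisible by [s ^ al l] and the terms after [l] by [t ^ be l.+1], so the
    coordinates are regular both where [s] and where [t] is invertible. *)
Lemma chain_exact (nu : nat -> L) :
  (forall l, (l <= N)%N -> O (Ndeg l) (nu l)) ->
  \sum_(l < N.+1) iota (row l) * nu l = 0 ->
  exists2 v : nat -> L, (forall l, (l < N)%N -> O (k l) (v l)) &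
    forall w : nat -> L, \sum_(l < N.+1) nu l * w l = \sum_(l < N) v l * chain w l.
Proof.
move=> Onu nu0; pose A r := \sum_(l < r) iota (row l) * nu l.
have A0 r : (r <= l0)%N -> A r = 0.
  move=> le_r; apply: big1 => i _.
  by rewrite /row (leq_trans (ltn_ord i) le_r) rmorph0 mul0r.
have AS r : A r.+1 = A r + iota (row r) * nu r by rewrite /A big_ord_recr.
pose v l := if (l < l0)%N then nu l else - A l.+1 / (iota (row l) * t ^+ q l).
have al_mono i j : (l0 <= i)%N -> (i <= j)%N -> (j <= N)%N -> (al j <= al i)%N.
  move=> le_l0 le_ij; elim: j le_ij => [|j IHj]; first by rewrite leqn0 => /eqP->.
  rewrite leq_eqVlt => /predU1P[<- //|]; rewrite ltnS => le_ij lt_jN.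
  by apply: leq_trans (IHj le_ij (ltnW lt_jN)); rewrite [al j]alS ?leq_addr //; lia.
have be_mono i j : (l0 <= i)%N -> (i <= j)%N -> (j <= N)%N -> (be i <= be j)%N.
  move=> le_l0 le_ij; elim: j le_ij => [|j IHj]; first by rewrite leqn0 => /eqP->.
  rewrite leq_eqVlt => /predU1P[<- //|]; rewrite ltnS => le_ij lt_jN.
  by apply: leq_trans (IHj le_ij (ltnW lt_jN)) _; rewrite beS ?leq_addr //; lia.
exists v => [l lt_lN|w].
  rewrite /v; case: ifP => [lt_l|/negbT]; first by rewrite k_triv //; apply: Onu; apply: ltnW.
  rewrite -leqNgt => le_l0; set vl := _ / _.
  have lE : (l0 <= l < N)%N by rewrite le_l0.
  have vE : s ^+ al l * t ^+ be l.+1 * vl = - A l.+1.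
    have -> : s ^+ al l * t ^+ be l.+1 = iota (row l) * t ^+ q l.
      by rewrite /row ltnNge le_l0 /= rmorphM !rmorphXn beS // exprD mulrA.
    by rewrite /vl mulrC divfK // mulf_neq0 ?row_neq0 // expf_neq0.
  have kE : k l = (Ndeg l)%:Z - (q l)%:Z by rewrite qE // addrK.
  have dE := @albe l; have bE := beS lE.
  apply: (floc_coprime iotaI hN0 homh dg_gt0 (l := al l) (l' := be l.+1)).
    have -> : s ^+ al l * vl = \sum_(l.+1 <= i < N.+1) s ^+ al i * t ^+ (be i - be l.+1) * nu i.
      have tbN0 : t ^+ be l.+1 != 0 by rewrite expf_neq0.
      apply: (mulfI tbN0); rewrite mulrCA mulrA vE.
      have := nu0; rewrite -/(A N.+1) /A -(big_mkord xpredT (fun i => iota (row i) * nu i)).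
      rewrite (big_cat_nat (n := l.+1)) //=; last exact: ltnW.
      rewrite big_mkord -/(A l.+1) => /eqP.
      rewrite addrC addr_eq0 => /eqP <-; rewrite mulr_sumr; apply: eq_big_nat => i /andP[lt_li le_iN].
      rewrite /row ltnNge (leq_trans le_l0 (ltnW lt_li)) /= rmorphM !rmorphXn /=.
      have -> : t ^+ be i = t ^+ be l.+1 * t ^+ (be i - be l.+1).
        by rewrite -exprD subnKC //; apply: be_mono => //; lia.
      by ring.
    apply: (@floc_sum nat (index_iota _ _) xpredT) => i; rewrite mem_index_iota => /andP[lt_li le_iN] _.
    have be_le := @be_mono l.+1 i; have dEi := @albe i.
    have -> : k l + (al l)%:Z = (al i + (be i - be l.+1))%N%:Z + (Ndeg i)%:Z by lia.
    by apply: OM; [apply: (floc_monomial iota homh)|apply: Onu].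
  have -> : t ^+ be l.+1 * vl = - \sum_(l0 <= i < l.+1) s ^+ (al i - al l) * t ^+ be i * nu i.
    have saN0 : s ^+ al l != 0 by rewrite expf_neq0.
    apply: (mulfI saN0); rewrite mulrA vE mulrN /A; congr (- _).
    rewrite -(big_mkord xpredT (fun i => iota (row i) * nu i)).
    rewrite (big_cat_nat (n := l0)) //=; last exact: leqW.
    rewrite [X in X + _]big_nat_cond big1 ?add0r => [|i /andP[/andP[_ lt_i] _]]; last first.
      by rewrite /row lt_i rmorph0 mul0r.
    rewrite mulr_sumr; apply: eq_big_nat => i /andP[le_i lt_il].
    rewrite /row ltnNge le_i /= rmorphM !rmorphXn /=.
    have -> : s ^+ al i = s ^+ al l * s ^+ (al i - al l).
      by rewrite -exprD subnKC //; apply: al_mono => //; lia.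
    by ring.
  apply: flocN; apply: (@floc_sum nat (index_iota _ _) xpredT) => i; rewrite mem_index_iota => /andP[le_i lt_il] _.
  have al_le := @al_mono i l; have dEi := @albe i.
  have -> : k l + (be l.+1)%:Z = (al i - al l + be i)%N%:Z + (Ndeg i)%:Z by lia.
  by apply: OM; [apply: (floc_monomial iota homh)|apply: Onu; lia].
(* [C r * w r] is the error term of the expansion truncated at [r]; it cancels
   the last term because [A N.+1 = 0]. *)
pose C r := if (r < l0)%N then 0 else A r / iota (row r).
have main r : (r <= N)%N ->
    \sum_(l < r) nu l * w l = \sum_(l < r) v l * chain w l + C r * w r.
  elim: r => [|r IHr] lt_rN.
    rewrite !big_ord0 add0r /C A0; last by lia.
    by case: ifP; rewrite mul0r ?mul0r.
  rewrite !big_ord_recr /= (IHr (ltnW lt_rN)) -!addrA; congr (_ + _).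
  rewrite /C /v /chain; case: (ltnP r l0) => [lt_r|le_r].
    case: ifP => _; last by rewrite A0 //; ring.
    by ring.
  rewrite ltnNge leqW //=.
  have N1 := row_neq0 le_r; have N2 := row_neq0 (leqW le_r).
  have E := @row_relation r; rewrite le_r lt_rN in E; have {}E := E isT.
  have tqN0 : t ^+ q r != 0 by rewrite expf_neq0.
  have spN0 : s ^+ p r != 0 by rewrite expf_neq0.
  rewrite AS.
  move: (iota (row r)) (iota (row r.+1)) (t ^+ q r) (s ^+ p r) N1 N2 E tqN0 spN0 => f f' T S.
  move=> fN0 f'N0 E TN0 SN0; rewrite E.
  have -> : f = f' * S / T by rewrite -E mulfK.
  by field; rewrite TN0 SN0 f'N0.
rewrite big_ord_recr /= main // -addrA -mulrDl.
suff -> : C N + nu N = 0 by rewrite mul0r addr0.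
have := nu0; rewrite -/(A N.+1) AS /C ltnNge l0_leN /= => /eqP; rewrite addr_eq0 => /eqP->.
by rewrite mulNr [X in X / _]mulrC mulfK ?row_neq0 // addNr.
Qed.

End Chain.

(** * Coordinates of normal sections *)

Lemma mderiv_homog (R : nzRingType) (m c : nat) (a : {mpoly R[m]}) i :
  a \is c.+1.-homog -> a^`M(i) \is c.-homog.
Proof.
move=> /dhomogP homa; apply/dhomogP => m'; rewrite mcoeff_msupp mcoeff_deriv => aN0.
have /homa /= : (m' + U_(i))%MM \in msupp a.
  by rewrite mcoeff_msupp; apply: contraNneq aN0 => ->; rewrite mul0rn.
by rewrite mdegD mdeg1 addn1 => -[].
Qed.

Lemma mderiv_homog0 (R : nzRingType) (m : nat) (a : {mpoly R[m]}) i :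
  a \is 0.-homog -> a^`M(i) = 0.
Proof.
move=> /dhomogP homa; apply/mpolyP => m'; rewrite mcoeff_deriv mcoeff0.
rewrite memN_msupp_eq0 ?mul0rn //; apply/negP => /homa /=.
by rewrite mdegD mdeg1 addn1.
Qed.

Lemma transverse_range (e n l : nat) :
  (l < e.-1)%N = false -> (l < n.-1)%N -> (e < l.+2 <= n)%N.
Proof. by lia. Qed.

Lemma edge_degree (e : nat) : (2 <= e)%N ->
  (e * 3)%N%:Z = e.+2%:Z + (e.-1.*2)%:Z.
Proof. by lia. Qed.

Section NormalSections.

Variables (K : closedFieldType) (e n : nat).
Variables (L : fieldType) (iota : {rmorphism {mpoly K[2]} -> L}).
Hypothesis iotaI : injective iota.
Hypothesis charK : [pchar K] =i pred0.
Hypotheses (e_ge2 : (2 <= e)%N) (e_len : (e <= n)%N).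
Implicit Types (a b : {mpoly K[n.+1]}).

Notation pb := (@rnc_pullback K e n).
Notation s := (iota 'X_ord0).
Notation t := (iota 'X_ord_max).
Notation xv := (@xv K n).
Notation minor := (@minor K n).
Notation cls := (@cls K e n L iota).

Let e_gt0 : (0 < e)%N. Proof. exact: ltnW. Qed.
Let sN0 : s != 0. Proof. exact: embedX_neq0. Qed.
Let tN0 : t != 0. Proof. exact: embedX_neq0. Qed.

(** The difference is linear over the pullback and vanishes on generators of
    the ideal, whose classes are polynomial. *)
Lemma cls_rev_cls c a l : (l < n.-1)%N -> a \is c.-homog -> pb a = 0 ->
  cls a l = cls_rev e iota a l.
Proof.
move=> lt_ln homa a0; apply/eqP; rewrite -subr_eq0; apply/eqP; move: c a homa a0.
apply: (conormal_vanish iotaI charK e_ge2 e_len (chi := fun _ a => cls a l - cls_rev e iota a l)).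
- move=> c a b _ _ _ _; rewrite clsD ?cls_revD //; ring.
- move=> c c' p a _ _ a0; rewrite clsM ?cls_revM //; ring.
- move=> j lt_je; have hc := hasclass_minor K e_ge2 e_len (leq0n j) lt_je.
  by rewrite (cls_hasclass iotaI e_ge2 e_len hc lt_ln) (cls_rev_hasclass iotaI e_ge2 e_len hc lt_ln) subrr.
move=> j lt_ej; have jE : j.-2.+2 = j by lia.
have hc : hasclass e (xv j.-2.+2 * 1) (delta j.-2 (pb 1)).
  by apply: hasclass_xv; lia.
rewrite mulr1 jE in hc.
by rewrite (cls_hasclass iotaI e_ge2 e_len hc lt_ln) (cls_rev_hasclass iotaI e_ge2 e_len hc lt_ln) subrr.
Qed.

(** The [minor 0 j] are obtained from the [edgeL 0 l] recursively, after
    multiplication by [xv 0]. *)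
Lemma conormal_vanish_edges (chi : nat -> {mpoly K[n.+1]} -> L) :
  (forall c a b, a \is c.-homog -> b \is c.-homog -> pb a = 0 -> pb b = 0 ->
     chi c (a + b) = chi c a + chi c b) ->
  (forall c c' p a, p \is c.-homog -> a \is c'.-homog -> pb a = 0 ->
     chi (c + c')%N (p * a) = iota (pb p) * chi c' a) ->
  (forall l, (l < n.-1)%N -> (l < e.-1)%N -> chi 3 (edgeL K n 0 l) = 0) ->
  (forall l, (l < n.-1)%N -> (e.-1 <= l)%N -> chi 1 (xv l.+2) = 0) ->
  forall c a, a \is c.-homog -> pb a = 0 -> chi c a = 0.
Proof.
move=> chiD chiM chi_edge chi_x.
apply: (conormal_vanish iotaI charK e_ge2 e_len chiD chiM) => [j|j lt_ej]; last first.
  by have := chi_x j.-2; rewrite (_ : j.-2.+2 = j); [apply; lia|lia].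
have hom2 i j' := minor_homog K n i j'.
have x_hom i := xv_homog K n i.
elim: j => [|j IHj] lt_je.
  have := chiM 0%N 2%N 0 0 (dhomog0 _ _ _) (dhomog0 _ _ _) (rmorph0 _).
  by rewrite add0n mul0r !rmorph0 mul0r => <-; rewrite /minor mulrC subrr.
have M0 i : (i < e)%N -> pb (minor 0 i) = 0 by move=> ?; apply: pullback_minor.
have XE : xv 0 * minor 0 j.+1 = edgeL K n 0 j + xv 1 * minor 0 j.
  by rewrite /edgeL subrK.
have hE : chi 3 (edgeL K n 0 j) = 0 by apply: chi_edge; lia.
have := chiM 1%N 2%N (xv 0) (minor 0 j.+1) (x_hom _) (hom2 _ _) (M0 _ lt_je).
rewrite XE chiD; last 4 first.
- exact: edge_homog.
- exact: (dhomogM (x_hom 1%N) (hom2 _ _)).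
- by apply: pullback_edgeL.
- by rewrite rmorphM /= M0 ?mulr0 // ltnW.
rewrite -[X in X + _]/(chi 3 _) hE add0r.
rewrite (chiM 1%N 2%N) ?x_hom ?hom2 ?M0 ?(ltnW lt_je) // (IHj (ltnW lt_je)) mulr0.
move/esym/eqP; rewrite mulf_eq0 (raddf_eq0 _ iotaI) pullback_xv // expr0 mulr1.
by rewrite expf_eq0 -msupp_eq0 msuppX !andbF /= => /eqP.
Qed.

Section OverOpen.

Variables (g : {mpoly K[n.+1]}) (m : nat).
Hypotheses (m_gt0 : (0 < m)%N) (homg : g \is m.-homog) (hN0 : pb g != 0).

Notation h := (pb g).
Notation O := (floc iota (fun=> True) h).

Let homh : h \is (e * m).-homog. Proof. exact: pullback_homog. Qed.
Let em_gt0 : (0 < e * m)%N. Proof. by rewrite muln_gt0 e_gt0. Qed.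
Let OM := flocM (iota := iota) hN0 homh.
Let O0 := floc0 iotaI hN0 homh em_gt0.
Let hF0 : iota h != 0. Proof. by rewrite (raddf_eq0 _ iotaI). Qed.

Lemma gr_regular c a k : a \is c.-homog -> O ((e * c)%N%:Z - e%:Z) (iota (gr e a k)).
Proof.
case: c => [|c] homa.
  by rewrite /gr (mderiv_homog0 _ homa) !rmorph0; apply: O0.
rewrite mulnS PoszD addrAC subrr add0r; apply: (floc_poly iota homh).
exact: pullback_homog (mderiv_homog _ homa).
Qed.

(** [cls] has poles at [t = 0] at most and [cls_rev] at [s = 0] at most, and
    they are equal. *)
Lemma cls_regular c a l : (l < n.-1)%N -> a \is c.-homog -> pb a = 0 ->
  O ((e * c)%N%:Z - (Ndeg e l)%:Z) (cls a l).
Proof.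
move=> lt_ln homa a0; rewrite /Ndeg; case: ifP => lt_le; last first.
  by rewrite /cls lt_le; apply: gr_regular.
have kE : (e * c)%N%:Z - e.+2%:Z = (e * c)%N%:Z - e%:Z - 2 by lia.
have [j Oj] : exists j : nat, O ((e * c)%N%:Z - e%:Z - 2 + j%:Z) (t ^+ j * cls a l).
  rewrite /cls lt_le; apply: (dbldiv_regular iotaI hN0 homh em_gt0) => // [||i].
  - exact: (floc_s iota homh).
  - exact: (floc_t iota homh).
  - exact: gr_regular.
have [j' Oj'] : exists j : nat, O ((e * c)%N%:Z - e%:Z - 2 + j%:Z) (s ^+ j * cls a l).
  rewrite (cls_rev_cls lt_ln homa a0) /cls_rev lt_le.
  apply: (dbldiv_regular iotaI hN0 homh em_gt0) => // [||i].
  - exact: (floc_t iota homh).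
  - exact: (floc_s iota homh).
  - exact: gr_regular.
by rewrite kE; apply: (floc_coprime iotaI hN0 homh em_gt0 Oj' Oj).
Qed.

Variables (L' : fieldType) (iota' : {rmorphism {mpoly K[n.+1]} -> L'}).
Hypothesis iota'I : injective iota'.
Variables (F : {mpoly K[n.+1]}) (d : nat).
Hypotheses (homF : F \is d.-homog) (F0 : pb F = 0).

Let gN0 : g != 0.
Proof. by apply: contraNneq hN0 => ->; rewrite rmorph0. Qed.

(** The definition of [normal_section], over arbitrary fields [L] and [L']
    that contain the coordinate rings of P^1 and of P^n. *)
Definition fnormal_section (phi : L' -> L) : Prop :=
  let I := floc iota' (@vanishes_on_rnc K e n) g 0 in
  [/\ (forall x, I x -> floc iota (fun=> True) h 0 (phi x)),
      (forall x y, I x -> I y -> phi (x + y) = phi x + phi y),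
      (forall (j m : nat) (p : {mpoly K[n.+1]}) x,
         g \is m.-homog -> p \is (j * m).-homog -> I x ->
         phi (iota' p / iota' g ^+ j * x) = iota (pb p) / iota h ^+ j * phi x) &
      (forall x, floc iota' (fun a => exists q, a = F * q) g 0 x -> phi x = 0)].

Lemma flocVP (M : {mpoly K[n.+1]} -> Prop) x :
  floc iota' M g 0 x <-> exists j a,
    [/\ a \is (j * m).-homog, M a & x = iota' a / iota' g ^+ j].
Proof.
split=> [[j [c [dg [a [Ma homa homg' cE xE]]]]]|[j [a [homa Ma xE]]]].
  exists j, a; split=> //; rewrite (dhomog_uniq gN0 homg homg').
  by move: cE; rewrite add0r => -[<-].
by exists j, (j * m)%N, m, a; split=> //; rewrite add0r.
Qed.

Lemma flocI0 j a : a \is (j * m).-homog -> pb a = 0 ->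
  floc iota' (@vanishes_on_rnc K e n) g 0 (iota' a / iota' g ^+ j).
Proof. by move=> homa a0; apply/flocVP; exists j, a; split=> //; apply/vanishesP. Qed.

Section Sections.

Variable phi : L' -> L.
Hypothesis phiP : fnormal_section phi.

Let pt j a := phi (iota' a / iota' g ^+ j).

Let ptD j a b : a \is (j * m).-homog -> b \is (j * m).-homog -> pb a = 0 -> pb b = 0 ->
  pt j (a + b) = pt j a + pt j b.
Proof.
move=> homa homb a0 b0; rewrite /pt rmorphD mulrDl.
by case: phiP => _ H _ _; apply: H; apply: flocI0.
Qed.

Let ptM i j p a : p \is (i * m).-homog -> a \is (j * m).-homog -> pb a = 0 ->
  pt (i + j) (p * a) = iota (pb p) / iota h ^+ i * pt j a.
Proof.
move=> homp homa a0; rewrite /pt rmorphM exprD -mulf_div.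
by case: phiP => _ _ H _; apply: H homg homp _; apply: flocI0.
Qed.

Let X0 := iota (pb (xv 0)).
Let X0N0 : X0 != 0.
Proof.
rewrite /X0 (raddf_eq0 _ iotaI) pullback_xv // expr0 mulr1 subn0.
by rewrite expf_neq0 // -msupp_eq0 msuppX.
Qed.

(** Only forms of degree divisible by [m] can be divided by a power of [g];
    the factor [xv 0 ^+ (c * m.-1)] makes the degree [c * m]. *)
Let ev c a := pt c (xv 0 ^+ (c * m.-1) * a) * iota h ^+ c / X0 ^+ (c * m.-1).

Let xv_exp i j : xv i ^+ j \is j.-homog.
Proof. by have := dhomogMn j (xv_homog K n i); rewrite mul1n. Qed.

Let pad_homog i c a : a \is c.-homog -> xv i ^+ (c * m.-1) * a \is (c * m).-homog.
Proof.
move=> homa; have := dhomogM (xv_exp i (c * m.-1)) homa.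
by rewrite -mulnSr prednK.
Qed.

Let pad0 i c a : pb a = 0 -> pb (xv i ^+ (c * m.-1) * a) = 0.
Proof. by move=> a0; rewrite rmorphM /= a0 mulr0. Qed.

Let evD c a b : a \is c.-homog -> b \is c.-homog -> pb a = 0 -> pb b = 0 ->
  ev c (a + b) = ev c a + ev c b.
Proof.
move=> homa homb a0 b0; rewrite /ev mulrDr (ptD (pad_homog 0 homa) (pad_homog 0 homb) (pad0 0 c a0) (pad0 0 c b0)).
by rewrite !mulrDl.
Qed.

Let evM c c' p a : p \is c.-homog -> a \is c'.-homog -> pb a = 0 ->
  ev (c + c')%N (p * a) = iota (pb p) * ev c' a.
Proof.
move=> homp homa a0; rewrite /ev.
have -> : xv 0 ^+ ((c + c') * m.-1) * (p * a) =
    (xv 0 ^+ (c * m.-1) * p) * (xv 0 ^+ (c' * m.-1) * a).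
  by rewrite mulnDl exprD mulrACA.
rewrite (ptM (pad_homog 0 homp) (pad_homog 0 homa) (pad0 0 c' a0)).
rewrite !rmorphM /= !rmorphXn /= -/X0.
have hc : iota h ^+ c != 0 by rewrite expf_neq0.
have Xc : X0 ^+ (c * m.-1) != 0 by rewrite expf_neq0.
have Xc' : X0 ^+ (c' * m.-1) != 0 by rewrite expf_neq0.
rewrite mulnDl !exprD.
move: (X0 ^+ (c * _)) (X0 ^+ (c' * _)) (iota h ^+ c) (iota h ^+ c') (pt _ _) hc Xc Xc'.
by move=> A B C D E C0 A0 B0; field; rewrite ?A0 ?B0 ?C0.
Qed.

Let ev_pt j a : a \is (j * m).-homog -> pb a = 0 -> ev (j * m) a = iota h ^+ j * pt j a.
Proof.
move=> homa a0; rewrite /ev.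
have E : (j * m = j * m.-1 + j)%N by rewrite -mulnSr prednK.
have -> : pt (j * m) (xv 0 ^+ (j * m * m.-1) * a) = X0 ^+ (j * m * m.-1) / iota h ^+ (j * m.-1) * pt j a.
  have hp : xv 0 ^+ (j * m * m.-1) \is (j * m.-1 * m).-homog.
    by rewrite [(j * m.-1 * m)%N]mulnAC; apply: xv_exp.
  by rewrite {1}E (ptM hp homa a0) !rmorphXn.
have -> : iota h ^+ (j * m) = iota h ^+ (j * m.-1) * iota h ^+ j by rewrite {1}E exprD.
have hc : iota h ^+ (j * m.-1) != 0 by rewrite expf_neq0.
have Xc : X0 ^+ (j * m * m.-1) != 0 by rewrite expf_neq0.
move: (X0 ^+ _) (iota h ^+ (j * _)) (iota h ^+ j) (pt _ _) hc Xc => A B C D B0 A0.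
by field; rewrite ?A0 ?B0.
Qed.

Let ev_regular c a : a \is c.-homog -> pb a = 0 -> O (e * c)%N (ev c a).
Proof.
move=> homa a0.
have Oi i : O (e * (c * m))%N (iota (pb (xv i)) ^+ (c * m.-1) * ev c a).
  have hp := pad_homog i homa; have p0 := pad0 i c a0.
  rewrite -!rmorphXn -(evM (xv_exp i (c * m.-1)) homa a0) -mulnSr prednK //.
  rewrite (ev_pt hp p0) -[(e * (c * m))%N%:Z]addr0; apply: OM.
    by rewrite -rmorphXn; apply: (floc_poly iota homh); rewrite mulnCA mulnC; apply: dhomogMn.
  by case: phiP => H _ _ _; apply: H; apply: flocI0.
have E : (e * (c * m))%N%:Z = (e * c)%N%:Z + (e * (c * m.-1))%N%:Z.
  by rewrite -PoszD -mulnDr -mulnS prednK.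
have := Oi 0%N; have := Oi e; rewrite !pullback_xv // subnn !expr0 mul1r mulr1 subn0.
rewrite !rmorphXn -!exprM E => Ot Os.
exact: (floc_coprime iotaI hN0 homh em_gt0 Os Ot).
Qed.

Let kills q' j : F * q' \is (j * m).-homog -> pt j (F * q') = 0.
Proof.
move=> hom; case: phiP => _ _ _ H; apply: H; apply/flocVP.
by exists j, (F * q'); split=> //; exists q'.
Qed.

(** Multiplying by powers of [xv 0], a section extends from the degree zero
    part of the localised ideal to a map [ev] on all forms of the ideal that
    is linear over the pullback. By [conormal_vanish_edges], [ev] is
    determined by its values on one element per coordinate of the class: it is
    the linear form with coefficients [nu] in the class. Regularity of [nu l]
    follows from [edgeL 0 l] and [edgeR 0 l], whose classes are supported at
    [l] and equal to a power of [s] and to a power of [t]. Since the section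
    kills [F], so does the linear form. *)
Lemma section_values : exists2 nu : nat -> L,
  (forall l, (l < n.-1)%N -> O (Ndeg e l) (nu l)) &
  [/\ (forall j a, a \is (j * m).-homog -> pb a = 0 ->
        phi (iota' a / iota' g ^+ j) = (\sum_(l < n.-1) nu l * cls a l) / iota h ^+ j)
    & \sum_(l < n.-1) nu l * cls F l = 0].
Proof.
pose nu l := if (l < e.-1)%N then ev 3 (edgeL K n 0 l) / s ^+ e.-1.*2 else ev 1 (xv l.+2).
have sum_delta (l : nat) (f : {mpoly K[2]}) : (l < n.-1)%N ->
    \sum_(i < n.-1) nu i * iota (delta l f i) = nu l * iota f.
  move=> lt_ln; rewrite (bigD1 (Ordinal lt_ln)) //= /delta eqxx big1 ?addr0 // => i.
  by rewrite -val_eqE /= => /negbTE->; rewrite rmorph0 mulr0.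
have cls_sum a f l : hasclass e a (delta l f) -> (l < n.-1)%N ->
    \sum_(i < n.-1) nu i * cls a i = nu l * iota f.
  move=> hc lt_ln; rewrite -(sum_delta l f lt_ln); apply: eq_bigr => i _.
  by rewrite (cls_hasclass iotaI e_ge2 e_len hc).
have e1E : (e.-1.*2 - 0 = e.-1.*2)%N by rewrite subn0.
have evE c a : a \is c.-homog -> pb a = 0 -> ev c a = \sum_(l < n.-1) nu l * cls a l.
  move=> homa a0; apply/eqP; rewrite -subr_eq0; apply/eqP; move: c a homa a0.
  apply: (conormal_vanish_edges (chi := fun c a => ev c a - \sum_(l < n.-1) nu l * cls a l)).
  - move=> c a b homa homb a0 b0; rewrite evD // addrACA -opprD -big_split /=.
    by congr (_ - _); apply: eq_bigr => l _; rewrite (clsD _ iotaI) mulrDr.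
  - move=> c c' p a homp homa a0; rewrite evM // mulrBr mulr_sumr; congr (_ - _).
    by apply: eq_bigr => l _; rewrite (clsM iotaI) // mulrCA.
  - move=> l lt_ln lt_le; have lt_le' : (l.+1 < e)%N by rewrite -ltn_predRL.
    have hc := hasclass_edgeL K e_ge2 e_len (leq0n l) lt_le'.
    rewrite (cls_sum _ _ _ hc lt_ln).
    rewrite /nu lt_le expr0 mulr1 subn0 rmorphXn divfK ?subrr //.
    by rewrite expf_neq0.
  - move=> l lt_ln le_el; have hc : hasclass e (xv l.+2 * 1) (delta l (pb 1)).
      by apply: hasclass_xv; rewrite // -ltn_predRL.
    rewrite mulr1 in hc; by rewrite (cls_sum _ _ _ hc lt_ln) !rmorph1 mulr1 /nu ltnNge le_el /= subrr.
exists nu; last split.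
- move=> l lt_ln; rewrite /Ndeg; case: ifP => lt_le; last first.
    have x0 : pb (xv l.+2) = 0.
      by apply: pullback_xv0; apply: transverse_range.
    by have := ev_regular (xv_homog K n l.+2) x0; rewrite muln1 /nu lt_le.
  have lt_le' : (l.+1 < e)%N by rewrite -ltn_predRL.
  have hcL := hasclass_edgeL K e_ge2 e_len (leq0n l) lt_le'.
  have hcR : hasclass e (edgeR K e n 0 l) _ := hasclass_edgeR K e_ge2 e_len (al := 0) lt_le'.
  have evL : ev 3 (edgeL K n 0 l) = s ^+ e.-1.*2 * nu l.
    rewrite evE; last 2 first.
    - exact: edge_homog.
    - exact: pullback_edgeL.
    by rewrite (cls_sum _ _ _ hcL lt_ln) expr0 mulr1 subn0 rmorphXn mulrC.
  have evR : ev 3 (edgeR K e n 0 l) = t ^+ e.-1.*2 * nu l.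
    rewrite evE; last 2 first.
    - exact: edge_homog.
    - exact: pullback_edgeR.
    by rewrite (cls_sum _ _ _ hcR lt_ln) expr0 mul1r subn0 rmorphXn mulrC.
  have E := edge_degree e_ge2.
  apply: (floc_coprime iotaI hN0 homh em_gt0 (l := e.-1.*2) (l' := e.-1.*2)).
    rewrite -evL -E; apply: ev_regular; first exact: edge_homog.
    exact: pullback_edgeL.
  rewrite -evR -E; apply: ev_regular; first exact: edge_homog.
  exact: pullback_edgeR.
- move=> j a homa a0; rewrite -(evE _ _ homa a0) ev_pt // [_ * pt _ _]mulrC mulfK //.
  by rewrite expf_neq0.
rewrite -(evE _ _ homF F0) /ev mulrC [xv 0 ^+ _ * F]mulrC kills ?mul0r ?mulr0 //.
by rewrite mulrC; apply: pad_homog.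
Qed.

End Sections.

End OverOpen.

End NormalSections.

(** * Normal sections and sections of the split bundle *)

Section Represent.

Variables (K : closedFieldType) (e n : nat).
Variables (L : fieldType) (iota : {rmorphism {mpoly K[2]} -> L}).
Hypothesis iotaI : injective iota.
Hypothesis charK : [pchar K] =i pred0.
Hypotheses (e_ge2 : (2 <= e)%N) (e_len : (e <= n)%N).
Implicit Types (a b : {mpoly K[n.+1]}).

Notation pb := (@rnc_pullback K e n).
Notation s := (iota 'X_ord0).
Notation t := (iota 'X_ord_max).
Notation xv := (@xv K n).
Notation cls := (@cls K e n L iota).

Variables (N l0 de : nat) (k : nat -> int) (q p al be : nat -> nat).
Hypotheses (l0_leN : (l0 <= N)%N)
  (k_triv : forall l, (l < l0)%N -> k l = (Ndeg e l)%:Z)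
  (qE : forall l, (l0 <= l < N)%N -> (Ndeg e l)%:Z = k l + (q l)%:Z)
  (pE : forall l, (l0 <= l < N)%N -> (Ndeg e l.+1)%:Z = k l + (p l)%:Z)
  (beS : forall l, (l0 <= l < N)%N -> be l.+1 = (be l + q l)%N)
  (alS : forall l, (l0 <= l < N)%N -> al l = (al l.+1 + p l)%N)
  (albe : forall l, (l0 <= l <= N)%N -> (al l + be l + Ndeg e l = de)%N).

Variables (F : {mpoly K[n.+1]}) (d : nat).
Hypotheses (n1E : n.-1 = N.+1) (homF : F \is d.-homog) (F0 : pb F = 0)
  (clsF : hasclass e F (row K l0 al be)).

Let sN0 : s != 0. Proof. exact: embedX_neq0. Qed.

(** The class of [a], evaluated on the basis of the kernel of the class of
    [F]. *)
Definition kap a (l : nat) : L := chain iota l0 q p (cls a) l.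

Lemma eq_chain (w w' : nat -> L) l : (l < N)%N ->
  (forall i, (i <= N)%N -> w i = w' i) -> chain iota l0 q p w l = chain iota l0 q p w' l.
Proof. by move=> lt_lN ww'; rewrite /chain !ww' // ltnW. Qed.

Lemma kapD a b l : kap (a + b) l = kap a l + kap b l.
Proof. by rewrite /kap -chain_add /chain !(clsD _ iotaI). Qed.

Lemma kapM r a l : pb a = 0 -> kap (r * a) l = iota (pb r) * kap a l.
Proof. by move=> a0; rewrite /kap -chain_mul /chain !(clsM iotaI). Qed.

(** The row of monomials is orthogonal to the basis of its kernel; so a map
    that factors through [kap] kills [F]. *)
Lemma kapF l : (l < N)%N -> kap F l = 0.
Proof.
move=> lt_lN; rewrite -(chain_row iota beS alS lt_lN); apply: eq_chain => // i le_iN.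
by rewrite (cls_hasclass iotaI e_ge2 e_len clsF) // n1E.
Qed.

Section Over.

Variables (g : {mpoly K[n.+1]}) (m : nat).
Hypotheses (m_gt0 : (0 < m)%N) (homg : g \is m.-homog) (hN0 : pb g != 0).

Notation h := (pb g).
Notation O := (floc iota (fun=> True) h).

Let homh : h \is (e * m).-homog. Proof. exact: pullback_homog. Qed.
Let em_gt0 : (0 < e * m)%N. Proof. by rewrite muln_gt0 (ltnW e_ge2). Qed.
Let OM := flocM (iota := iota) hN0 homh.
Let hF0 : iota h != 0. Proof. by rewrite (raddf_eq0 _ iotaI). Qed.

Lemma kap_regular c a l : (l < N)%N -> a \is c.-homog -> pb a = 0 ->
  O ((e * c)%N%:Z - k l) (kap a l).
Proof.
move=> lt_lN homa a0; rewrite /kap /chain.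
have reg i : (i <= N)%N -> O ((e * c)%N%:Z - (Ndeg e i)%:Z) (cls a i).
  by move=> le_iN; apply: (cls_regular iotaI charK e_ge2 e_len m_gt0 homg hN0); rewrite ?n1E.
case: ifP => [lt_l0|/negbT]; first by rewrite k_triv //; apply/reg/ltnW.
rewrite -leqNgt => le_l0; apply: (flocD iotaI hN0 homh em_gt0).
  have -> : (e * c)%N%:Z - k l = (q l)%:Z + ((e * c)%N%:Z - (Ndeg e l)%:Z).
    by rewrite qE ?le_l0 //; ring.
  apply: OM; last exact/reg/ltnW.
  apply: (flocN hN0 homh).
  by have := floc_monomial iota homh 0 (q l); rewrite expr0 mul1r add0n.
have -> : (e * c)%N%:Z - k l = (p l)%:Z + ((e * c)%N%:Z - (Ndeg e l.+1)%:Z).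
  by rewrite pE ?le_l0 //; ring.
apply: OM; last exact/reg.
by have := floc_monomial iota homh (p l) 0; rewrite expr0 mulr1 addn0.
Qed.

Variables (L' : fieldType) (iota' : {rmorphism {mpoly K[n.+1]} -> L'}).
Hypothesis iota'I : injective iota'.

Let gN0 : g != 0.
Proof. by apply: contraNneq hN0 => ->; rewrite rmorph0. Qed.

Let gF0 : iota' g != 0. Proof. by rewrite (raddf_eq0 _ iota'I). Qed.

(** The section [phi] is the combination, with coefficients [v], of the basis
    of the kernel of the class of [F]. *)
Definition represents (phi : L' -> L) (v : nat -> L) : Prop :=
  forall j a, a \is (j * m).-homog -> pb a = 0 ->
    phi (iota' a / iota' g ^+ j) = (\sum_(l < N) v l * kap a l) / iota h ^+ j.

(** The coefficients of the linear form that [section_values] provides are in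
    the kernel of the class of [F], so [chain_exact] expands them in its
    basis. *)
Lemma normal_section_coords (phi : L' -> L) :
  fnormal_section e iota g iota' F phi ->
  exists2 v, (forall l, (l < N)%N -> O (k l) (v l)) & represents phi v.
Proof.
move=> phiP.
have [nu Onu [phiE nu0]] := section_values iotaI charK e_ge2 e_len m_gt0 homg hN0 homF F0 phiP.
rewrite n1E in Onu phiE nu0.
have nu0' : \sum_(l < N.+1) iota (row K l0 al be l) * nu l = 0.
  rewrite -[RHS]nu0; apply: eq_bigr => l _; rewrite mulrC.
  by rewrite (cls_hasclass iotaI e_ge2 e_len clsF) // n1E.
have [v Ov vE] := chain_exact iotaI hN0 homh em_gt0 l0_leN k_triv qE beS alS albe Onu nu0'.
by exists v => // j a homa a0; rewrite phiE // vE.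
Qed.

(** For each coordinate there is a cubic in the ideal whose class is a power
    of [s] at that coordinate and zero elsewhere; after multiplication by a
    power of [xv 0] its degree is divisible by [m]. *)
Lemma represents_inj (phi : L' -> L) v v' :
  represents phi v -> represents phi v' -> forall l, (l < N)%N -> v l = v' l.
Proof.
move=> rv rv' l lt_lN; apply/eqP; rewrite -subr_eq0; apply/eqP; move: l lt_lN.
apply: (chain_inj iotaI (q := q) (p := p) (l0 := l0)) => i lt_iN.
pose D := if (i < e.-1)%N then (e + 2)%N else e.
have [||W [homW W0 clsW]] := @lift_delta K e n e_ge2 e_len 3 i (3 * e - D) 0 isT.
  by rewrite -ltn_predRL n1E ltnW.
  by rewrite /D; case: ifP; lia.
pose a := xv 0 ^+ (3 * m.-1) * W.
have homa : a \is (3 * m).-homog.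
  have := dhomogM (dhomogMn (3 * m.-1) (xv_homog K n 0)) homW.
  by rewrite mul1n -mulnSr prednK.
have a0 : pb a = 0 by rewrite rmorphM /= W0 mulr0.
have aN0 : iota (pb (xv 0 ^+ (3 * m.-1))) * s ^+ (3 * e - D) != 0.
  rewrite rmorphXn !rmorphXn /= pullback_xv // expr0 mulr1 rmorphXn.
  by rewrite mulf_neq0 // !expf_neq0.
apply: (mulfI aN0); rewrite mulr0 mulr_sumr.
transitivity (\sum_(l < N) (v l - v' l) * kap a l).
  apply: eq_bigr => l _; rewrite mulrCA; congr (_ * _).
  rewrite /a kapM // -mulrA; congr (_ * _); rewrite /kap -chain_mul.
  apply: eq_chain => // i' le_i'N; rewrite (cls_hasclass iotaI e_ge2 e_len clsW) ?n1E //.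
  rewrite /delta; case: eqP => _; first by rewrite mulr1 expr0 mulr1 rmorphXn.
  by rewrite mulr0 rmorph0.
have := rv _ _ homa a0; rewrite (rv' _ _ homa a0) => /(mulIf _) E.
under eq_bigr do rewrite mulrBl.
rewrite sumrB E ?subrr //.
by rewrite invr_eq0 expf_neq0.
Qed.

(** The formula in [represents] does not depend on the way in which an element
    of the localised ideal is written as a fraction, so it defines a section
    on these elements; its values elsewhere are arbitrary. *)
Lemma represents_section (v : nat -> L) : (forall l, (l < N)%N -> O (k l) (v l)) ->
  exists2 phi, fnormal_section e iota g iota' F phi & represents phi v.
Proof.
move=> Ov; pose val j a := (\sum_(l < N) v l * kap a l) / iota h ^+ j.
pose graph x y := exists j a,
  [/\ a \is (j * m).-homog, pb a = 0, x = iota' a / iota' g ^+ j & y = val j a].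
pose phi x := epsilon (inhabits 0) (graph x).
have hj j : iota h ^+ j != 0 by rewrite expf_neq0.
have gj j : iota' g ^+ j != 0 by rewrite expf_neq0.
have valM i j r a : pb a = 0 -> val (i + j)%N (r * a) = iota (pb r) / iota h ^+ i * val j a.
  move=> a0; rewrite /val exprD mulf_div mulr_sumr; congr (_ / _).
  by apply: eq_bigr => l _; rewrite kapM // mulrCA.
have valD j a b : val j (a + b) = val j a + val j b.
  rewrite /val -mulrDl -big_split /=; congr (_ / _).
  by apply: eq_bigr => l _; rewrite kapD mulrDr.
have valg i j a : pb a = 0 -> val (i + j)%N (g ^+ i * a) = val j a.
  by move=> a0; rewrite valM // !rmorphXn divff ?mul1r.
have repr : represents phi v.
  move=> j a homa a0; rewrite /phi.
  have : graph (iota' a / iota' g ^+ j) (epsilon (inhabits 0) (graph (iota' a / iota' g ^+ j))).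
    by apply: epsilon_spec; exists (val j a), j, a.
  move=> [i [b [homb b0 /eqP abE ->]]]; rewrite -/(val j a).
  rewrite eqr_div // -!rmorphXn -!rmorphM (inj_eq iota'I) in abE.
  by rewrite -(valg j i b b0) -(valg i j a a0) addnC mulrC -(eqP abE) mulrC.
exists phi => //.
have I_repr x : floc iota' (@vanishes_on_rnc K e n) g 0 x -> exists j a,
    [/\ a \is (j * m).-homog, pb a = 0, x = iota' a / iota' g ^+ j & phi x = val j a].
  move/(flocVP homg hN0); move=> [j [a [homa /(vanishesP e charK) a0 ->]]].
  by exists j, a; split=> //; apply: repr.
split.
- move=> x /I_repr[j [a [homa a0 _ ->]]]; rewrite /val.
  have OE x' : O ((e * (j * m))%N%:Z + - (e * m * j)%N%:Z) x' -> O 0 x'.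
    by rewrite mulnA mulnAC subrr.
  apply: OE; apply: OM.
    apply: (floc_sum iotaI hN0 homh em_gt0) => l _ _.
    rewrite (_ : (e * (j * m))%N%:Z = k l + ((e * (j * m))%N%:Z - k l)); last by ring.
    by apply: OM; [exact: Ov|apply: kap_regular].
  rewrite -[_^-1]mul1r -(rmorph1 iota); apply: (flocI iota homh (c := 0)); first exact: dhomog1.
  by rewrite [(j * _)%N]mulnC addNr.
- move=> x y /I_repr[j [a [homa a0 -> ->]]] /I_repr[i [b [homb b0 -> ->]]].
  rewrite addf_div // -exprD -!rmorphXn -!rmorphM -rmorphD rmorphXn.
  rewrite repr; last 2 first.
  - rewrite mulnDl; apply: rpredD.
      by apply: dhomogM => //; rewrite mulnC; apply: dhomogMn.
    by rewrite addnC; apply: dhomogM => //; rewrite mulnC; apply: dhomogMn.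
  - by rewrite rmorphD !rmorphM /= a0 b0 !mul0r addr0.
  rewrite -/(val _ _) valD [a * _]mulrC [b * _]mulrC -(valg i j a a0) -(valg j i b b0).
  by rewrite [(j + i)%N]addnC.
- move=> i m' r x homg' homr /I_repr[j [a [homa a0 -> ->]]].
  rewrite mulf_div -rmorphM -exprD repr; last 2 first.
  - rewrite mulnDl; apply: dhomogM => //.
    by rewrite -(dhomog_uniq gN0 homg' homg).
  - by rewrite rmorphM /= a0 mulr0.
  by rewrite -/(val _ _) valM.
move=> x /(flocVP homg hN0)[j [a [homa [r aE] ->]]].
have a0 : pb a = 0 by rewrite aE rmorphM /= F0 mul0r.
rewrite repr // big1 ?mul0r // => l _.
by rewrite aE [F * r]mulrC kapM // kapF // !mulr0.
Qed.

End Over.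

End Represent.

Section RepresentCompat.

Variables (K : closedFieldType) (e n : nat).
Variables (L : fieldType) (iota : {rmorphism {mpoly K[2]} -> L}).
Variables (L' : fieldType) (iota' : {rmorphism {mpoly K[n.+1]} -> L'}).
Hypotheses (iotaI : injective iota) (iota'I : injective iota').
Hypothesis charK : [pchar K] =i pred0.
Variables (N l0 : nat) (q p : nat -> nat).

Notation pb := (@rnc_pullback K e n).
Notation rep := (represents e iota N l0 q p).

Lemma representsD g m (phi psi : L' -> L) v w :
  rep g m iota' phi v -> rep g m iota' psi w ->
  rep g m iota' (fun x => phi x + psi x) (fun l => v l + w l).
Proof.
move=> hv hw j a homa a0; rewrite hv // hw // -mulrDl -big_split /=; congr (_ / _).
by apply: eq_bigr => l _; rewrite mulrDl.
Qed.

Lemma representsZ g m c (phi : L' -> L) v : rep g m iota' phi v ->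
  rep g m iota' (fun x => c * phi x) (fun l => c * v l).
Proof.
move=> hv j a homa a0; rewrite hv // mulrA mulr_sumr; congr (_ / _).
by apply: eq_bigr => l _; rewrite mulrA.
Qed.

Lemma represents_ext g m (phi : L' -> L) v w : (forall l, (l < N)%N -> v l = w l) ->
  rep g m iota' phi v -> rep g m iota' phi w.
Proof.
move=> vw hv j a homa a0; rewrite hv //; congr (_ / _).
by apply: eq_bigr => l _; rewrite vw.
Qed.

Lemma represents_eq g m (phi psi : L' -> L) v : g \is m.-homog -> pb g != 0 ->
  (forall x, floc iota' (@vanishes_on_rnc K e n) g 0 x -> phi x = psi x) ->
  rep g m iota' phi v -> rep g m iota' psi v.
Proof.
move=> homg g0 eqp hv j a homa a0; rewrite -eqp; first exact: hv.
exact: (flocI0 charK homg g0 iota' homa a0).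
Qed.

Lemma represents_eqI g m (phi psi : L' -> L) v w : g \is m.-homog -> pb g != 0 ->
  (forall l, (l < N)%N -> v l = w l) ->
  rep g m iota' phi v -> rep g m iota' psi w ->
  forall x, floc iota' (@vanishes_on_rnc K e n) g 0 x -> phi x = psi x.
Proof.
move=> homg g0 vw hv hw x /(flocVP homg g0)[j [a [homa /(vanishesP e charK) a0 ->]]].
by rewrite (represents_ext vw hv) // hw.
Qed.

(** An element of the ideal over the larger open is also a fraction with
    denominator [g * r], whose value is given by the same coordinates. *)
Lemma represents_restrict g m r m' (phi psi : L' -> L) v :
  g \is m.-homog -> g * r \is m'.-homog -> pb (g * r) != 0 ->
  (forall x, floc iota' (@vanishes_on_rnc K e n) g 0 x -> psi x = phi x) ->
  rep (g * r) m' iota' psi v -> rep g m iota' phi v.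
Proof.
move=> homg homgr gr0 eqp hv j a homa a0.
have [g0 r0] : pb g != 0 /\ pb r != 0.
  by move: gr0; rewrite rmorphM /= mulf_eq0 negb_or => /andP[].
have N0 x : pb x != 0 -> x != 0 by apply: contraNneq => ->; rewrite rmorph0.
have [le_mm' homr] := homog_cancel (N0 _ g0) homg homgr (N0 _ r0).
rewrite -eqp; last exact: (flocI0 charK homg g0 iota' homa a0).
have F0 x : pb x != 0 -> forall i, iota' x ^+ i != 0.
  by move=> x0 i; rewrite expf_neq0 // (raddf_eq0 _ iota'I) N0.
have -> : iota' a / iota' g ^+ j = iota' (r ^+ j * a) / iota' (g * r) ^+ j.
  rewrite !rmorphM rmorphXn exprMn; have := F0 _ g0 j; have := F0 _ r0 j.
  move: (iota' g ^+ j) (iota' r ^+ j) (iota' a) => A B C B0 A0.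
  by field; rewrite A0 B0.
have P0 x : pb x != 0 -> forall i, iota (pb x) ^+ i != 0.
  by move=> x0 i; rewrite expf_neq0 // (raddf_eq0 _ iotaI).
rewrite hv; last 2 first.
- have := dhomogM (dhomogMn j homr) homa.
  by rewrite [(_ * j)%N]mulnC -mulnDr subnK.
- by rewrite rmorphM /= a0 mulr0.
rewrite rmorphM /= rmorphM exprMn.
have -> : \sum_(l < N) v l * kap e iota l0 q p (r ^+ j * a) l
    = iota (pb r) ^+ j * \sum_(l < N) v l * kap e iota l0 q p a l.
  rewrite mulr_sumr; apply: eq_bigr => l _.
  by rewrite (kapM iotaI) // !rmorphXn /= mulrCA.
have := P0 _ g0 j; have := P0 _ r0 j.
move: (iota _ ^+ j) (iota _ ^+ j) (\sum_(l < N) _) => A B C B0 A0.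
by field; rewrite A0 B0.
Qed.

End RepresentCompat.

(** * The isomorphism with the split bundle *)

Section SplitBundle.

Variables (K : closedFieldType) (e n : nat).
Hypothesis charK : [pchar K] =i pred0.
Hypotheses (e_ge2 : (2 <= e)%N) (e_len : (e <= n)%N).

Notation pb := (@rnc_pullback K e n).
Notation Fr m := {fraction {mpoly K[m]}}.

Let iota : {rmorphism {mpoly K[2]} -> Fr 2} := @tofrac {mpoly K[2]}.
Let iota' : {rmorphism {mpoly K[n.+1]} -> Fr n.+1} := @tofrac {mpoly K[n.+1]}.

Lemma tofrac_inj (R : idomainType) : injective (@tofrac R).
Proof. by move=> x y /eqP; rewrite tofrac_eq => /eqP. Qed.

Let iotaI : injective iota. Proof. exact: tofrac_inj. Qed.
Let iota'I : injective iota'. Proof. exact: tofrac_inj. Qed.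

Lemma normal_sectionE (F : {mpoly K[n.+1]}) (U : basic_open K e n) phi :
  normal_section F U phi <-> fnormal_section e iota U iota' F phi.
Proof. by []. Qed.

Variables (ks : seq int) (l0 de : nat) (q p al be : nat -> nat).
Notation N := (size ks).
Notation k := (nth 0 ks).
Hypotheses (l0_leN : (l0 <= N)%N)
  (k_triv : forall l, (l < l0)%N -> k l = (Ndeg e l)%:Z)
  (qE : forall l, (l0 <= l < N)%N -> (Ndeg e l)%:Z = k l + (q l)%:Z)
  (pE : forall l, (l0 <= l < N)%N -> (Ndeg e l.+1)%:Z = k l + (p l)%:Z)
  (beS : forall l, (l0 <= l < N)%N -> be l.+1 = (be l + q l)%N)
  (alS : forall l, (l0 <= l < N)%N -> al l = (al l.+1 + p l)%N)
  (albe : forall l, (l0 <= l <= N)%N -> (al l + be l + Ndeg e l = de)%N).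
Variables (F : {mpoly K[n.+1]}) (d : nat).
Hypotheses (n1E : n.-1 = N.+1) (homF : F \is d.-homog) (F0 : pb F = 0)
  (clsF : hasclass e F (row K l0 al be)).

(** The coordinates of a section of the normal bundle. The degree [m] of the
    equation of [U] is unique, but not part of [U]. *)
Definition coords (U : basic_open K e n) (phi : Fr n.+1 -> Fr 2) (v : nat -> Fr 2) : Prop :=
  (forall l, (l < N)%N -> OP1 (k l) U (v l)) /\
  (forall m, Defs.eqn U \is m.-homog -> represents e iota N l0 q p U m iota' phi v).

Lemma basic_open_homog (U : basic_open K e n) :
  exists m, [/\ (0 < m)%N, Defs.eqn U \is m.-homog & forall m', Defs.eqn U \is m'.-homog -> m' = m].
Proof.
have [m m0 homU] := eqn_homog U; exists m; split=> // m' homU'.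
apply: dhomog_uniq homU' homU.
by have := eqn_meets U; apply: contraNneq => ->; rewrite rmorph0.
Qed.

Lemma coords_exist U phi : normal_section F U phi -> exists v, coords U phi v.
Proof.
have [m [m0 homU uniqm]] := basic_open_homog U.
move=> /normal_sectionE/(normal_section_coords iotaI charK e_ge2 e_len l0_leN k_triv qE
  beS alS albe n1E homF F0 clsF m0 homU (eqn_meets U))[v Ov rv].
by exists v; split=> // m' /uniqm->.
Qed.

Lemma coords_inj U phi v v' :
  coords U phi v -> coords U phi v' -> forall l, (l < N)%N -> v l = v' l.
Proof.
have [m [m0 homU _]] := basic_open_homog U.
move=> [_ /(_ m homU) rv] [_ /(_ m homU) rv'].
exact: (represents_inj iotaI e_ge2 e_len l0_leN n1E homF m0 homU (eqn_meets U) iota'I rv rv').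
Qed.

Lemma coords_ext U phi v v' : (forall l, (l < N)%N -> v l = v' l) ->
  coords U phi v -> coords U phi v'.
Proof.
move=> vv' [Ov rv]; split=> [l lt_l|m homU]; first by rewrite -vv' //; apply: Ov.
exact: represents_ext vv' (rv m homU).
Qed.

Lemma coords_section U v : (forall l, (l < N)%N -> OP1 (k l) U (v l)) ->
  exists2 phi, normal_section F U phi & coords U phi v.
Proof.
have [m [m0 homU uniqm]] := basic_open_homog U.
move=> Ov; have [phi phiP rv] := represents_section iotaI charK e_ge2 e_len k_triv qE pE beS alS
  n1E F0 clsF m0 homU (eqn_meets U) iota'I Ov.
by exists phi; [apply/normal_sectionE|split=> // m' /uniqm->].
Qed.

Let ext (v : 'I_N -> Fr 2) (l : nat) : Fr 2 := if insub l is Some i then v i else 0.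

Let extE v (i : 'I_N) : ext v i = v i.
Proof. by rewrite /ext valK. Qed.

(** A section is sent to its coordinates, which exist, are unique and can be
    prescribed; all operations are compatible with [represents]. *)
Theorem normal_bundle_split : isomorphic (normal_bundle e F) (split_bundle e n ks).
Proof.
pose good U phi (v : 'I_N -> Fr 2) := coords U phi (ext v).
pose Phi U phi := epsilon (inhabits (fun _ : 'I_N => 0 : Fr 2)) (good U phi).
have goodP U phi v : coords U phi v -> good U phi (fun i => v i).
  by apply: coords_ext => l lt_l; rewrite /ext insubT.
have PhiP U phi : normal_section F U phi -> coords U phi (ext (Phi U phi)).
  move=> /coords_exist[v /goodP gv].
  exact: (epsilon_spec _ (good U phi) (ex_intro _ _ gv)).
have PhiE U phi v : coords U phi v -> forall i, Phi U phi i = v i.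
  move=> cv i; have := epsilon_spec (inhabits (fun _ : 'I_N => 0 : Fr 2)) (good U phi)
    (ex_intro _ _ (goodP _ _ _ cv)).
  by move=> /coords_inj/(_ cv)/(_ i (ltn_ord i)); rewrite extE.
have ext_eq v w : (forall i : 'I_N, v i = w i) -> forall l, (l < N)%N -> ext v l = ext w l.
  by move=> vw l lt_l; rewrite /ext insubT vw.
exists Phi; split.
- move=> U phi /PhiP[Ov _] i; rewrite -extE; exact: Ov.
- move=> U phi psi /PhiP c1 /PhiP c2; split=> [eqp i|eqv].
    have [m [m0 homU uniqm]] := basic_open_homog U.
    rewrite -[LHS]extE -[RHS]extE; apply: (coords_inj (v := ext (Phi U phi)) _ c2); last exact: ltn_ord.
    split; first by case: c1.
    move=> m' homU'; apply: (represents_eq charK homU' (eqn_meets U) eqp).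
    by case: c1 => _; apply.
  have [m [m0 homU uniqm]] := basic_open_homog U.
  case: c1 c2 => _ r1 [_ r2].
  exact: (represents_eqI charK homU (eqn_meets U) (ext_eq _ _ eqv) (r1 m homU) (r2 m homU)).
- move=> U v Ov; have Ov' l : (l < N)%N -> OP1 (k l) U (ext v l).
    by move=> lt_l; rewrite /ext insubT; apply: (Ov (Sub l lt_l)).
  have [phi phiP cv] := coords_section Ov'.
  by exists phi => // i; rewrite (PhiE _ _ _ cv) extE.
split.
- move=> U phi psi /PhiP[O1 r1] /PhiP[O2 r2].
  have [m [m0 homU uniqm]] := basic_open_homog U.
  have homh := pullback_homog e homU.
  have em0 : (0 < e * m)%N by rewrite muln_gt0 m0 (ltnW e_ge2).
  have c : coords U (fun x => phi x + psi x) (fun l => ext (Phi U phi) l + ext (Phi U psi) l).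
    split=> [l lt_l|m' homU']; last exact: (representsD (r1 _ homU') (r2 _ homU')).
    exact: (flocD iotaI (eqn_meets U) homh em0 (O1 l lt_l) (O2 l lt_l)).
  by move=> i; rewrite (PhiE _ _ _ c) !extE.
- move=> U c phi Oc /PhiP[O1 r1].
  have [m [m0 homU uniqm]] := basic_open_homog U.
  have homh := pullback_homog e homU.
  have cc : coords U (fun x => c * phi x) (fun l => c * ext (Phi U phi) l).
    split=> [l lt_l|m' homU']; last exact: (representsZ c (r1 _ homU')).
    by have := flocM (iota := iota) (eqn_meets U) homh Oc (O1 l lt_l); rewrite add0r.
  by move=> i; rewrite (PhiE _ _ _ cc) !extE.
move=> U U' phi phi' [r UE] /PhiP c1 /PhiP c2 eqp i.
have [m [m0 homU uniqm]] := basic_open_homog U.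
have [m' [m'0 homU' uniqm']] := basic_open_homog U'.
rewrite -[LHS]extE -[RHS]extE.
case: c1 c2 => _ /(_ m homU) r1 [_ /(_ m' homU') r2].
have U'0 := eqn_meets U'; rewrite UE in r2 homU' U'0.
have {}r2 := represents_restrict iotaI iota'I charK homU homU' U'0 eqp r2.
exact: (represents_inj iotaI e_ge2 e_len l0_leN n1E homF m0 homU (eqn_meets U) iota'I r2 r1).
Qed.

End SplitBundle.

(** * Directional derivatives and equations of the curve *)

Section Directional.

Variables (K : closedFieldType) (e n : nat).
Hypothesis charK : [pchar K] =i pred0.
Hypotheses (e_ge2 : (2 <= e)%N) (e_len : (e <= n)%N).
Notation pb := (@rnc_pullback K e n).
Notation xv := (@xv K n).
Notation minor := (@minor K n).
Implicit Types (H G : {mpoly K[n.+1]}) (p v : 'I_n.+1 -> K).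

Definition dirderiv v H p : K := \sum_k v k * (H^`M(k)).@[p].

Lemma dirderivM v H G p :
  dirderiv v (H * G) p = dirderiv v H p * G.@[p] + H.@[p] * dirderiv v G p.
Proof.
rewrite /dirderiv mulr_suml mulr_sumr -big_split /=; apply: eq_bigr => k _.
by rewrite mderivM mevalD !mevalM; ring.
Qed.

Lemma dirderivD v H G p : dirderiv v (H + G) p = dirderiv v H p + dirderiv v G p.
Proof.
rewrite /dirderiv -big_split /=; apply: eq_bigr => k _.
by rewrite mderivD mevalD mulrDr.
Qed.

Lemma dirderivC v (c : K) p : dirderiv v (c%:MP : {mpoly K[n.+1]}) p = 0.
Proof. by apply: big1 => k _; rewrite mderivC meval0 mulr0. Qed.

Lemma dirderiv_critical v H p : (forall k, (H^`M(k)).@[p] = 0) -> dirderiv v H p = 0.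
Proof. by move=> crit; apply: big1 => k _; rewrite crit mulr0. Qed.

Lemma dirderivB v H G p : dirderiv v (H - G) p = dirderiv v H p - dirderiv v G p.
Proof.
rewrite /dirderiv -sumrB; apply: eq_bigr => k _.
by rewrite mderivB mevalB mulrBr.
Qed.

Lemma dirderiv_exp v H j p :
  dirderiv v (H ^+ j.+1) p = j.+1%:R * H.@[p] ^+ j * dirderiv v H p.
Proof.
elim: j => [|j IHj]; first by rewrite expr1 expr0 !mul1r.
by rewrite exprS dirderivM IHj rmorphXn /= [j.+2%:R]mulrSr !exprS; ring.
Qed.

Lemma mderivXU (i k : 'I_n.+1) : ('X_i : {mpoly K[n.+1]})^`M(k) = (i == k)%:R.
Proof.
rewrite mderivX mnm1E; case: eqP => [->|_]; last by rewrite scale0r.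
rewrite scale1r (_ : _ - _ = 0)%MM ?mpolyX0 //.
by apply/mnmP => l; rewrite mnmBE mnm0E subnn.
Qed.

Lemma dirderiv_xv v i p : dirderiv v (xv i) p = v (inord i).
Proof.
rewrite /dirderiv (bigD1 (inord i)) //= big1 ?addr0 => [|k kNi].
  by rewrite mderivXU eqxx meval1 mulr1.
by rewrite mderivXU eq_sym (negbTE kNi) meval0 mulr0.
Qed.

Lemma meval_xv i p : (xv i).@[p] = p (inord i).
Proof. by rewrite mevalXU. Qed.

Lemma meval_minor a b p : (minor a b).@[p] =
  p (inord a) * p (inord b.+1) - p (inord a.+1) * p (inord b).
Proof. by rewrite mevalB !mevalM !meval_xv. Qed.

Lemma dirderiv_minor v a b p : dirderiv v (minor a b) p =
  v (inord a) * p (inord b.+1) + p (inord a) * v (inord b.+1)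
  - (v (inord a.+1) * p (inord b) + p (inord a.+1) * v (inord b)).
Proof. by rewrite dirderivB !dirderivM !dirderiv_xv !meval_xv. Qed.

Definition on_rnc p : Prop := exists c u w,
  [/\ c != 0, (u, w) != (0, 0) & forall k, p k = c * rnc e u w k].

(** If [p 0] is nonzero, the equations [minor 0 i] make the coordinates a
    geometric progression; otherwise the minors force all coordinates before
    the one of index [e] to vanish. *)
Lemma on_rncP p : (exists k, p k != 0) ->
  (forall j, (e < j <= n)%N -> p (inord j) = 0) ->
  (forall a b, (a < e)%N -> (b < e)%N -> (minor a b).@[p] = 0) -> on_rnc p.
Proof.
move=> [k0 k0N0] pj0 pM0; pose P i := p (inord i).
have ME a b : (a < e)%N -> (b < e)%N -> P a * P b.+1 = P a.+1 * P b.
  by move=> ha hb; apply/eqP; rewrite -subr_eq0 -meval_minor pM0.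
have pE c u w : (forall i, (i <= e)%N -> P i = c * (u ^+ (e - i) * w ^+ i)) ->
    forall k, p k = c * rnc e u w k.
  move=> h k; rewrite /rnc -[k in p k]inord_val; case: ifP => [le_ke|/negbT]; first exact: h.
  by rewrite -ltnNge => lt_ek; rewrite mulr0 pj0 // lt_ek -ltnS ltn_ord.
have [P00|P0N0] := eqVneq (P 0%N) 0; last first.
  exists (P 0%N), 1, (P 1%N / P 0%N); split=> //; first by rewrite -pair_eqE /= oner_eq0.
  apply: pE => i; rewrite expr1n mul1r; elim: i => [|i IHi] le_ie; first by rewrite expr0 mulr1.
  have IH := IHi (ltnW le_ie); apply: (mulfI P0N0).
  rewrite (ME 0%N i (ltnW e_ge2) le_ie) IH exprS.
  by move: (_ ^+ i) => x; field.
have Pi0 i : (i < e)%N -> P i = 0.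
  elim: i => [//|i IHi] lt_ie; have := ME i i.+1 (ltnW lt_ie) lt_ie.
  by rewrite IHi ?(ltnW lt_ie) // mul0r => /esym/eqP; rewrite mulf_eq0 orbb => /eqP.
have PeN0 : P e != 0.
  apply: contraNneq k0N0 => Pe0; rewrite -[k0]inord_val.
  have [lt_ke|] := ltnP k0 e; first by rewrite -/(P _) Pi0.
  rewrite leq_eqVlt => /predU1P[<-|lt_ek]; first by apply/eqP.
  by rewrite pj0 // lt_ek -ltnS ltn_ord.
exists (P e), 0, 1; split=> //; first by rewrite -pair_eqE /= oner_eq0 andbF.
apply: pE => i; rewrite leq_eqVlt => /predU1P[->|lt_ie].
  by rewrite subnn expr0 expr1n !mulr1.
by rewrite Pi0 // expr0n subn_eq0 leqNgt lt_ie mul0r mulr0.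
Qed.

End Directional.

(** * Avoiding singular points in a linear system *)

Section Strata.

Variables (K : closedFieldType) (n d : nat) (X : finType).
Variable (H : X -> {mpoly K[n.+1]}).
Hypotheses (homH : forall x, H x \is d.-homog).
Implicit Types (p v : 'I_n.+1 -> K) (lam : X -> K).

Definition singular_at lam p : Prop := forall k, \sum_x lam x * ((H x)^`M(k)).@[p] = 0.

(** The directions in which all members of the system have zero derivative at
    [p]; their codimension is the rank of the gradients at [p]. *)
Definition in_kernel p v : Prop := forall x, dirderiv v (H x) p = 0.

Lemma grad_scale x k c p : (0 < d)%N ->
  ((H x)^`M(k)).@[fun i => c * p i] = c ^+ d.-1 * ((H x)^`M(k)).@[p].
Proof.
move=> d_gt0; apply: meval_homog; by apply: mderiv_homog; rewrite prednK.
Qed.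

(** Being singular at a point where [r] rows of the matrix of gradients are
    independent imposes [r] conditions on the coefficients of a member, and
    the points of the stratum have only [m < r] parameters. The function [S]
    singles out the independent rows. *)
Lemma stratum_avoid (m r : nat) (pi : 'I_n.+1 -> {mpoly K[m]}) :
  (0 < d)%N -> (m < r)%N ->
  exists2 P : {mpoly K[#|X|]}, P != 0 & forall lam p,
    singular_at lam p ->
    (exists c z, c != 0 /\ forall k, p k = c * (pi k).@[z]) ->
    (exists2 S : 'I_r -> 'I_n.+1, injective S & forall v, in_kernel p v ->
       (forall k, k \notin codom S -> v k = 0) -> forall k, v k = 0) ->
    P.@[fun i => lam (enum_val i)] = 0.
Proof.
move=> d_gt0 lt_mr.
pose A (S : {ffun 'I_r -> 'I_n.+1}) (k : 'I_r) (i : 'I_#|X|) : {mpoly K[m]} :=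
  (H (enum_val i))^`M(S k) \mPo [tuple pi l | l < n.+1].
have AE S k i z : (A S k i).@[z] = ((H (enum_val i))^`M(S k)).@[fun l => (pi l).@[z]].
  by rewrite comp_mpoly_meval; apply: meval_eq => l; rewrite tnth_mktuple.
have /fin_all_exists2[P PN0 PE] S := kernel_avoid (A S) lt_mr.
exists (\prod_S P S); first by apply/prodf_neq0 => S _; apply: PN0.
move=> lam p sing [c [z [cN0 pE]]] [S SI indep].
have gE x k : ((H x)^`M(k)).@[p] = c ^+ d.-1 * ((H x)^`M(k)).@[fun l => (pi l).@[z]].
  by rewrite -grad_scale //; apply: meval_eq => l; rewrite pE.
have cdN0 : c ^+ d.-1 != 0 by rewrite expf_neq0.
rewrite rmorph_prod /=; apply/eqP/prodf_eq0; exists (finfun S) => //; apply/eqP.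
apply: (PE _ _ z) => [k|v vA k].
  apply: (mulfI cdN0); rewrite mulr0 -[RHS](sing (S k)) mulr_sumr.
  rewrite [RHS](reindex (@enum_val X predT)) /=; last first.
    by apply: onW_bij; exact: enum_val_bij.
  by apply: eq_bigr => i _; rewrite AE ffunE gE; ring.
pose v' k := \sum_(i | S i == k) v i.
have v'S i : v' (S i) = v i.
  by rewrite /v' (big_pred1 i) // => j; rewrite /= (inj_eq SI).
rewrite -v'S; apply: indep => [x|k' k'S]; last first.
  by rewrite /v' big_pred0 // => i; apply: contraNF k'S => /eqP<-; exact: codom_f.
rewrite /dirderiv /v'; under eq_bigr do rewrite mulr_suml big_mkcond.
rewrite exchange_big /=.
have := vA (enum_rank x); rewrite -[RHS](mulr0 (c ^+ d.-1)) => E.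
transitivity (c ^+ d.-1 * \sum_k v k * (A (finfun S) k (enum_rank x)).@[z]).
  rewrite mulr_sumr; apply: eq_bigr => i _; rewrite (bigD1 (S i)) //= eqxx big1 ?addr0 => [|j].
    by rewrite AE ffunE enum_rankK gE; ring.
  by rewrite eq_sym => /negbTE->.
by rewrite vA mulr0.
Qed.

Definition chart (i k : 'I_n.+1) : {mpoly K[n]} :=
  if unlift i k is Some j then 'X_j else 1.

Lemma chartP p i : p i != 0 ->
  exists c z, c != 0 /\ forall k, p k = c * (chart i k).@[z].
Proof.
move=> piN0; exists (p i), (fun j => p (lift i j) / p i); split=> // k.
rewrite /chart; case: unliftP => [j ->|->]; last by rewrite meval1 mulr1.
by rewrite mevalXU mulrC divfK.
Qed.

Lemma full_rank_avoid : (0 < d)%N -> exists2 P : {mpoly K[#|X|]}, P != 0 & forall lam p,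
  singular_at lam p -> (exists k, p k != 0) ->
  (forall v, in_kernel p v -> forall k, v k = 0) -> P.@[fun i => lam (enum_val i)] = 0.
Proof.
move=> d_gt0.
have /fin_all_exists2[P PN0 PE] i := stratum_avoid (chart i) d_gt0 (ltnSn n).
exists (\prod_i P i); first by apply/prodf_neq0 => i _; apply: PN0.
move=> lam p sing [k pkN0] ker0.
rewrite rmorph_prod /=; apply/eqP/prodf_eq0; exists k => //; apply/eqP.
apply: (PE k lam p sing (chartP pkN0)).
by exists id => // v vker _; apply: ker0.
Qed.

End Strata.

(** * The kernel of the polarised minors *)

Section Secants.

Variables (K : fieldType) (e : nat) (P : nat -> K) (i0 j0 : nat).
Hypotheses (lt_i0e : (i0 < e)%N) (lt_j0e : (j0 < e)%N).
Hypothesis minorN0 : P i0 * P j0.+1 - P i0.+1 * P j0 != 0.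

(** The equations say that all minors have zero derivative at [P] in the
    direction [V]. By Cramer's rule with the independent columns [i0] and
    [j0], the same traceless linear transformation maps each pair of
    consecutive coordinates of [P] to that of [V]. *)
Lemma polar_kernel (V : nat -> K) :
  (forall i j, (i < e)%N -> (j < e)%N ->
     V i * P j.+1 + P i * V j.+1 - (V i.+1 * P j + P i.+1 * V j) = 0) ->
  exists a b c, forall i, (i < e)%N ->
    V i = a * P i + b * P i.+1 /\ V i.+1 = c * P i - a * P i.+1.
Proof.
have dN0 := minorN0; move=> E; set dl := _ - _ in dN0.
exists ((P j0 * V i0.+1 - P i0 * V j0.+1) / dl), ((P i0 * V j0 - P j0 * V i0) / dl),
  ((P j0.+1 * V i0.+1 - P i0.+1 * V j0.+1) / dl) => i lt_ie.
have E0 := E _ _ lt_i0e lt_j0e.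
have E1 := E _ _ lt_ie lt_i0e; have E2 := E _ _ lt_ie lt_j0e.
split; apply: (mulfI dN0); apply/eqP; rewrite -subr_eq0; apply/eqP.
  transitivity (P i0 * (V i * P j0.+1 + P i * V j0.+1 - (V i.+1 * P j0 + P i.+1 * V j0))
    - P j0 * (V i * P i0.+1 + P i * V i0.+1 - (V i.+1 * P i0 + P i.+1 * V i0))).
    by rewrite /dl; field.
  by rewrite E1 E2 !mulr0 subrr.
transitivity (P i0.+1 * (V i * P j0.+1 + P i * V j0.+1 - (V i.+1 * P j0 + P i.+1 * V j0))
    - P j0.+1 * (V i * P i0.+1 + P i * V i0.+1 - (V i.+1 * P i0 + P i.+1 * V i0))
    - P i.+1 * (V i0 * P j0.+1 + P i0 * V j0.+1 - (V i0.+1 * P j0 + P i0.+1 * V j0))).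
  by rewrite /dl; field.
by rewrite E0 E1 E2 !mulr0 !subrr.
Qed.

(** If [P] satisfies all three relations with a nonzero vector [(n0, n1, n2)],
    it is a geometric progression or vanishes except possibly in the last
    place, so all minors vanish. *)
Lemma secant_unique (n0 n1 n2 : K) : (3 <= e)%N ->
  (forall i, (i.+1 < e)%N -> [/\ n0 * P i.+1 = n1 * P i, n0 * P i.+2 = n2 * P i
     & n1 * P i.+2 = n2 * P i.+1]) -> [/\ n0 = 0, n1 = 0 & n2 = 0].
Proof.
move=> e_ge3 nP.
have n00 : n0 = 0.
  apply/eqP/negPn/negP => n0N0; case/eqP: minorN0.
  have step i : (i < e)%N -> P i.+1 = n1 / n0 * P i.
    move=> lt_ie; apply: (mulfI n0N0).
    have -> : n0 * (n1 / n0 * P i) = n1 * P i by field.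
    have [lt_ie1|le_ei] := ltnP i.+1 e; first by have [] := nP i lt_ie1.
    case: i lt_ie le_ei => [|[|i]] lt_ie le_ei; try lia.
    have [_ -> _] := nP i.+1 lt_ie.
    have [_ _ E3] := nP i (ltnW lt_ie).
    by rewrite E3.
  have geo i : (i <= e)%N -> P i = (n1 / n0) ^+ i * P 0%N.
    elim: i => [|i IHi] le_ie; first by rewrite expr0 mul1r.
    by rewrite step // IHi ?(ltnW le_ie) // exprS mulrA.
  rewrite (geo i0 (ltnW lt_i0e)) (geo j0 (ltnW lt_j0e)) (geo i0.+1 lt_i0e) (geo j0.+1 lt_j0e).
  by rewrite !exprS; ring.
have n10 : n1 = 0.
  apply/eqP/negPn/negP => n1N0; case/eqP: minorN0.
  have Z i : (i.+1 < e)%N -> P i = 0.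
    by move=> /nP[]; rewrite n00 mul0r => /esym/eqP; rewrite mulf_eq0 (negbTE n1N0) => /eqP.
  have Z' i : (i <= e)%N -> P i = 0.
    move=> le_ie; have [/Z //|le_ei] := ltnP i.+1 e.
    have S k : (0 < k)%N -> (k.+1 <= e)%N -> P k = 0 -> P k.+1 = 0.
      case: k => // k _ lt_ke Pk0; have [_ _] := nP k lt_ke.
      by rewrite Pk0 mulr0 => /eqP; rewrite mulf_eq0 (negbTE n1N0) => /eqP.
    have Pe2 : P e.-2 = 0 by apply: Z; lia.
    have Pe1 : P e.-1 = 0 by rewrite (_ : e.-1 = e.-2.+1); [apply: S|]; lia || done.
    have [->|->] : i = e.-1 \/ i = e by lia.
      by [].
    by rewrite (_ : e = e.-1.+1); [apply: S|]; lia || done.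
  by rewrite !Z' ?mul0r ?subrr //; exact: ltnW.
split=> //; apply/eqP/negPn/negP => n2N0; case/eqP: minorN0.
have Z i : (i < e)%N -> P i = 0.
  have Z1 k : (k.+1 < e)%N -> P k = 0 /\ P k.+1 = 0.
    move=> /nP[_]; rewrite n00 n10 !mul0r => /esym/eqP; rewrite mulf_eq0 (negbTE n2N0) => /eqP->.
    by move=> /esym/eqP; rewrite mulf_eq0 (negbTE n2N0) => /eqP->.
  case: i => [|i] lt_ie; last by have [] := Z1 i lt_ie.
  by have [] := Z1 0%N; lia || done.
by rewrite (Z i0) // (Z j0) // mul0r mulr0 subrr.
Qed.

(** By [polar_kernel] a vector in the kernel gives a recurrence of order two,
    [c P_i - 2 a P_(i+1) - b P_(i+2) = 0], so [P] lies on a secant or tangent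
    line of the curve. Two non-proportional recurrences would place [P] on the
    curve itself. *)
Lemma polar_kernel_line (a b c a' b' c' : K) : (3 <= e)%N -> 2%:R != 0 :> K ->
  (forall i, (i.+1 < e)%N -> c * P i - a * P i.+1 = a * P i.+1 + b * P i.+2) ->
  (forall i, (i.+1 < e)%N -> c' * P i - a' * P i.+1 = a' * P i.+1 + b' * P i.+2) ->
  [/\ a * b' = a' * b, a * c' = a' * c & b * c' = b' * c].
Proof.
move=> e_ge3 two h h'.
have [|E0 E1 E2] := @secant_unique (2%:R * (a * b' - a' * b)) (b' * c - b * c')
  (2%:R * (a * c' - a' * c)) e_ge3.
  move=> i lt_ie; have {}h := h i lt_ie; have {}h' := h' i lt_ie.
  have H : c * P i - 2%:R * a * P i.+1 - b * P i.+2 = 0.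
    by transitivity (c * P i - a * P i.+1 - (a * P i.+1 + b * P i.+2)); [ring|rewrite h subrr].
  have H' : c' * P i - 2%:R * a' * P i.+1 - b' * P i.+2 = 0.
    by transitivity (c' * P i - a' * P i.+1 - (a' * P i.+1 + b' * P i.+2)); [ring|rewrite h' subrr].
  split; apply/eqP; rewrite -subr_eq0; apply/eqP.
  - transitivity (b * (c' * P i - 2%:R * a' * P i.+1 - b' * P i.+2)
      - b' * (c * P i - 2%:R * a * P i.+1 - b * P i.+2)); first by ring.
    by rewrite H H' !mulr0 subrr.
  - transitivity (2%:R * a' * (c * P i - 2%:R * a * P i.+1 - b * P i.+2)
      - 2%:R * a * (c' * P i - 2%:R * a' * P i.+1 - b' * P i.+2)); first by ring.
    by rewrite H H' !mulr0 subrr.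
  transitivity (c' * (c * P i - 2%:R * a * P i.+1 - b * P i.+2)
    - c * (c' * P i - 2%:R * a' * P i.+1 - b' * P i.+2)); first by ring.
  by rewrite H H' !mulr0 subrr.
split.
- by move/eqP: E0; rewrite mulf_eq0 (negbTE two) subr_eq0 => /eqP.
- by move/eqP: E2; rewrite mulf_eq0 (negbTE two) subr_eq0 => /eqP.
by move/eqP: E1; rewrite subr_eq0 => /eqP.
Qed.

End Secants.

(** * The square of the ideal *)

Section SquareSystem.

Variables (K : closedFieldType) (e n d : nat).
Hypothesis charK : [pchar K] =i pred0.
Hypotheses (e_ge2 : (2 <= e)%N) (e_len : (e <= n)%N) (d_ge4 : (4 <= d)%N).
Notation pb := (@rnc_pullback K e n).
Notation xv := (@xv K n).
Notation minor := (@minor K n).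
Implicit Types (p v : 'I_n.+1 -> K).

(** Forms of degree [d] in the square of the ideal. The number [c] selects one
    of four families, and indices out of range give zero, so that the whole
    system is indexed by a finite type. *)
Definition sqform (c i j a b : nat) : {mpoly K[n.+1]} :=
  match c with
  | 0 => if (e < i <= n)%N then xv i * (xv i * (xv i ^+ (d - 3) * xv j)) else 0
  | 1 => if [&& e < i <= n, a < e & b < e]%N then xv i * (minor a b * xv j ^+ (d - 3)) else 0
  | 2 => if [&& 5 <= d, a < e & b < e]%N
         then minor a b * (minor a b * (xv i ^+ (d - 5) * xv j)) else 0
  | _ => if [&& d == 4, i < e, j < e, a < e & b < e]%N then minor i j * minor a b else 0
  end.

Lemma sqform_homog c i j a b : sqform c i j a b \is d.-homog.
Proof.
have xE i' k : xv i' ^+ k \is k.-homog.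
  by have := dhomogMn k (xv_homog K n i'); rewrite mul1n.
have x1 := xv_homog K n; have M2 := minor_homog K n.
have out (b' : bool) k h : (b' -> d = k) -> h \is k.-homog ->
    (if b' then h else 0 : {mpoly K[n.+1]}) \is d.-homog.
  by case: b' => [->|]// _ _; apply: dhomog0.
case: c => [|[|[|c]]] /=.
- apply: (out _ (1 + (1 + ((d - 3) + 1)))%N); first by move=> _; lia.
  by do 3?apply: dhomogM.
- apply: (out _ (1 + (2 + (d - 3)))%N); first by move=> _; lia.
  by do 3?apply: dhomogM.
- apply: (out _ (2 + (2 + ((d - 5) + 1)))%N); first by case/and3P=> ? _ _; lia.
  by do 3?apply: dhomogM.
apply: (out _ (2 + 2)%N); first by case/and5P=> /eqP->.
exact: dhomogM.
Qed.

Lemma sqform_class c i j a b : hasclass e (sqform c i j a b) (fun=> 0) /\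
  pb (sqform c i j a b) = 0.
Proof.
have h0 : hasclass e (0 : {mpoly K[n.+1]}) (fun=> 0) /\ pb 0 = 0.
  by split; [exact: hasclass0|exact: rmorph0].
have pM a' b' : (a' < e)%N -> (b' < e)%N -> pb (minor a' b') = 0 by exact: pullback_minor.
have sq u w : pb u = 0 -> pb w = 0 -> hasclass e (u * w) (fun=> 0) /\ pb (u * w) = 0.
  by move=> u0 w0; split; [exact: hasclass_sqr0|rewrite rmorphM /= u0 mul0r].
case: c => [|[|[|c]]] /=; case: ifP => // h.
- by apply: sq; rewrite ?rmorphM /= pullback_xv0 ?mul0r.
- case/and3P: h => h ha hb.
  by apply: sq; rewrite ?rmorphM /= ?pM ?mul0r // pullback_xv0.
- case/and3P: h => _ ha hb.
  by apply: sq; rewrite ?rmorphM /= ?pM ?mul0r.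
by case/and5P: h => _ hi hj ha hb; apply: sq; rewrite pM.
Qed.

Section Kernel.

Variables (p v : 'I_n.+1 -> K).
Hypothesis ker : forall c i j a b, (i <= n)%N -> (j <= n)%N -> (a <= n)%N -> (b <= n)%N ->
  dirderiv v (sqform c i j a b) p = 0.

Let P i := p (inord i).
Let V i := v (inord i).

Let V0 : (forall j, (j <= n)%N -> V j = 0) -> forall k, v k = 0.
Proof. by move=> h k; rewrite -[k]inord_val; apply: h; rewrite -ltnS ltn_ord. Qed.

Let natN0 j : j.+1%:R != 0 :> K.
Proof. by move/pcharf0P: charK => ->. Qed.

(** Off the linear span of the curve some coordinate [xv i] in the ideal is
    nonzero, and the products [xv i ^+ (d - 1) * xv j] have independent
    gradients there. *)
Lemma kernel_off_span i : (e < i <= n)%N -> P i != 0 -> forall k, v k = 0.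
Proof.
move=> lt_ei PiN0.
have le_in : (i <= n)%N by case/andP: lt_ei.
have D j : (j <= n)%N -> dirderiv v (xv i ^+ d.-1) p * P j + P i ^+ d.-1 * V j = 0.
  move=> le_jn; have := ker 0 le_in le_jn (leq0n n) (leq0n n); rewrite /sqform lt_ei.
  have -> : xv i * (xv i * (xv i ^+ (d - 3) * xv j)) = xv i ^+ d.-1 * xv j.
    by rewrite (_ : d.-1 = (d - 3).+2) ?exprS ?mulrA //; lia.
  by rewrite dirderivM rmorphXn /= !meval_xv dirderiv_xv.
have Vi : V i = 0.
  have := D i le_in; rewrite (_ : d.-1 = d.-2.+1); last by lia.
  rewrite dirderiv_exp dirderiv_xv meval_xv -/(P i) -/(V i) => E.
  have : (d.-2.+2)%:R * P i ^+ d.-2.+1 * V i = 0.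
    by rewrite -[RHS]E [d.-2.+2%:R]mulrSr exprS; ring.
  by move/eqP; rewrite !mulf_eq0 expf_eq0 (negbTE PiN0) andbF (negbTE (natN0 _)) => /eqP.
apply: V0 => j le_jn; have := D j le_jn.
rewrite (_ : d.-1 = d.-2.+1); last by lia.
rewrite dirderiv_exp dirderiv_xv -/(V i) Vi mulr0 mul0r add0r => /eqP.
by rewrite mulf_eq0 expf_eq0 (negbTE PiN0) andbF => /eqP.
Qed.

Hypothesis Pj0 : forall j, (e < j <= n)%N -> P j = 0.
Variables (i a b : nat).
Hypotheses (le_in : (i <= n)%N) (PiN0 : P i != 0) (lt_ae : (a < e)%N) (lt_be : (b < e)%N).
Hypothesis MN0 : (minor a b).@[p] != 0.

Let le_an : (a <= n)%N. Proof. exact: leq_trans (ltnW lt_ae) e_len. Qed.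
Let le_bn : (b <= n)%N. Proof. exact: leq_trans (ltnW lt_be) e_len. Qed.

Lemma kernel_normal j : (e < j <= n)%N -> V j = 0.
Proof.
move=> lt_ej; have le_jn : (j <= n)%N by case/andP: lt_ej.
have := ker 1 le_jn le_in le_an le_bn; rewrite /sqform lt_ej lt_ae lt_be /=.
rewrite dirderivM dirderiv_xv meval_xv -/(P j) Pj0 // mul0r addr0 mevalM rmorphXn /= meval_xv.
move/eqP; rewrite !mulf_eq0 expf_eq0 -/(P i) (negbTE PiN0) (negbTE MN0) andbF !orbF.
by move/eqP.
Qed.

(** In degree at least [5] the system contains the products of all linear
    forms with a fixed form [A] of degree [d - 1] that does not vanish at [p].
    Their derivatives show that [V = - tau P], and then Euler's formula gives
    [d tau = 0]. *)
Lemma kernel_degree5 : (5 <= d)%N -> forall k, v k = 0.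
Proof.
move=> d_ge5; pose A := minor a b * (minor a b * xv i ^+ (d - 5)).
have AE : A.@[p] = (minor a b).@[p] ^+ 2 * P i ^+ (d - 5).
  by rewrite !mevalM rmorphXn /= meval_xv mulrA -expr2.
have AN0 : A.@[p] != 0 by rewrite AE mulf_neq0 ?expf_neq0.
have D j : (j <= n)%N -> dirderiv v A p * P j + A.@[p] * V j = 0.
  move=> le_jn; have := ker 2 le_in le_jn le_an le_bn; rewrite /sqform d_ge5 lt_ae lt_be /=.
  have -> : minor a b * (minor a b * (xv i ^+ (d - 5) * xv j)) = A * xv j.
    by rewrite /A !mulrA.
  by rewrite dirderivM meval_xv dirderiv_xv.
pose tau := dirderiv v A p / A.@[p].
have VE j : (j <= n)%N -> V j = - tau * P j.
  move=> /D/eqP; rewrite addrC addr_eq0 => /eqP E; apply: (mulfI AN0); rewrite E /tau.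
  by field.
have ME : dirderiv v (minor a b) p = - 2%:R * tau * (minor a b).@[p].
  rewrite dirderiv_minor meval_minor -!/(V _) -!/(P _) !VE ?le_an ?le_bn //; try by lia.
  by ring.
have XE : dirderiv v (xv i ^+ (d - 5)) p = - (d - 5)%:R * tau * P i ^+ (d - 5).
  case: (d - 5)%N => [|c].
    rewrite /dirderiv big1 ?oppr0 ?mul0r // => k _.
    by rewrite expr0 -mpolyC1 mderivC meval0 mulr0.
  by rewrite dirderiv_exp dirderiv_xv meval_xv -/(V i) -/(P i) VE // exprS; ring.
have : (d - 5).+4.+1%:R * (tau * A.@[p]) = 0.
  have : dirderiv v A p = tau * A.@[p] by rewrite /tau divfK.
  rewrite AE /A !dirderivM ME XE mevalM rmorphXn /= meval_xv -/(P i) => /eqP.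
  rewrite -subr_eq0 => /eqP E; rewrite -[RHS]oppr0 -[in RHS]E.
  have -> : (d - 5).+4.+1%:R = (d - 5)%:R + 5%:R :> K by rewrite -natrD addnC.
  by ring.
move/eqP; rewrite mulf_eq0 (negbTE (natN0 _)) mulf_eq0 (negbTE AN0) orbF => /eqP tau0.
by apply: V0 => j le_jn; rewrite VE // tau0 oppr0 mul0r.
Qed.

(** In degree [4] and along the span of the curve, only the products of two
    minors are available. If one minor does not vanish at [p], its square
    shows that its own derivative is zero, and then its products with the
    other minors show the same for these. *)
Lemma kernel_degree4 i' j' : d = 4 -> (i' < e)%N -> (j' < e)%N ->
  dirderiv v (minor i' j') p = 0.
Proof.
move=> d4.
have D a' b' : (a' < e)%N -> (b' < e)%N -> dirderiv v (minor a b * minor a' b') p = 0.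
  move=> ha hb; have := @ker 3 a b a' b' le_an le_bn.
  rewrite /sqform d4 lt_ae lt_be ha hb /=; apply; lia.
have M0 : dirderiv v (minor a b) p = 0.
  have := D a b lt_ae lt_be; rewrite dirderivM mulrC -mulr2n -mulr_natl => /eqP.
  by rewrite !mulf_eq0 (negbTE (natN0 1)) (negbTE MN0) => /eqP.
move=> ha hb; have := D i' j' ha hb; rewrite dirderivM M0 mul0r add0r => /eqP.
by rewrite mulf_eq0 (negbTE MN0) => /eqP.
Qed.

End Kernel.

End SquareSystem.

(** * Smoothness of a general member off the curve *)

Section LinearRecurrence.

Variables (R : comNzRingType) (x y r0 r1 : R).

Fixpoint linrec_pair (i : nat) : R * R :=
  if i is i'.+1 then
    let: (u, w) := linrec_pair i' in (w, x * u + y * w)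
  else (r0, r1).

Definition linrec (i : nat) : R := (linrec_pair i).1.

Lemma linrecSS i : linrec i.+2 = x * linrec i + y * linrec i.+1.
Proof. by rewrite /linrec /=; case: linrec_pair. Qed.

End LinearRecurrence.

Lemma linrec_meval (K : fieldType) (m : nat) (x y r0 r1 : {mpoly K[m]}) z i :
  (linrec x y r0 r1 i).@[z] = linrec x.@[z] y.@[z] r0.@[z] r1.@[z] i.
Proof.
elim/ltn_ind: i => -[|[|i]] // IH.
by rewrite !linrecSS mevalD !mevalM !IH //; lia.
Qed.

Section SmoothMember.

Variables (K : closedFieldType) (e n d : nat).
Hypothesis charK : [pchar K] =i pred0.
Hypotheses (e_ge2 : (2 <= e)%N) (e_len : (e <= n)%N) (d_ge4 : (4 <= d)%N).
Hypothesis big : (5 <= d)%N || (4 <= n)%N.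
Notation pb := (@rnc_pullback K e n).
Notation minor := (@minor K n).
Implicit Types (p v : 'I_n.+1 -> K).

(** The entries are [c], [i], [j], [a], [b] of [sqform]. *)
Definition sq_index : finType := ('I_4 * 'I_n.+1 * 'I_n.+1 * 'I_n.+1 * 'I_n.+1)%type.

Variable F0 : {mpoly K[n.+1]}.
Hypothesis homF0 : F0 \is d.-homog.

Definition member (x : option sq_index) : {mpoly K[n.+1]} :=
  if x is Some (c, i, j, a, b) then sqform K e n d c i j a b else F0.

Lemma member_homog x : member x \is d.-homog.
Proof. by case: x => [[[[[c i] j] a] b]|] //; apply: sqform_homog. Qed.

Lemma member_kernel p v : in_kernel member p v ->
  forall c i j a b, (i <= n)%N -> (j <= n)%N -> (a <= n)%N -> (b <= n)%N ->
  dirderiv v (sqform K e n d c i j a b) p = 0.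
Proof.
move=> ker c i j a b hi hj ha hb.
have := ker (Some (inord (minn c 3), inord i, inord j, inord a, inord b)).
rewrite /member !inordK //; last by rewrite ltnS geq_minr.
by case: c => [|[|[|c]]].
Qed.

Let two : 2%:R != 0 :> K. Proof. by move/pcharf0P: charK => ->. Qed.

Notation X3 i := ('X_(inord i : 'I_3) : {mpoly K[3]}).

(** The points on the secant and tangent lines of the curve form a variety of
    dimension at most three. Their coordinates satisfy a linear recurrence of
    order two, and the four maps correspond to its shape: a recurrence that
    can be solved for the last term, with nonzero or zero first coordinate; a
    recurrence of order one on all coordinates but the last; and the vanishing
    of all coordinates but the two at the ends. *)
Definition secant_map (t : 'I_4) (k : 'I_n.+1) : {mpoly K[3]} :=
  match val t with
  | 0 => if (k <= e)%N then linrec (X3 0) (X3 1) 1 (X3 2) k else 0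
  | 1 => if (k <= e)%N then linrec (X3 0) (X3 1) (X3 2) 1 k else 0
  | 2 => if (k < e)%N then X3 0 ^+ (e.-1 - k) * X3 1 else if (k == e :> nat) then X3 2 else 0
  | _ => if (k == 0 :> nat) then X3 0 else if (k == e :> nat) then X3 1 else 0
  end.

Lemma secant_mapP p (a b c : K) : (exists k, p k != 0) ->
  (forall j, (e < j <= n)%N -> p (inord j) = 0) ->
  ~ [/\ a = 0, b = 0 & c = 0] ->
  (forall i, (i.+1 < e)%N -> c * p (inord i) - a * p (inord i.+1)
     = a * p (inord i.+1) + b * p (inord i.+2)) ->
  exists t w z, w != 0 /\ forall k, p k = w * (secant_map t k).@[z].
Proof.
move=> [k0 k0N0] pj0 abcN0 rec; pose P i := p (inord i).
have pE (t : 'I_4) w z :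
    (forall i, (i <= e)%N -> P i = w * (secant_map t (inord i)).@[z]) ->
    (forall k : 'I_n.+1, (e < k)%N -> (secant_map t k).@[z] = 0) ->
    forall k, p k = w * (secant_map t k).@[z].
  move=> h h0 k; have [le_ke|lt_ek] := leqP k e.
    by rewrite -{1}[k]inord_val -/(P k) h // inord_val.
  by rewrite h0 // mulr0 -[k]inord_val pj0 // lt_ek -ltnS ltn_ord.
have PN0 : exists2 i, (i <= e)%N & P i != 0.
  exists k0; last by rewrite /P inord_val.
  rewrite leqNgt; apply: contra k0N0 => lt_ek.
  by rewrite -[k0]inord_val pj0 // lt_ek -ltnS ltn_ord.
have inE i : (i <= e)%N -> (inord i : 'I_n.+1) = i :> nat.
  by move=> le_ie; rewrite inordK // ltnS; apply: leq_trans le_ie e_len.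
pose zz (z0 z1 z2 : K) (i : 'I_3) := nth 0 [:: z0; z1; z2] i.
have zE z0 z1 z2 : ((X3 0).@[zz z0 z1 z2] = z0) * ((X3 1).@[zz z0 z1 z2] = z1)
    * ((X3 2).@[zz z0 z1 z2] = z2).
  by rewrite !mevalXU /zz !inordK.
have [b0|bN0] := eqVneq b 0.
  have [c0|cN0] := eqVneq c 0.
    have aN0 : a != 0 by apply/eqP => a0; apply: abcN0.
    have Pi0 i : (0 < i < e)%N -> P i = 0.
      case: i => // i /= lt_ie; have := rec i lt_ie.
      rewrite b0 c0 !mul0r addr0 sub0r => /eqP; rewrite eq_sym -subr_eq0 opprK -mulr2n.
      by rewrite -mulr_natl !mulf_eq0 (negbTE two) (negbTE aN0) => /eqP.
    exists (inord 3), 1, (zz (P 0%N) (P e) 0); split; first exact: oner_neq0.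
    apply: pE => [i le_ie|k lt_ek]; rewrite /secant_map /= inordK //=.
      rewrite mul1r inE //; case: eqP => [->|iN0]; first by rewrite zE.
      case: eqP => [->|iNe]; first by rewrite zE.
      by rewrite meval0 Pi0 //; lia.
    by rewrite !gtn_eqF ?meval0 //; lia.
  have step i : (i.+1 < e)%N -> P i = (2%:R * a / c) * P i.+1.
    move=> lt_ie; apply: (mulfI cN0); have := rec i lt_ie.
    rewrite b0 mul0r addr0 => /eqP; rewrite subr_eq => /eqP->.
    by rewrite /P; field.
  exists (inord 2), 1, (zz (2%:R * a / c) (P e.-1) (P e)); split; first exact: oner_neq0.
  apply: pE => [i le_ie|k lt_ek]; rewrite /secant_map /= inordK //=.
    rewrite mul1r inE //; case: ltnP => [lt_ie|le_ei]; last first.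
      by rewrite (_ : i = e) ?eqxx ?zE //; apply/eqP; rewrite eqn_leq le_ie.
    rewrite mevalM rmorphXn /= !zE.
    have [k kE] : exists k, (i + k = e.-1)%N by exists (e.-1 - i)%N; lia.
    rewrite -kE addKn; elim: k i kE {le_ie lt_ie} => [|k IHk] i kE.
      by rewrite addn0 expr0 mul1r.
    rewrite step; last by lia.
    by rewrite (IHk i.+1) ?addSnnS // exprS mulrA.
  by rewrite ltnNge ltnW // gtn_eqF ?meval0.
have recP i : (i.+1 < e)%N -> P i.+2 = (c / b) * P i + (- (2%:R * a) / b) * P i.+1.
  move=> lt_ie; apply: (mulfI bN0).
  have -> : b * P i.+2 = c * P i - a * P i.+1 - a * P i.+1.
    by rewrite (rec i lt_ie) addrAC subrr add0r.
  by field.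
have linE w r0 r1 : P 0%N = w * r0 -> P 1%N = w * r1 -> forall i, (i <= e)%N ->
    P i = w * linrec (c / b) (- (2%:R * a) / b) r0 r1 i.
  move=> h0 h1; elim/ltn_ind => -[|[|i]] // IH le_ie.
  rewrite recP // linrecSS (IH i) ?(IH i.+1) //; try lia.
  by ring.
have [P00|P0N0] := eqVneq (P 0%N) 0; last first.
  exists (inord 0), (P 0%N), (zz (c / b) (- (2%:R * a) / b) (P 1%N / P 0%N)); split=> //.
  apply: pE => [i le_ie|k lt_ek]; rewrite /secant_map /= inordK //=.
    rewrite inE // le_ie linrec_meval !zE meval1; apply: linE => //; first by rewrite mulr1.
    by field.
  by rewrite leqNgt lt_ek meval0.
exists (inord 1), (P 1%N), (zz (c / b) (- (2%:R * a) / b) 0); split.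
  apply/eqP => P10; have [i le_ie] := PN0; rewrite (linE 0 0 0) ?mul0r ?eqxx //.
apply: pE => [i le_ie|k lt_ek]; rewrite /secant_map /= inordK //=.
  rewrite inE // le_ie linrec_meval !zE meval1; apply: linE => //; last by rewrite mulr1.
  by rewrite mulr0.
by rewrite leqNgt lt_ek meval0.
Qed.

Notation X2 i := ('X_(inord i : 'I_2) : {mpoly K[2]}).

(** The three standard charts of the plane that contains a conic. *)
Definition plane_map (t : 'I_3) (k : 'I_n.+1) : {mpoly K[2]} :=
  if (k <= 2)%N then (if k == t :> nat then 1 else X2 (unbump t k)) else 0.

Lemma plane_mapP p : e = 2 -> (exists k, p k != 0) ->
  (forall j, (2 < j <= n)%N -> p (inord j) = 0) ->
  exists t w z, w != 0 /\ forall k, p k = w * (plane_map t k).@[z].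
Proof.
move=> e2 [k0 k0N0] pj0.
have lt_k0 : (k0 < 3)%N.
  rewrite ltnNge; apply: contra k0N0 => lt_k.
  by rewrite -[k0]inord_val pj0 // lt_k -ltnS ltn_ord.
exists (Ordinal lt_k0), (p k0), (fun i => p (inord (bump k0 i)) / p k0); split=> // k.
rewrite /plane_map /=; case: leqP => [le_k2|lt_2k]; last first.
  by rewrite meval0 mulr0 -[k]inord_val pj0 // lt_2k -ltnS ltn_ord.
case: eqP => [/val_inj->|/eqP neq]; first by rewrite meval1 mulr1.
rewrite mevalXU inordK; last by rewrite /unbump; lia.
by rewrite unbumpKcond (negbTE neq) inord_val mulrC divfK.
Qed.

Lemma off_curve p : (exists k, p k != 0) -> ~ on_rnc e p ->
  (forall j, (e < j <= n)%N -> p (inord j) = 0) ->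
  exists i a b, [/\ (i <= n)%N, p (inord i) != 0, (a < e)%N, (b < e)%N
    & (minor a b).@[p] != 0].
Proof.
move=> pN0 offC pj0; have [k kN0] := pN0.
have [/existsP[a /existsP[b abN0]]|none] :=
    boolP [exists a : 'I_e, exists b : 'I_e, (minor a b).@[p] != 0].
  exists k, a, b; split=> //; first by rewrite -ltnS ltn_ord.
  by rewrite inord_val.
case: offC; apply: (on_rncP e_ge2 pN0 pj0) => a b lt_ae lt_be.
move/existsPn/(_ (Ordinal lt_ae)): none => /existsPn/(_ (Ordinal lt_be)).
by rewrite negbK => /eqP.
Qed.

(** For [d >= 5] there is no such direction [v] off the curve. For [d = 4] and
    a conic, [p] lies in a plane, and the gradients have rank at least three
    there: two transverse directions and one from the equation of the conic.
    For [d = 4] and [e >= 3], [p] lies on a secant or a tangent, so it depends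
    on three parameters, and the kernel is at most a line, so that the rank is
    at least [n >= 4]. *)
Lemma degenerate_avoid : exists2 P : {mpoly K[#|{: option sq_index}|]}, P != 0 &
  forall lam p v, singular_at member lam p -> (exists k, p k != 0) -> ~ on_rnc e p ->
    in_kernel member p v -> (exists k, v k != 0) ->
    P.@[fun i => lam (enum_val i)] = 0.
Proof.
have d_gt0 : (0 < d)%N by apply: leq_trans d_ge4.
have span p v : (exists k, p k != 0) -> ~ on_rnc e p -> in_kernel member p v ->
    (exists k, v k != 0) -> (forall j, (e < j <= n)%N -> p (inord j) = 0).
  move=> pN0 offC ker [k kN0] j lt_ej; apply/eqP/negPn/negP => pjN0.
  by move: kN0; rewrite (kernel_off_span charK e_ge2 e_len d_ge4 (member_kernel ker) lt_ej pjN0) eqxx.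
have [d5|d_lt5] := leqP 5 d.
  exists 1; first exact: oner_neq0.
  move=> lam p v _ pN0 offC ker vN0; have pj0 := span p v pN0 offC ker vN0.
  have [i [a [b [le_in piN0 lt_ae lt_be MN0]]]] := off_curve pN0 offC pj0.
  have [k kN0] := vN0; move: kN0.
  by rewrite (kernel_degree5 charK e_ge2 e_len d_ge4 (member_kernel ker) le_in piN0 lt_ae lt_be MN0 d5) eqxx.
have d4 : d = 4 by lia.
have n4 : (4 <= n)%N by move: big; rewrite d4.
have [e2|e_neq2] := eqVneq e 2.
  have /fin_all_exists2[P PN0 PE] t :=
    stratum_avoid member_homog (plane_map t) d_gt0 (ltnSn 2).
  exists (\prod_t P t); first by apply/prodf_neq0 => t _; apply: PN0.
  move=> lam p v sing pN0 offC ker vN0; have pj0 := span p v pN0 offC ker vN0.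
  have [i [a [b [le_in piN0 lt_ae lt_be MN0]]]] := off_curve pN0 offC pj0.
  have pj0' : forall j, (2 < j <= n)%N -> p (inord j) = 0 by move=> j hj; apply: pj0; rewrite e2.
  have [t [w [z [wN0 pE]]]] := plane_mapP e2 pN0 pj0'.
  rewrite rmorph_prod /=; apply/eqP/prodf_eq0; exists t => //; apply/eqP.
  apply: (PE t lam p sing); first by exists w, z.
  (* The conic is smooth, so one of the three partial derivatives of [x0 x2 -
     x1 ^ 2] is nonzero at [p]. *)
  have [i' lt_i' gN0] : exists2 i', (i' <= 2)%N &
      forall u : nat -> K, (forall l, (l <= 2)%N -> l != i' -> u l = 0) ->
      u 0%N * p (inord 2) + p (inord 0) * u 2 - 2%:R * (p (inord 1) * u 1%N) = 0 -> u i' = 0.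
    have [p0|p0N0] := eqVneq (p (inord 0)) 0; last first.
      exists 2 => // u h; rewrite (h 0%N) // (h 1%N) // mul0r !mulr0 subr0 add0r.
      by move/eqP; rewrite mulf_eq0 (negbTE p0N0) => /eqP.
    have [p2|p2N0] := eqVneq (p (inord 2)) 0; last first.
      exists 0%N => // u h; rewrite (h 1%N) // (h 2) // !mulr0 subr0 addr0.
      by move/eqP; rewrite mulf_eq0 (negbTE p2N0) orbF => /eqP.
    have [p1|p1N0] := eqVneq (p (inord 1)) 0; last first.
      exists 1%N => // u h; rewrite (h 0%N) // (h 2) // mul0r mulr0 addr0 sub0r => /eqP.
      by rewrite oppr_eq0 !mulf_eq0 (negbTE two) (negbTE p1N0) => /eqP.
    have [k kN0] := pN0; case/eqP: kN0; rewrite -[k]inord_val.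
    case: k => [[|[|[|k]]] lt_k] //=; rewrite ?p0 ?p1 ?p2 //.
    by apply: pj0'; rewrite /= -ltnS.
  pose S (l : 'I_3) : 'I_n.+1 := inord (nth 0%N [:: i'; 3; 4] l).
  have Sle (l : 'I_3) : (nth 0%N [:: i'; 3; 4] l < n.+1)%N.
    by case: l => [[|[|[|l]]] lt_l] //=; lia.
  exists S.
    move=> l l' /(congr1 val); rewrite /= !inordK //.
    by case: l l' => [[|[|[|l]]] hl] [[|[|[|l']]] hl'] //= h; apply: val_inj => //=; lia.
  move=> u uker uS k.
  have Vj := kernel_normal e_len (member_kernel uker) pj0 le_in piN0 lt_ae lt_be MN0.
  have M := kernel_degree4 charK e_ge2 e_len d_ge4 (member_kernel uker) le_in piN0 lt_ae lt_be MN0 d4.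
  have u0 l : (l <= 2)%N -> l != i' -> u (inord l) = 0.
    move=> le_l2 neq; apply: uS; apply/codomP => -[[[|[|[|x]]] lt_x]] //;
      move/(congr1 val); rewrite /S /= !inordK; move: neq; lia.
  have ui' : u (inord i') = 0.
    apply: (gN0 (fun l => u (inord l)) u0).
    have := M 0%N 1%N; rewrite e2 dirderiv_minor => /(_ isT isT) E.
    by rewrite -[RHS]E; ring.
  rewrite -[k]inord_val; have [le_k2|lt_2k] := leqP k 2.
    by have [->|] := eqVneq (val k) i'; [|exact: u0].
  by apply: Vj; rewrite e2 lt_2k -ltnS ltn_ord.
have e3 : (3 <= e)%N by lia.
have /fin_all_exists2[P PN0 PE] t :=
  stratum_avoid member_homog (secant_map t) d_gt0 (ltnSn 3).
exists (\prod_t P t); first by apply/prodf_neq0 => t _; apply: PN0.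
move=> lam p v sing pN0 offC ker vN0; have pj0 := span p v pN0 offC ker vN0.
have [i [a [b [le_in piN0 lt_ae lt_be MN0]]]] := off_curve pN0 offC pj0.
pose V (u : 'I_n.+1 -> K) l := u (inord l).
have kernelE u : in_kernel member p u -> exists a b c,
    (forall l, (l < e)%N -> V u l = a * V p l + b * V p l.+1 /\ V u l.+1 = c * V p l - a * V p l.+1)
    /\ (forall j, (e < j <= n)%N -> V u j = 0).
  move=> uker.
  have M := kernel_degree4 charK e_ge2 e_len d_ge4 (member_kernel uker) le_in piN0 lt_ae lt_be MN0 d4.
  have Vj := kernel_normal e_len (member_kernel uker) pj0 le_in piN0 lt_ae lt_be MN0.
  have := @polar_kernel _ e (V p) a b lt_ae lt_be; rewrite -meval_minor => /(_ MN0 (V u)) [].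
    by move=> l l' hl hl'; rewrite -dirderiv_minor M.
  by move=> a' [b' [c' h]]; exists a', b', c'; split.
have [a1 [b1 [c1 [E1 N1]]]] := kernelE v ker.
have rec1 l : (l.+1 < e)%N -> c1 * V p l - a1 * V p l.+1 = a1 * V p l.+1 + b1 * V p l.+2.
  by move=> lt_l; have [_ <-] := E1 l (ltnW lt_l); have [<- _] := E1 l.+1 lt_l.
have zeroV u (a' b' c' : K) : a' = 0 -> b' = 0 -> c' = 0 ->
    (forall l, (l < e)%N -> V u l = a' * V p l + b' * V p l.+1 /\ V u l.+1 = c' * V p l - a' * V p l.+1) ->
    (forall j, (e < j <= n)%N -> V u j = 0) -> forall k, u k = 0.
  move=> -> -> -> E N k; rewrite -[k]inord_val; have [lt_ke|] := ltnP k e.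
    by have [h _] := E k lt_ke; rewrite -/(V u k) h !mul0r addr0.
  rewrite leq_eqVlt => /predU1P[ek|lt_ek]; last by apply: N; rewrite lt_ek -ltnS ltn_ord.
  have [_ h] := E e.-1 ltac:(lia); rewrite -ek -/(V u e) (_ : e = e.-1.+1); last by lia.
  by rewrite h !mul0r subr0.
have T1 : ~ [/\ a1 = 0, b1 = 0 & c1 = 0].
  by move=> [h1 h2 h3]; have [k /eqP[]] := vN0; apply: zeroV h1 h2 h3 E1 N1 k.
have [t [w [z [wN0 pE]]]] := secant_mapP pN0 pj0 T1 rec1.
rewrite rmorph_prod /=; apply/eqP/prodf_eq0; exists t => //; apply/eqP.
apply: (PE t lam p sing); first by exists w, z.
have [k0 k0N0] := vN0.
(* The kernel is spanned by [v], so the rows other than [k0] are independent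
   when [v k0] is nonzero. *)
exists (fun l : 'I_4 => lift k0 (widen_ord n4 l)).
  by move=> l l' /lift_inj/(congr1 val) /= h; apply: val_inj.
move=> u uker uS; have [a2 [b2 [c2 [E2 N2]]]] := kernelE u uker.
have rec2 l : (l.+1 < e)%N -> c2 * V p l - a2 * V p l.+1 = a2 * V p l.+1 + b2 * V p l.+2.
  by move=> lt_l; have [_ <-] := E2 l (ltnW lt_l); have [<- _] := E2 l.+1 lt_l.
have MN0' := MN0; rewrite meval_minor in MN0'.
have [ab ac bc] := polar_kernel_line lt_ae lt_be MN0' e3 two rec1 rec2.
have uk0 : u k0 = 0 by apply: uS; apply/codomP => -[l] /eqP; rewrite (negbTE (neq_lift _ _)).
have par : forall x1 x2, (a1 * x2 = a2 * x1 -> b1 * x2 = b2 * x1 -> c1 * x2 = c2 * x1 ->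
    forall k, x1 * u k = x2 * v k).
  move=> x1 x2 h1 h2 h3 k; rewrite -[k]inord_val; have [lt_ke|] := ltnP k e.
    have [g1 _] := E1 k lt_ke; have [g2 _] := E2 k lt_ke.
    rewrite -/(V u k) -/(V v k) g1 g2.
    transitivity ((a2 * x1) * V p k + (b2 * x1) * V p k.+1); first by ring.
    by rewrite -h1 -h2; ring.
  rewrite leq_eqVlt => /predU1P[ek|lt_ek].
    have lt_e1 : (e.-1 < e)%N by lia.
    have [_ g1] := E1 e.-1 lt_e1; have [_ g2] := E2 e.-1 lt_e1.
    have eE : e.-1.+1 = e by lia.
    rewrite eE in g1 g2; rewrite -ek -/(V u e) -/(V v e) g1 g2.
    transitivity ((c2 * x1) * V p e.-1 - (a2 * x1) * V p e); first by ring.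
    by rewrite -h1 -h3; ring.
  by rewrite -/(V u k) -/(V v k) N1 ?N2 ?mulr0 // lt_ek -ltnS ltn_ord.
have conclude x1 x2 : x1 != 0 -> (forall k, x1 * u k = x2 * v k) -> forall k, u k = 0.
  move=> x1N0 h k; have := h k0; rewrite uk0 mulr0 => /esym/eqP.
  rewrite mulf_eq0 (negbTE k0N0) orbF => /eqP x20.
  by have := h k; rewrite x20 mul0r => /eqP; rewrite mulf_eq0 (negbTE x1N0) => /eqP.
have [a10|a1N0] := eqVneq a1 0; last first.
  apply: (conclude a1 a2 a1N0); apply: par; first by rewrite mulrC.
    by rewrite mulrC -ab mulrC.
  by rewrite mulrC -ac mulrC.
have [b10|b1N0] := eqVneq b1 0; last first.
  apply: (conclude b1 b2 b1N0); apply: par; [exact: ab|by rewrite mulrC|].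
  by rewrite mulrC -bc mulrC.
have [c10|c1N0] := eqVneq c1 0; last first.
  by apply: (conclude c1 c2 c1N0); apply: par; [exact: ac|exact: bc|rewrite mulrC].
by case: T1.
Qed.

(** A general linear combination of [F0] and of the system has no singular
    point off the curve, because the coefficients of the singular ones satisfy
    a fixed equation; it is scaled to have coefficient one at [F0], so it has
    the class of [F0]. *)
Lemma smooth_member : exists G : {mpoly K[n.+1]},
  [/\ G \is d.-homog, (pb F0 = 0 -> pb G = 0),
      (forall f, hasclass e F0 f -> hasclass e G f) &
      forall p, (exists k, p k != 0) -> ~ on_rnc e p -> exists k, (G^`M(k)).@[p] != 0].
Proof.
have d_gt0 : (0 < d)%N by apply: leq_trans d_ge4.
have [P1 P1N0 P1E] := full_rank_avoid member_homog d_gt0.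
have [P2 P2N0 P2E] := degenerate_avoid.
pose None' : option sq_index := None.
have [|w] := @mpoly_nonroot _ charK _ (P1 * P2 * 'X_(enum_rank None')).
  by rewrite !mulf_neq0 // -msupp_eq0 msuppX.
rewrite !mevalM mevalXU !mulf_eq0 !negb_or => /andP[/andP[w1 w2] w0].
pose lam x := w (enum_rank x).
have lamE P : P.@[fun i => lam (enum_val i)] = P.@[w].
  by apply: meval_eq => i; rewrite /lam enum_valK.
pose c := (lam None')^-1.
have cN0 : c != 0 by rewrite invr_eq0.
pose G := \sum_x (c * lam x) *: member x.
have GE : G = F0 + \sum_y (c * lam (Some y)) *: member (Some y).
  rewrite /G (bigD1 None') //= mulVf // scale1r; congr (_ + _).
  rewrite (reindex_omap Some id) /=; last by case.
  by apply: eq_bigl => y; rewrite eqxx.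
exists G; split.
- by apply: rpred_sum => x _; apply: rpredZ; apply: member_homog.
- move=> F00; rewrite GE rmorphD /= F00 add0r rmorph_sum big1 // => -[[[[c' i] j] a] b] _.
  by rewrite -mul_mpolyC rmorphM /= (proj2 (sqform_class K d e_ge2 e_len c' i j a b)) mulr0.
- move=> f hf; rewrite GE.
  have hs : hasclass e (\sum_y (c * lam (Some y)) *: member (Some y))
      (fun l => \sum_(y : sq_index) 0).
    apply: hasclass_sum => // -[[[[c' i] j] a] b] _.
    rewrite -mul_mpolyC; apply: (hasclass_ext e_ge2 e_len
      (_ : forall l, (l < n.-1)%N -> pb (c * lam (Some (c', i, j, a, b)))%:MP * 0 = 0)).
      by move=> l _; rewrite mulr0.
    have [h0 p0] := sqform_class K d e_ge2 e_len c' i j a b.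
    exact: hasclassM p0 h0.
  apply: (hasclass_ext e_ge2 e_len) (hasclassD hf hs) => l _.
  by rewrite big1 ?addr0.
move=> p pN0 offC; apply/existsP; apply: contra_notT offC => /existsPn sing.
have singp : singular_at member lam p.
  move=> k; apply: (mulfI cN0); rewrite mulr0; have /negPn/eqP := sing k.
  rewrite /G (raddf_sum (mderiv k)) (raddf_sum (meval p)) /= mulr_sumr => E; rewrite -[RHS]E.
  by apply: eq_bigr => x _; rewrite mderivZ mevalZ mulrA.
have [onC|offC] := classic (on_rnc e p); first exact: onC.
have [[v [ker vN0]]|none] := classic (exists v, in_kernel member p v /\ exists k, v k != 0).
  by case/eqP: w2; rewrite -lamE; apply: P2E singp pN0 offC ker vN0.
case/eqP: w1; rewrite -lamE; apply: (P1E lam p singp pN0) => v ker k.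
by apply/eqP/negPn/negP => kN0; case: none; exists v; split=> //; exists k.
Qed.

End SmoothMember.

(** * Quartic surfaces *)

Section QuarticSurfaces.

Variable K : closedFieldType.
Hypothesis charK : [pchar K] =i pred0.

Notation xv := (@xv K 3).
Notation minor := (@minor K 3).
Notation s := ('X_ord0 : {mpoly K[2]}).
Notation t := ('X_ord_max : {mpoly K[2]}).
Implicit Types p : 'I_4 -> K.

Let nz j : j.+1%:R != 0 :> K.
Proof. by move/pcharf0P: charK => ->. Qed.

Let sqr0 (x : K) : x ^+ 2 = 0 -> x = 0.
Proof. by move/eqP; rewrite expf_eq0 => /eqP. Qed.

Let cub0 (x : K) : x ^+ 3 = 0 -> x = 0.
Proof. by move/eqP; rewrite expf_eq0 => /eqP. Qed.

Let cancel0 (x y : K) : x != 0 -> x * y = 0 -> y = 0.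
Proof. by move=> xN0 /eqP; rewrite mulf_eq0 (negbTE xN0) => /eqP. Qed.

Section Twisted.

Variables a b g dd : K.
Let A := a * g - b * b.
Let B := b * dd - g * g.
Let P := a ^+ 2 + 2%:R * A.
Let Q := dd ^+ 2 + 2%:R * B.

(** With [P = a^2 + 2 A] and [Q = d^2 + 2 B], where [d] stands for [dd], the
    Euler-type combinations [(a + g) P = a^3] and [(b + d) Q = d^3] lead, with
    the second and the third equation, to a contradiction or to the origin if
    [a], [d], [P] or [Q] is zero. Otherwise the second and the third equation
    give [a d = 4 b g]; with [a = 1] the remaining equations in [x = g] and [u
    = b^2] are [2 u (1 + x) = 3 x + 2 x^2], [u (24 x + 4) = x + 4 x^2] and the
    third one. Eliminating [u] from the first two gives [4 x^2 + 7 x + 1 = 0],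
    whence [u = -1/4], and then the third equation gives [x = -1/5], which is
    not a root. *)
Lemma twisted_quartic_smooth :
  g * P + 2%:R * a * A = 0 -> dd * Q - 2%:R * b * P = 0 ->
  a * P - 2%:R * g * Q = 0 -> b * Q + 2%:R * dd * B = 0 ->
  [/\ a = 0, b = 0, g = 0 & dd = 0].
Proof.
move=> E0 E1 E2 E3.
have Ea : (a + g) * P - a ^+ 3 = 0 by rewrite -[RHS]E0 /P; ring.
have Ed : (b + dd) * Q - dd ^+ 3 = 0 by rewrite -[RHS]E3 /Q; ring.
have [P0|PN0] := eqVneq P 0.
  have a0 : a = 0 by apply: cub0; rewrite -[RHS]oppr0 -[in RHS]Ea P0; ring.
  have [Q0|QN0] := eqVneq Q 0.
    have d0 : dd = 0 by apply: cub0; rewrite -[RHS]oppr0 -[in RHS]Ed Q0; ring.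
    have b0 : b = 0.
      by apply: sqr0; apply: (cancel0 (nz 1)); rewrite -[RHS]oppr0 -[in RHS]P0 /P /A a0; ring.
    have g0 : g = 0.
      by apply: sqr0; apply: (cancel0 (nz 1)); rewrite -[RHS]oppr0 -[in RHS]Q0 /Q /B d0; ring.
    by [].
  have d0 : dd = 0 by apply: (cancel0 QN0); rewrite mulrC -[RHS]E1 P0; ring.
  have g0 : g = 0.
    apply: (cancel0 (nz 1)); apply: (cancel0 QN0); rewrite -[RHS]oppr0 -[in RHS]E2 P0; ring.
  have b0 : b = 0.
    by apply: sqr0; apply: (cancel0 (nz 1)); rewrite -[RHS]oppr0 -[in RHS]P0 /P /A a0; ring.
  by case/eqP: QN0; rewrite /Q /B b0 g0 d0; ring.
have [Q0|QN0] := eqVneq Q 0.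
  have d0 : dd = 0 by apply: cub0; rewrite -[RHS]oppr0 -[in RHS]Ed Q0; ring.
  have b0 : b = 0.
    apply: (cancel0 (nz 1)); apply: (cancel0 PN0); rewrite -[RHS]oppr0 -[in RHS]E1 Q0; ring.
  have a0 : a = 0 by apply: (cancel0 PN0); rewrite -[RHS]E2 Q0; ring.
  by case/eqP: PN0; rewrite /P /A a0 b0; ring.
have [a0|aN0] := eqVneq a 0.
  have g0 : g = 0 by apply: (cancel0 PN0); rewrite -[RHS]Ea a0; ring.
  have bd : b * (dd * (3%:R * dd + 2%:R * b)) = 0.
    by rewrite -[RHS]Ed /Q /B g0; ring.
  have bN0 : b != 0 by apply: contraNneq PN0 => b0; rewrite /P /A a0 b0; apply/eqP; ring.
  have E1' : dd ^+ 3 + 2%:R * b * dd ^+ 2 + 4%:R * b ^+ 3 = 0.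
    by rewrite -[RHS]E1 /P /Q /A /B a0 g0; ring.
  case/eqP: (bN0); move/(cancel0 bN0)/eqP: bd; rewrite mulf_eq0 => /orP[/eqP d0|/eqP db].
    by apply: cub0; apply: (cancel0 (nz 3)); rewrite -[RHS]E1' d0; ring.
  have d0 : dd = 0.
    apply: cub0; apply: (cancel0 (nz 30)).
    transitivity ((3%:R * dd + 2%:R * b) * (4%:R * b ^+ 2 - 6%:R * b * dd + 11%:R * dd ^+ 2)
       - 2%:R * (dd ^+ 3 + 2%:R * b * dd ^+ 2 + 4%:R * b ^+ 3)); first by ring.
    by rewrite db E1'; ring.
  by apply: (cancel0 (nz 1)); rewrite -[RHS]db d0; ring.
have [d0|dN0] := eqVneq dd 0.
  have b0 : b = 0 by apply: (cancel0 QN0); rewrite -[RHS]Ed d0; ring.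
  have ag : a * (g * (3%:R * a + 2%:R * g)) = 0.
    by rewrite -[RHS]Ea /P /A b0; ring.
  have E2' : a ^+ 3 + 2%:R * g * a ^+ 2 + 4%:R * g ^+ 3 = 0.
    by rewrite -[RHS]E2 /P /Q /A /B d0 b0; ring.
  have gN0 : g != 0 by apply: contraNneq QN0 => g0; rewrite /Q /B d0 b0 g0; apply/eqP; ring.
  case/eqP: (aN0); have db := cancel0 gN0 (cancel0 aN0 ag).
  apply: cub0; apply: (cancel0 (nz 30)).
  transitivity ((3%:R * a + 2%:R * g) * (4%:R * g ^+ 2 - 6%:R * g * a + 11%:R * a ^+ 2)
     - 2%:R * (a ^+ 3 + 2%:R * g * a ^+ 2 + 4%:R * g ^+ 3)); first by ring.
  by rewrite db E2'; ring.
have Ebg : a * dd - 4%:R * b * g = 0.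
  apply: (cancel0 PN0); apply: (cancel0 QN0).
  transitivity (dd * Q * (a * P - 2%:R * g * Q) + 2%:R * g * Q * (dd * Q - 2%:R * b * P));
    first by ring.
  by rewrite E1 E2; ring.
pose x := g / a; pose y := b / a; pose z := dd / a.
have [gE [bE dE]] : g = x * a /\ b = y * a /\ dd = z * a.
  by rewrite /x /y /z !divfK.
have a3N0 : a ^+ 3 != 0 by rewrite expf_neq0.
have zE : z = 4%:R * y * x.
  apply/eqP; rewrite -subr_eq0; apply/eqP; apply: (cancel0 (expf_neq0 2 aN0)).
  by rewrite -[RHS]Ebg gE bE dE; ring.
have F1 : (1 + x) * (1 + 2%:R * x - 2%:R * y ^+ 2) - 1 = 0.
  by apply: (cancel0 a3N0); rewrite -[RHS]Ea /P /A gE bE; ring.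
have F2 : (y + z) * (z ^+ 2 + 2%:R * y * z - 2%:R * x ^+ 2) - z ^+ 3 = 0.
  by apply: (cancel0 a3N0); rewrite -[RHS]Ed /Q /B gE bE dE; ring.
have F3 : 1 + 2%:R * x - 2%:R * y ^+ 2 - 2%:R * x * (z ^+ 2 + 2%:R * y * z - 2%:R * x ^+ 2) = 0.
  by apply: (cancel0 a3N0); rewrite -[RHS]E2 /P /Q /A /B gE bE dE; ring.
have zN0 : z != 0 by rewrite /z mulf_neq0 ?invr_eq0.
have [yN0 xN0] : y != 0 /\ x != 0.
  by move: zN0; rewrite zE !mulf_eq0 !negb_or => /andP[/andP[_ ->] ->].
rewrite zE in F2 F3.
pose u := y ^+ 2.
have G1 : 2%:R * u * (1 + x) - 3%:R * x - 2%:R * x ^+ 2 = 0.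
  by rewrite -[RHS]oppr0 -[in RHS]F1 /u; ring.
have G2 : u * (24%:R * x + 4%:R) - x - 4%:R * x ^+ 2 = 0.
  apply: (cancel0 (nz 1)); apply: (cancel0 yN0); apply: (cancel0 xN0).
  by rewrite -[RHS]F2 /u; ring.
have G3 : 4%:R * x ^+ 2 + 7%:R * x + 1 = 0.
  apply: (cancel0 (nz 9)); apply: (cancel0 xN0).
  transitivity (2%:R * (1 + x) * (u * (24%:R * x + 4%:R) - x - 4%:R * x ^+ 2)
    - (24%:R * x + 4%:R) * (2%:R * u * (1 + x) - 3%:R * x - 2%:R * x ^+ 2)); first by ring.
  by rewrite G1 G2; ring.
have xN6 : 6%:R * x + 1 != 0.
  apply/eqP => h; move/eqP: (nz 1); apply.
  transitivity (4%:R * (6%:R * x + 1) ^+ 2 + 34%:R * (6%:R * x + 1)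
    - 36%:R * (4%:R * x ^+ 2 + 7%:R * x + 1)); first by ring.
  by rewrite h G3; ring.
have uE : 4%:R * u + 1 = 0.
  apply: (cancel0 xN6).
  transitivity (u * (24%:R * x + 4%:R) - x - 4%:R * x ^+ 2
    + (4%:R * x ^+ 2 + 7%:R * x + 1)); first by ring.
  by rewrite G2 G3 addr0.
(* The third equation with [u = - 1 / 4], reduced modulo [4 x ^ 2 + 7 x + 1].
   *)
have x5 : 5%:R * x + 1 = 0.
  apply: (cancel0 (nz 22)).
  transitivity (4%:R * (1 + 2%:R * x - 2%:R * y ^+ 2
      - 2%:R * x * ((4%:R * y * x) ^+ 2 + 2%:R * y * (4%:R * y * x) - 2%:R * x ^+ 2))
    + 2%:R * (1 + 16%:R * x ^+ 3 + 8%:R * x ^+ 2) * (4%:R * u + 1)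
    + (17%:R - 12%:R * x) * (4%:R * x ^+ 2 + 7%:R * x + 1)
    ); first by rewrite /u; ring.
  by rewrite F3 uE G3; ring.
(* A Bezout identity between the two polynomials in [x] found above. *)
case/eqP: (nz 5).
transitivity (- 25%:R * (4%:R * x ^+ 2 + 7%:R * x + 1) + (20%:R * x + 31%:R) * (5%:R * x + 1));
  first by ring.
by rewrite G3 x5; ring.
Qed.

End Twisted.

Let vec (v0 v1 v2 v3 : K) (k : 'I_4) : K := nth 0 [:: v0; v1; v2; v3] k.

Let vecE v0 v1 v2 v3 : (vec v0 v1 v2 v3 (inord 0) = v0)
  * (vec v0 v1 v2 v3 (inord 1) = v1) * (vec v0 v1 v2 v3 (inord 2) = v2)
  * (vec v0 v1 v2 v3 (inord 3) = v3).
Proof. by rewrite /vec !inordK. Qed.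

Let all0 p : [/\ p (inord 0) = 0, p (inord 1) = 0, p (inord 2) = 0 & p (inord 3) = 0] ->
  forall k, p k = 0.
Proof.
by case=> h0 h1 h2 h3 k; rewrite -[k]inord_val; case: k => [[|[|[|[|k]]]] lt_k].
Qed.

Let unit_values (c0 c1 c2 c3 : K) :
  (forall v0 v1 v2 v3, v0 * c0 + v1 * c1 + v2 * c2 + v3 * c3 = 0) ->
  [/\ c0 = 0, c1 = 0, c2 = 0 & c3 = 0].
Proof.
by move=> h; split; [rewrite -[RHS](h 1 0 0 0)|rewrite -[RHS](h 0 1 0 0)
  |rewrite -[RHS](h 0 0 1 0)|rewrite -[RHS](h 0 0 0 1)]; ring.
Qed.

Let pbM0 e (x a : {mpoly K[4]}) : rnc_pullback e a = 0 -> rnc_pullback e (x * a) = 0.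
Proof. by move=> a0; rewrite rmorphM /= a0 mulr0. Qed.

Let pbD0 e (a b : {mpoly K[4]}) :
  rnc_pullback e a = 0 -> rnc_pullback e b = 0 -> rnc_pullback e (a + b) = 0.
Proof. by move=> a0 b0; rewrite rmorphD /= a0 b0 addr0. Qed.

(** The class of [minor 0 1] is [(s, 0)] and that of [minor 1 2] is [(0, t)];
    the squares of the minors do not change the class and remove the
    singularities off the curve. *)
Lemma twisted_quartic : exists G : {mpoly K[4]},
  [/\ G \is 4.-homog, rnc_pullback 3 G = 0,
      (forall f : nat -> {mpoly K[2]}, f 0%N = s ^+ 7 -> f 1%N = t ^+ 7 -> hasclass 3 G f) &
      forall p, (exists k, p k != 0) -> exists k, (G^`M(k)).@[p] != 0].
Proof.
pose A := minor 0 1; pose B := minor 1 2.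
have A0 : rnc_pullback 3 A = 0 by apply: pullback_minor.
have B0 : rnc_pullback 3 B = 0 by apply: pullback_minor.
pose G := xv 0 * xv 0 * A + xv 3 * xv 3 * B + A * A + B * B; exists G.
have hx i : xv i \is 1.-homog by exact: xv_homog.
have [hA hB] : A \is 2.-homog /\ B \is 2.-homog by split; exact: minor_homog.
split.
- by do 3?apply: rpredD; apply: (@dhomogM _ _ _ 2 _ 2) => //; apply: (@dhomogM _ _ _ 1 _ 1).
- by apply: (pbD0 (pbD0 (pbD0 (pbM0 _ A0) (pbM0 _ B0)) (pbM0 _ A0)) (pbM0 _ B0)).
- move=> f f0 f1.
  have cA := @hasclass_minor K 3 3 isT isT 0 1 isT isT.
  have cB := @hasclass_minor K 3 3 isT isT 1 2 isT isT.
  have hsq (a : {mpoly K[4]}) : rnc_pullback 3 a = 0 -> hasclass 3 (a * a) (fun=> 0 : {mpoly K[2]}).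
    by move=> a0; apply: hasclass_sqr0.
  have cG := (hasclassD (hasclassD (hasclassD (hasclassM (xv 0 * xv 0) A0 cA)
    (hasclassM (xv 3 * xv 3) B0 cB)) (hsq _ A0)) (hsq _ B0)).
  apply: (hasclass_ext _ _ _ cG) => //.
  move=> [|[|l]] // _; rewrite !rmorphM /= !pullback_xv // ?f0 ?f1 /=.
    by rewrite !expr0 ?expr1; ring.
  by rewrite !expr0 ?expr1; ring.
move=> p [k0 k0N0].
have [/existsP//|none] := boolP [exists k, (G^`M(k)).@[p] != 0].
have crit k : (G^`M(k)).@[p] = 0.
  by move/existsPn/(_ k): none; rewrite negbK => /eqP.
case/eqP: k0N0; apply: all0; set a := p _; set b := p _; set g := p _; set dd := p _.
have [|E0 E1 E2 E3] := unit_values (c0 := g * (a ^+ 2 + 2%:R * (a * g - b * b))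
      + 2%:R * a * (a * g - b * b))
    (c1 := dd * (dd ^+ 2 + 2%:R * (b * dd - g * g)) - 2%:R * b * (a ^+ 2 + 2%:R * (a * g - b * b)))
    (c2 := a * (a ^+ 2 + 2%:R * (a * g - b * b)) - 2%:R * g * (dd ^+ 2 + 2%:R * (b * dd - g * g)))
    (c3 := b * (dd ^+ 2 + 2%:R * (b * dd - g * g)) + 2%:R * dd * (b * dd - g * g)).
  move=> v0 v1 v2 v3; rewrite -[RHS](dirderiv_critical (vec v0 v1 v2 v3) crit).
  have dA := dirderiv_minor (vec v0 v1 v2 v3) 0 1 p; have dB := dirderiv_minor (vec v0 v1 v2 v3) 1 2 p.
  have eA := meval_minor 0 1 p; have eB := meval_minor 1 2 p.
  rewrite -/A in dA eA; rewrite -/B in dB eB; rewrite /G; clearbody A B.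
  rewrite !(dirderivD, dirderivM) dA dB !dirderiv_xv !mevalM eA eB !meval_xv !vecE.
  by rewrite -/a -/b -/g -/dd; ring.
exact: twisted_quartic_smooth.
Qed.

(** Outside the origin, the first three equations reduce to [p1 = 0], [p2 = -
    p0] and [p3 = 2/3 p0], up to points that the last equation excludes; it
    then becomes [5/27 p0 ^ 3 = 0]. *)
Lemma conic_quartic_smooth (lam p0 p1 p2 p3 : K) : 2%:R * lam = 3%:R ->
  let Q := p0 * p2 - p1 * p1 in
  2%:R * p0 * Q + p2 * (p0 ^+ 2 + 2%:R * lam * Q) = 0 ->
  - (2%:R * p1) * (p0 ^+ 2 + 2%:R * lam * Q) = 0 ->
  p0 ^+ 3 + 2%:R * lam * Q * p0 + 3%:R * p3 * p2 ^+ 2 = 0 ->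
  p2 ^+ 3 + 4%:R * p3 ^+ 3 = 0 ->
  [/\ p0 = 0, p1 = 0, p2 = 0 & p3 = 0].
Proof.
move=> lamE Q; rewrite lamE => E0 E1 E2 E3.
have [p10|p1N0] := eqVneq p1 0; last first.
  have T0 : p0 ^+ 2 + 3%:R * Q = 0.
    apply: (cancel0 p1N0); apply: (cancel0 (nz 1)); rewrite -[RHS]oppr0 -[in RHS]E1; ring.
  rewrite T0 mulr0 addr0 in E0.
  have p00 : p0 = 0.
    apply: cub0; apply: (cancel0 (nz 1)).
    transitivity (2%:R * p0 * (p0 ^+ 2 + 3%:R * Q) - 3%:R * (2%:R * p0 * Q)); first by ring.
    by rewrite T0 E0; ring.
  case/eqP: p1N0; apply: sqr0; apply: (cancel0 (nz 2)).
  by rewrite -[RHS]oppr0 -[in RHS]T0 /Q p00; ring.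
have QE : Q = p0 * p2 by rewrite /Q p10; ring.
rewrite QE in E0 E2.
have p3E : p2 = 0 -> p3 = 0.
  by move=> p20; apply: cub0; apply: (cancel0 (nz 3)); rewrite -[RHS]E3 p20; ring.
have [p20|p2N0] := eqVneq p2 0.
  split; rewrite ?p20 ?p3E //.
  by apply: cub0; rewrite -[RHS]E2 p20; ring.
have [p00|p0N0] := eqVneq p0 0.
  have p30 : p3 = 0.
    apply: (cancel0 (expf_neq0 2 p2N0)); apply: (cancel0 (nz 2)).
    by rewrite -[RHS]E2 p00; ring.
  by split=> //; apply: cub0; rewrite -[RHS]E3 p30; ring.
have p2E : p2 = - p0.
  apply/eqP; rewrite -addr_eq0; apply/eqP; apply: (cancel0 p0N0); apply: (cancel0 p2N0).
  by apply: (cancel0 (nz 2)); rewrite -[RHS]E0; ring.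
rewrite p2E in E2 E3.
have p3E' : 3%:R * p3 = 2%:R * p0.
  apply/eqP; rewrite -subr_eq0; apply/eqP; apply: (cancel0 (expf_neq0 2 p0N0)).
  by rewrite -[RHS]E2; ring.
case/eqP: (p0N0); apply: cub0; apply: (cancel0 (nz 4)).
have : (3%:R * p3) ^+ 3 = (2%:R * p0) ^+ 3 by rewrite p3E'.
move/eqP; rewrite -subr_eq0 => /eqP E4.
transitivity (27%:R * ((- p0) ^+ 3 + 4%:R * p3 ^+ 3)
   - 4%:R * ((3%:R * p3) ^+ 3 - (2%:R * p0) ^+ 3)); first by ring.
by rewrite E3 E4; ring.
Qed.

(** The first and the third term have the classes [(s ^+ 4, 0)] and [(0, t ^+
    6)]; the other two lie in the square of the ideal and remove the
    singularities off the curve. The coefficient [3 / 2] makes the critical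
    equations simple. *)
Lemma conic_quartic : exists G : {mpoly K[4]},
  [/\ G \is 4.-homog, rnc_pullback 2 G = 0,
      (forall f : nat -> {mpoly K[2]}, f 0%N = s ^+ 4 -> f 1%N = t ^+ 6 -> hasclass 2 G f) &
      forall p, (exists k, p k != 0) -> exists k, (G^`M(k)).@[p] != 0].
Proof.
pose A := minor 0 1; pose lam : K := 3%:R / 2%:R.
have lamE : 2%:R * lam = 3%:R by rewrite /lam mulrC divfK.
have A0 : rnc_pullback 2 A = 0 by apply: pullback_minor.
have X0 : rnc_pullback 2 (xv 3) = 0 by apply: pullback_xv0.
pose G := xv 0 * xv 0 * A + lam%:MP * A * A + xv 3 * (xv 2 * xv 2 * xv 2)
  + xv 3 * (xv 3 * xv 3 * xv 3).
exists G.
have hx i : xv i \is 1.-homog by exact: xv_homog.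
have hA : A \is 2.-homog by exact: minor_homog.
have hc (c : K) : c%:MP \is 0.-homog by rewrite -[c%:MP]mulr1 mul_mpolyC; apply: dhomogZ; exact: dhomog1.
split.
- do 3?apply: rpredD.
  + by apply: (@dhomogM _ _ _ 2 _ 2) => //; apply: (@dhomogM _ _ _ 1 _ 1).
  + by apply: (@dhomogM _ _ _ 2 _ 2) => //; apply: (@dhomogM _ _ _ 0 _ 2).
  + apply: (@dhomogM _ _ _ 1 _ 3) => //; apply: (@dhomogM _ _ _ 2 _ 1) => //.
    exact: (@dhomogM _ _ _ 1 _ 1).
  + apply: (@dhomogM _ _ _ 1 _ 3) => //; apply: (@dhomogM _ _ _ 2 _ 1) => //.
    exact: (@dhomogM _ _ _ 1 _ 1).
- apply: (pbD0 (pbD0 (pbD0 (pbM0 _ A0) (pbM0 _ A0)) _) _);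
    by rewrite mulrC; apply: pbM0.
- move=> f f0 f1.
  have cA := @hasclass_minor K 2 3 isT isT 0 1 isT isT.
  have cA0 : rnc_pullback 2 (lam%:MP * A) = 0 by apply: pbM0.
  have cQ : hasclass 2 (lam%:MP * A * A) (fun=> 0 : {mpoly K[2]}) by apply: hasclass_sqr0.
  have hX (p : {mpoly K[4]}) : hasclass 2 (xv 3 * p) (delta 1 (rnc_pullback 2 p)) by exact: hasclass_xv.
  have cG := (hasclassD (hasclassD (hasclassD (hasclassM (xv 0 * xv 0) A0 cA)
    cQ) (hX (xv 2 * xv 2 * xv 2))) (hX (xv 3 * xv 3 * xv 3))).
  apply: (hasclass_ext _ _ _ cG) => //.
  move=> [|[|l]] // _; rewrite !rmorphM /= ?X0 !pullback_xv // ?f0 ?f1 /delta /=.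
    by rewrite !expr0 ?expr1; ring.
  by rewrite !expr0 ?expr1; ring.
move=> p [k0 k0N0].
have [/existsP//|none] := boolP [exists k, (G^`M(k)).@[p] != 0].
have crit k : (G^`M(k)).@[p] = 0.
  by move/existsPn/(_ k): none; rewrite negbK => /eqP.
case/eqP: k0N0; apply: all0; set a := p _; set b := p _; set g := p _; set dd := p _.
have [|E0 E1 E2 E3] := unit_values
    (c0 := 2%:R * a * (a * g - b * b) + g * (a ^+ 2 + 2%:R * lam * (a * g - b * b)))
    (c1 := - (2%:R * b) * (a ^+ 2 + 2%:R * lam * (a * g - b * b)))
    (c2 := a ^+ 3 + 2%:R * lam * (a * g - b * b) * a + 3%:R * dd * g ^+ 2)
    (c3 := g ^+ 3 + 4%:R * dd ^+ 3).
  move=> v0 v1 v2 v3; rewrite -[RHS](dirderiv_critical (vec v0 v1 v2 v3) crit).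
  have dA := dirderiv_minor (vec v0 v1 v2 v3) 0 1 p; have eA := meval_minor 0 1 p.
  rewrite -/A in dA eA; rewrite /G; clearbody A.
  rewrite !(dirderivD, dirderivM) dA !dirderiv_xv dirderivC !mevalM mevalC eA !meval_xv !vecE.
  by rewrite -/a -/b -/g -/dd; ring.
exact: (conic_quartic_smooth lamE).
Qed.

End QuarticSurfaces.

(** * Hypersurfaces with prescribed normal bundle *)

Lemma smooth_quartic (K : closedFieldType) (charK : [pchar K] =i pred0) (e n : nat)
    (e_ge2 : (2 <= e)%N) (e_len : (e <= n)%N) (n3 : n = 3) (f : nat -> {mpoly K[2]}) :
  f 0%N = 'X_ord0 ^+ (4 * e - Ndeg e 0) -> f 1%N = 'X_ord_max ^+ (4 * e - Ndeg e 1) ->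
  exists G : {mpoly K[n.+1]},
  [/\ G \is 4.-homog, rnc_pullback e G = 0, hasclass e G f &
      forall x : 'I_n.+1 -> K, (exists k, x k != 0) -> exists k, (G^`M(k)).@[x] != 0].
Proof.
have [->|->] : e = 2 \/ e = 3 by lia.
- rewrite n3 => f0 f1; have [G [homG G0 clsG off]] := conic_quartic charK.
  by exists G; split=> //; apply: clsG.
rewrite n3 => f0 f1; have [G [homG G0 clsG off]] := twisted_quartic charK.
by exists G; split=> //; apply: clsG.
Qed.

Section MainTheorem.

Variables (K : closedFieldType) (e n d : nat).
Hypothesis charK : [pchar K] =i pred0.
Hypotheses (e_ge2 : (2 <= e)%N) (e_len : (e <= n)%N) (d_ge4 : (4 <= d)%N).
Notation pb := (@rnc_pullback K e n).

(** On the curve, the gradient does not vanish where some entry of the class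
    does not; off the curve this is the hypothesis. *)
Lemma smooth_of_class (G : {mpoly K[n.+1]}) (f : nat -> {mpoly K[2]}) l l' al be :
  G \is d.-homog -> hasclass e G f -> (l < n.-1)%N -> (l' < n.-1)%N ->
  f l = 'X_ord0 ^+ al -> f l' = 'X_ord_max ^+ be ->
  (forall p, (exists k, p k != 0) -> ~ on_rnc e p -> exists k, (G^`M(k)).@[p] != 0) ->
  smooth_hypersurface d G.
Proof.
move=> homG clsG lt_l lt_l' fl fl' off.
have grad p : (exists k, p k != 0) -> exists k, (G^`M(k)).@[p] != 0.
  move=> pN0; have [[c [u [w [cN0 uwN0 pE]]]]|] := excluded_middle_informative (on_rnc e p);
    last exact: off.
  have [k kN0] : exists k, (G^`M(k)).@[rnc e u w] != 0.
    have [u0|uN0] := eqVneq u 0.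
      have wN0 : w != 0 by apply: contraNneq uwN0 => ->; rewrite u0.
      apply: (hasclass_grad_neq0 e_ge2 e_len clsG uwN0 lt_l').
      by rewrite fl' rmorphXn /= mevalXU expf_neq0.
    apply: (hasclass_grad_neq0 e_ge2 e_len clsG uwN0 lt_l).
    by rewrite fl rmorphXn /= mevalXU expf_neq0.
  exists k; rewrite (meval_eq _ pE) (meval_homog (c := d.-1)) ?mulf_neq0 ?expf_neq0 //.
  by apply: mderiv_homog; rewrite prednK //; lia.
split=> //; last by move=> p pN0 _; apply: grad.
have [|k] := grad (fun=> 1); first by exists ord0; apply: oner_neq0.
by apply: contraNneq => ->; rewrite mderiv0 meval0.
Qed.

(** The splitting type is encoded by the differences [p] between the degrees of
    its summands and those of the next summand of the normal bundle in P^n. The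
    exponents [al] and [be] of the class of the hypersurface are the partial sums
    of these and of the analogous differences [q], from the right and from the
    left. *)
Variables (ks : seq int) (l0 : nat) (p : nat -> nat).
Notation N := (size ks).
Hypotheses (n1E : n.-1 = N.+1) (l0_leN : (l0 <= N)%N).
Hypotheses (n_ge3 : (3 <= n)%N) (l0_small : (4 <= n)%N || (l0 == 0%N)).
Hypothesis k_triv : forall l, (l < l0)%N -> nth 0 ks l = (Ndeg e l)%:Z.
Hypothesis pE : forall l, (l0 <= l < N)%N -> (Ndeg e l.+1)%:Z = nth 0 ks l + (p l)%:Z.
Hypothesis sum_p : (\sum_(l0 <= i < N) p i + Ndeg e l0 = d * e)%N.

Let q l := (p l + (Ndeg e l - Ndeg e l.+1))%N.
Let be l := (\sum_(l0 <= i < l) q i)%N.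
Let al l := (\sum_(l <= i < N) p i)%N.

Let NdegS l : (Ndeg e l.+1 <= Ndeg e l)%N.
Proof. by rewrite /Ndeg; do 2!case: ifP; lia. Qed.

Let qE l : (l0 <= l < N)%N -> (Ndeg e l)%:Z = nth 0 ks l + (q l)%:Z.
Proof. by move/pE; have := NdegS l; rewrite /q; lia. Qed.

Let beS l : (l0 <= l < N)%N -> be l.+1 = (be l + q l)%N.
Proof. by case/andP=> le_l _; rewrite /be big_nat_recr. Qed.

Let alS l : (l0 <= l < N)%N -> al l = (al l.+1 + p l)%N.
Proof. by case/andP=> _ lt_l; rewrite /al big_ltn // addnC. Qed.

(** From [l] to [l.+1], [al] loses [p l] and [be] gains [q l], which differ by
    [Ndeg e l - Ndeg e l.+1]; so all entries of the class have the degree of a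
    map from the normal bundle to O(d e). *)
Let albe l : (l0 <= l <= N)%N -> (al l + be l + Ndeg e l = d * e)%N.
Proof.
have base : (al l0 + be l0 + Ndeg e l0 = d * e)%N.
  by rewrite /be [X in (_ + X + _)%N]big_geq // addn0.
elim: l => [|l IHl] /andP[le_l lt_l].
  by move: base; rewrite (_ : l0 = 0%N) //; apply/eqP; rewrite -leqn0.
move: le_l; rewrite leq_eqVlt => /predU1P[<- //|le_l].
have h : (l0 <= l < N)%N by rewrite -ltnS le_l.
have := IHl _; rewrite -ltnS le_l ltnW // => /(_ isT) <-.
by rewrite (beS h) (alS h) /q; have := NdegS l; lia.
Qed.

(** The general construction leaves out quartic surfaces in P^3, for which the
    class is one of two possible ones and an explicit equation exists. *)
Lemma exists_smooth_class : exists G : {mpoly K[n.+1]},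
  [/\ G \is d.-homog, pb G = 0, hasclass e G (row K l0 al be) &
      forall x, (exists k, x k != 0) -> ~ on_rnc e x -> exists k, (G^`M(k)).@[x] != 0].
Proof.
have [big|small] := boolP ((5 <= d) || (4 <= n))%N.
  have [|l lt_l|F0 [homF0 F00 clsF0]] :=
      @lift_class K e n e_ge2 e_len d (row K l0 al be); first by lia.
    rewrite /row; case: ltnP => le_l; [by left|right].
    exists (al l), (be l); split=> //; rewrite -(@albe l); last by lia.
    by rewrite /Ndeg addn2.
  have [G [homG G0 clsG off]] := smooth_member charK e_ge2 e_len d_ge4 big homF0.
  by exists G; split=> //; [apply: G0|apply: clsG].
move: small; rewrite negb_or -!ltnNge => /andP[lt_d5 lt_n4].
have d4 : d = 4 by apply/eqP; rewrite eqn_leq d_ge4 andbT -ltnS.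
have n3 : n = 3 by apply/eqP; rewrite eqn_leq n_ge3 andbT -ltnS.
have l00 : l0 = 0%N by move: l0_small; rewrite leqNgt lt_n4 => /eqP.
have N1 : N = 1%N by move: n1E; rewrite n3 => -[].
have [al0 be1] : al 0%N = (4 * e - Ndeg e 0)%N /\ be 1%N = (4 * e - Ndeg e 1)%N.
  have al1 : al 1%N = 0%N by rewrite /al N1 big_geq.
  have be0 : be 0%N = 0%N by rewrite /be l00 big_geq.
  have := @albe 0%N; have := @albe 1%N.
  by rewrite d4 al1 be0 l00 N1 => /(_ isT) h1 /(_ isT) h0; lia.
have f0 : row K l0 al be 0 = 'X_ord0 ^+ al 0%N.
  by rewrite /row l00 /= /be l00 big_geq // expr0 mulr1.
have f1 : row K l0 al be 1 = 'X_ord_max ^+ be 1%N.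
  by rewrite /row l00 /= /al N1 big_geq // expr0 mul1r.
move: f0 f1; rewrite al0 be1 => f0 f1.
have [G [homG G0 clsG off]] := smooth_quartic charK e_ge2 e_len n3 f0 f1.
by exists G; rewrite d4; split=> // x xN0 _; apply: off.
Qed.

Lemma exists_hypersurface : exists F : {mpoly K[n.+1]},
  [/\ smooth_hypersurface d F, vanishes_on_rnc e F &
      isomorphic (normal_bundle e F) (split_bundle e n ks)].
Proof.
have [G [homG G0 clsG off]] := exists_smooth_class.
exists G; split.
- apply: (smooth_of_class (l := l0) (l' := N) (al := al l0) (be := be N) homG clsG); rewrite ?n1E //.
  + by rewrite /row ltnn /be big_geq // expr0 mulr1.
  + by rewrite /row ltnNge l0_leN /= /al big_geq // expr0 mul1r.
- by apply/vanishesP.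
exact: (normal_bundle_split charK e_ge2 e_len l0_leN k_triv qE pE beS alS albe n1E homG G0 clsG).
Qed.

End MainTheorem.

Theorem corollary1p2 (K : closedFieldType) (charK : [pchar K] =i pred0)
  (e n d : nat) (e_ge2 : (2 <= e)%N) (e_len : (e <= n)%N) (d_ge4 : (4 <= d)%N)
  (k : seq int)
  (kE :
    (exists a b : nat -> nat,
       (\sum_(1 <= i < e.-1) a i + \sum_(e.+1 <= j < n.+1) b j
          = e * (d - 1) - 2)%N /\
       k = [seq e%:Z + 2%:Z - (a i)%:Z | i <- index_iota 1 e.-1]
           ++ [seq e%:Z - (b j)%:Z | j <- index_iota e.+1 n.+1])
    \/
    ((e < n - 1)%N /\
     exists b : nat -> nat,
       (\sum_(e.+2 <= j < n.+1) b j = e * (d - 1))%N /\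
       k = nseq (e - 1) (e%:Z + 2%:Z)
           ++ [seq e%:Z - (b j)%:Z | j <- index_iota e.+2 n.+1])) :
  exists F : {mpoly K[n.+1]},
    [/\ smooth_hypersurface d F,
        vanishes_on_rnc e F &
        isomorphic (normal_bundle e F) (split_bundle e n k)].
Proof.
have nth_map_iota (f : nat -> int) i j l : (l < j - i)%N ->
    nth 0 [seq f x | x <- index_iota i j] l = f (l + i)%N.
  by move=> lt_l; rewrite (nth_map 0%N) ?size_iota // nth_iota // addnC.
have shift3 (f : nat -> nat) i j :
    (\sum_(i <= l < j) f l.+3 = \sum_(i + 3 <= l < j + 3) f l)%N.
  by rewrite big_addn addnK; apply: eq_bigr => l _; rewrite addn3.
have n3E : (n - 2 + 3 = n.+1)%N by lia.
have eE : (e * (d - 1) + e = d * e)%N by rewrite mulnC -mulSnr; congr (_ * _)%N; lia.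
case: kE => [[a [b [sum_ab kE]]]|[lt_en [b [sum_b kE]]]].
- have n3 : (3 <= n)%N.
    rewrite ltnNge; apply/negP => le_n2; have [e2 n2] : e = 2 /\ n = 2 by lia.
    by move: sum_ab; rewrite e2 n2 !big_geq //; lia.
  have szk : size k = (n - 2)%N by rewrite kE size_cat !size_map !size_iota; lia.
  pose p l := if (l < e - 2)%N then a l.+1 else b l.+3.
  apply: (@exists_hypersurface K e n d charK e_ge2 e_len d_ge4 k 0 p); rewrite ?szk //.
  + by lia.
  + by rewrite orbT.
  + move=> l lt_l; rewrite kE nth_cat size_map size_iota /p /Ndeg.
    have -> : (e.-1 - 1 = e - 2)%N by lia.
    have [lt_le|lt_le] := ltnP l (e - 2); rewrite nth_map_iota; try lia.
      by rewrite addn1; case: ifP => h; lia.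
    rewrite (_ : (l - (e - 2) + e.+1)%N = l.+3); last by lia.
    by case: ifP => h; lia.
  + rewrite (big_cat_nat (n := e - 2)) //=; last by lia.
    rewrite (_ : \sum_(0 <= i < e - 2) p i = \sum_(1 <= i < e.-1) a i)%N; last first.
      rewrite (_ : e.-1 = (e - 2).+1) ?big_add1 /=; last by lia.
      by apply: eq_big_nat => i lt_i; rewrite /p; case: ltnP => //; lia.
    rewrite (_ : \sum_(e - 2 <= i < n - 2) p i = \sum_(e.+1 <= j < n.+1) b j)%N; last first.
      have e3E : (e - 2 + 3 = e.+1)%N by lia.
      rewrite -e3E -n3E -shift3; apply: eq_big_nat => i /andP[le_i _].
      by rewrite /p ltnNge le_i.
    have le2 : (2 <= e * (d - 1))%N by rewrite (leq_trans e_ge2) // leq_pmulr; lia.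
    rewrite sum_ab /Ndeg; case: ifP => [_|]; last by lia.
    by rewrite -eE; move: (e * (d - 1))%N le2 => m le2; lia.
have szk : size k = (n - 2)%N by rewrite kE size_cat size_nseq size_map size_iota; lia.
apply: (@exists_hypersurface K e n d charK e_ge2 e_len d_ge4 k e.-1 (fun l => b l.+3));
  rewrite ?szk; try lia.
- move=> l lt_l; rewrite kE nth_cat size_nseq /Ndeg lt_l subn1 lt_l nth_nseq lt_l.
  by lia.
- move=> l lt_l; rewrite kE nth_cat size_nseq /Ndeg.
  have [lt_le|le_l] := ltnP l (e - 1); first by lia.
  rewrite nth_map_iota; last by lia.
  rewrite (_ : (l - (e - 1) + e.+2)%N = l.+3); last by lia.
  by case: ifP => h; lia.
rewrite (_ : \sum_(e.-1 <= i < n - 2) b i.+3 = \sum_(e.+2 <= j < n.+1) b j)%N; last first.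
  have e3E : (e.-1 + 3 = e.+2)%N by lia.
  by rewrite -e3E -n3E shift3.
by rewrite sum_b /Ndeg ltnn eE.
Qed.
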